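(* Let $K$ be a field of characteristic zero. Let $H=(H_1,H_2,H_3)\in K[x,y,z]^3$ satisfy $H(0)=0$. Suppose that the Jacobian matrix $JH$ is nilpotent and that the components $H_1,H_2,H_3$ are linearly independent over $K$. Then there exist linearly independent linear forms $\ell_1,\ell_2\in(K^3)^*$ such that the polynomials $\ell_1(H)$ and $\ell_2(H)$ are algebraically dependent over $K$.
   Context: For $H\in K[x,y,z]^3$, $JH$ denotes the $3\times 3$ matrix of partial derivatives $(\partial H_i/\partial x_j)$ with $(x_1,x_2,x_3)=(x,y,z)$, regarded as a matrix over $K[x,y,z]$. For a linear form $\ell(U,V,W)=aU+bV+cW$ with $a,b,c\in K$, $\ell(H)=aH_1+bH_2+cH_3$. The components of $H$ are linearly independent over $K$ if $\ell(H)\ne 0$ for every nonzero constant linear form $\ell\in (K^3)^*$. Two polynomials $f,g$ are algebraically dependent over $K$ if $R(f,g)=0$ for some nonzero $R\in K[S,T]$. *)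

(* Defs.v *)
From mathcomp Require Import all_boot all_algebra.
From mathcomp Require Import mpoly.

Set Implicit Arguments.
Unset Strict Implicit.
Unset Printing Implicit Defensive.

Import GRing.Theory.
Local Open Scope ring_scope.

Definition jacobian (K : fieldType) (n : nat) (H : 'I_n -> {mpoly K[n]}) :
    'M[{mpoly K[n]}]_n :=
  \matrix_(i < n, j < n) (H i)^`M(j).

Definition nilpotent_mx (R : comNzRingType) (n : nat) (A : 'M[R]_n) : Prop :=
  exists k : nat, A ^+ k = 0.

(* A linear form on K^n is given by the row vector of its coefficients. *)
Definition linear_form_app (K : fieldType) (n : nat) (l : 'rV[K]_n)
    (H : 'I_n -> {mpoly K[n]}) : {mpoly K[n]} :=
  \sum_(i < n) l 0 i *: H i.

Definition components_lin_indep (K : fieldType) (n : nat)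
    (H : 'I_n -> {mpoly K[n]}) : Prop :=
  forall l : 'rV[K]_n, l != 0 -> linear_form_app l H != 0.

Definition alg_dependent (K : fieldType) (n : nat) (f g : {mpoly K[n]}) : Prop :=
  exists2 R : {mpoly K[2]}, R != 0 & R \mPo [tuple f; g] = 0.

(* Main.v *)
Require Import Defs.
From mathcomp Require Import all_boot all_algebra.
From mathcomp Require Import mpoly.
From mathcomp Require Import ring zify.

Set Implicit Arguments.
Unset Strict Implicit.
Unset Printing Implicit Defensive.

Import GRing.Theory.
Local Open Scope ring_scope.

(** The components of [H] are viewed as elements [a], [b], [f] of the field [L]
    of rational functions in [x], [y], [z].  When their gradients are pairwise
    parallel, any two forms will do.  Otherwise the image of [H] is a surface on
    which [f] is a function of [a] and [b], with partial derivatives [P] and [Q].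
    It is enough to find a fixed plane, with constant normal vector
    [(k1, k2, k3)], that contains every normal direction [(P, Q, -1)] of the
    surface ([normals_planar], [gauss_dependent]): the linear forms orthogonal to
    [k] then have pairwise parallel gradients, and polynomials with parallel
    gradients are algebraically dependent ([parallel_gradients_dependent]).

    The dual frame [d1], [d2], [d3] of the coordinates [a], [b], [x] turns
    nilpotency into geometry ([frame_exists], [fibre_direction], [M_e]).  The
    kernel [M] of [d3] consists of the functions that are constant on the fibres
    of [H].  The second invariant of the Jacobian matrix vanishes exactly when
    [z = P x + Q y + c] with [c] in [M], so that each fibre lies in a plane; its
    trace vanishes exactly when the fibre is, in that plane, the conic [e] = const
    whose quadratic part is the second fundamental form [d1 P], [d2 P], [d2 Q] of
    the surface.  The cofactor [v] of the Jacobian matrix is a polynomial, and its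
    inverse [N / B] is again an explicit function on the conic; this limits which
    conics can occur.

    If the second fundamental form is zero, [P] and [Q] are constants.  If it has
    rank one, the surface is developable, and it is a cylinder, whose normals
    are orthogonal to its rulings ([rank_one_constant_ruling]), unless the
    direction of the rulings varies.  In that case the fibres are lines or
    parabolas.  Lines are excluded by a parity of vanishing orders
    ([planes_absurd]), and parabolas by a localization argument: over the field of
    functions that are constant on the rulings, the polynomial functions lie in a
    ring in which the residues of simple poles are restricted
    ([fibre_ring_residue]), and [a] has a forbidden pole ([parabolas_absurd]).

    If the second fundamental form has rank two there is a contradiction.  Pairs of
    lines have a singular point, where [1 / v] has a pole ([line_pair_absurd]).  On
    a smooth conic, [N] is a non-constant unit of a ring of functions graded by the
    derivation along the fibre.  Hence that derivation has a rational eigenvalue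
    ([finite_weight_unit], [asymptotic_rational]), the equation of the conic splits
    as [t * t' = kap], and [N] is a monomial in [t] ([N_monomial]).  Comparing low
    powers of [t] shows that one family of asymptotic curves of the surface
    consists of straight lines ([ruling_equations]).  The preimage of a ruling is a
    quadric, and the localization argument applies again ([quadric_exceptional]),
    except when the pole of [a] lies at infinity on each of these quadrics; the
    denominator of that pole is then a non-constant polynomial, which would have to
    be invertible ([exceptional_absurd]).

    The rank of the second fundamental form is not changed by a shear, which
    provides the general position [d2 Q <> 0] used in the last two cases
    ([transverse_normals_planar]). *)

(** * Consequences of linear combinations of equations *)

Section LinearCombinations.

Variables (R : comNzRingType).

Lemma eq_lc1 (k s t u w : R) : s = t -> u - w = k * (s - t) -> u = w.
Proof. by move=> -> /eqP; rewrite subrr mulr0 subr_eq0 => /eqP. Qed.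

Lemma eq_lc2 (k s t k' s' t' u w : R) : s = t -> s' = t' ->
  u - w = k * (s - t) + k' * (s' - t') -> u = w.
Proof. by move=> -> -> /eqP; rewrite !subrr !mulr0 addr0 subr_eq0 => /eqP. Qed.

Lemma eq_lc3 (k s t k' s' t' k'' s'' t'' u w : R) : s = t -> s' = t' -> s'' = t'' ->
  u - w = k * (s - t) + k' * (s' - t') + k'' * (s'' - t'') -> u = w.
Proof. by move=> -> -> -> /eqP; rewrite !subrr !mulr0 !addr0 subr_eq0 => /eqP. Qed.

Lemma eq_lc4 (k1 s1 t1 k2 s2 t2 k3 s3 t3 k4 s4 t4 u w : R) :
  s1 = t1 -> s2 = t2 -> s3 = t3 -> s4 = t4 ->
  u - w = k1 * (s1 - t1) + k2 * (s2 - t2) + k3 * (s3 - t3) + k4 * (s4 - t4) -> u = w.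
Proof. by move=> -> -> -> -> /eqP; rewrite !subrr !mulr0 !addr0 subr_eq0 => /eqP. Qed.

End LinearCombinations.

(** * Derivations of a field and polynomials over their kernels *)

Section Derivations.

Variable L : fieldType.

Definition derivation (d : L -> L) : Prop :=
  (forall u v, d (u + v) = d u + d v) /\
  (forall u v, d (u * v) = d u * v + u * d v).

Section OneDerivation.

Variables (d : L -> L) (hd : derivation d).

Lemma derD u v : d (u + v) = d u + d v. Proof. by case: hd. Qed.

Lemma derM u v : d (u * v) = d u * v + u * d v. Proof. by case: hd. Qed.

Lemma der0 : d 0 = 0.
Proof. by apply: (addrI (d 0)); rewrite -derD !addr0. Qed.

Lemma der1 : d 1 = 0.
Proof.
have h := derM 1 1; rewrite !mulr1 mul1r in h.
by apply: (addrI (d 1)); rewrite addr0 -h.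
Qed.

Lemma derN u : d (- u) = - d u.
Proof. by apply: (addrI (d u)); rewrite -derD !subrr der0. Qed.

Lemma derB u v : d (u - v) = d u - d v.
Proof. by rewrite derD derN. Qed.

Lemma derMn u n : d (u *+ n) = d u *+ n.
Proof. by elim: n => [|n ih]; rewrite ?mulr0n ?der0 // !mulrS derD ih. Qed.

Lemma der_nat n : d n%:R = 0.
Proof. by rewrite derMn der1 mul0rn. Qed.

Lemma derV u : d u^-1 = - (d u / u ^+ 2).
Proof.
have [->|u0] := eqVneq u 0; first by rewrite invr0 der0 mul0r oppr0.
apply: (mulfI u0); have := derM u u^-1; rewrite divff // der1 => h.
have -> : u * d u^-1 = - (d u * u^-1) by apply/eqP; rewrite -addr_eq0 addrC -h.
by field.
Qed.

Lemma derX u n : d (u ^+ n) = n%:R * u ^+ n.-1 * d u.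
Proof.
elim: n => [|[|n] ih]; first by rewrite expr0 der1 mul0r mul0r.
  by rewrite expr1 mulr1 mul1r.
by rewrite exprS derM ih /= (exprS u n); ring.
Qed.

Lemma derX2 u : d (u ^+ 2) = 2 * u * d u.
Proof. by rewrite derX expr1. Qed.

Lemma derX3 u : d (u ^+ 3) = 3 * u ^+ 2 * d u.
Proof. by rewrite derX. Qed.

Lemma der_sum (I : Type) (r : seq I) (F : I -> L) :
  d (\sum_(i <- r) F i) = \sum_(i <- r) d (F i).
Proof.
by elim: r => [|i r ih]; rewrite ?big_nil ?der0 // !big_cons derD ih.
Qed.

Lemma der_div0 u v : d u = 0 -> d v = 0 -> d (u / v) = 0.
Proof. by move=> hu hv; rewrite derM derV hu hv !mul0r oppr0 mulr0 addr0. Qed.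

Definition derE := (derD, derB, derN, derM, derV, derX2, derX3, der_nat, der0, der1).

End OneDerivation.

Lemma derivation_comb d1 d2 s1 s2 : derivation d1 -> derivation d2 ->
  derivation (fun u => s1 * d1 u + s2 * d2 u).
Proof.
move=> h1 h2; split=> u v; first by rewrite (derD h1) (derD h2); ring.
by rewrite (derM h1) (derM h2); ring.
Qed.

Lemma derivation_scale d s : derivation d -> derivation (fun u => s * d u).
Proof.
by move=> h; split=> u v; rewrite ?(derD h) ?(derM h); ring.
Qed.

Definition kerpoly (d : L -> L) (p : {poly L}) : Prop := forall i, d p`_i = 0.

Section KerPoly.

Variables (d : L -> L) (hd : derivation d).

Lemma kerpoly0 : kerpoly d 0.
Proof. by move=> i; rewrite coef0 der0. Qed.

Lemma kerpolyC c : d c = 0 -> kerpoly d c%:P.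
Proof. by move=> hc i; rewrite coefC; case: ifP => _ //; apply: der0. Qed.

Lemma kerpolyX : kerpoly d 'X.
Proof. by move=> i; rewrite coefX; apply: der_nat. Qed.

Lemma kerpolyD p q : kerpoly d p -> kerpoly d q -> kerpoly d (p + q).
Proof. by move=> hp hq i; rewrite coefD derD // hp hq addr0. Qed.

Lemma kerpolyN p : kerpoly d p -> kerpoly d (- p).
Proof. by move=> hp i; rewrite coefN derN // hp oppr0. Qed.

Lemma kerpolyB p q : kerpoly d p -> kerpoly d q -> kerpoly d (p - q).
Proof. by move=> hp hq; apply: kerpolyD => //; apply: kerpolyN. Qed.

Lemma kerpolyM p q : kerpoly d p -> kerpoly d q -> kerpoly d (p * q).
Proof.
move=> hp hq i; rewrite coefM der_sum // big1_seq // => j _.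
by rewrite derM // hp hq mul0r mulr0 addr0.
Qed.

Lemma kerpolyXn n : kerpoly d 'X^n.
Proof. by move=> i; rewrite coefXn; apply: der_nat. Qed.

Lemma kerpoly_deriv p : kerpoly d p -> kerpoly d p^`().
Proof. by move=> hp i; rewrite coef_deriv derMn // hp mul0rn. Qed.

Lemma der_horner_ker p u : kerpoly d p -> d p.[u] = p^`().[u] * d u.
Proof.
elim/poly_ind: p => [|p c ih] hp; first by rewrite deriv0 !horner0 mul0r der0.
have hp' : kerpoly d p.
  by move=> i; have := hp i.+1; rewrite coefD coefMX coefC addr0.
have hc : d c = 0 by have := hp 0%N; rewrite coefD coefMX coefC add0r.
rewrite derivD derivM derivX derivC addr0 mulr1 !hornerE derD // derM // ih // hc.
ring.
Qed.

End KerPoly.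

Section CharZero.

Hypothesis char0 : [pchar L] =i pred0.

Lemma natf_neq0 n : (n.+1%:R : L) != 0.
Proof. by rewrite ((pcharf0P L).1 char0). Qed.

(** Differentiating an equation of least degree gives one of smaller degree, so
    an element that is not a constant of [d] is transcendental over the
    constants. *)
Lemma ker_transcendental d u p : derivation d -> d u != 0 ->
  kerpoly d p -> p.[u] = 0 -> p = 0.
Proof.
move=> hd du; have [n] := ubnP (size p); elim: n p => // n ih p sp hp pu.
have h' : p^`().[u] = 0.
  apply: (mulIf du); rewrite mul0r -(der_horner_ker hd u hp) pu; exact: der0.
have p'0 : p^`() = 0.
  have [->|p0] := eqVneq p 0; first by rewrite deriv0.
  apply: ih => //; last exact: kerpoly_deriv.
  by apply: leq_trans (lt_size_deriv p0) _; rewrite -ltnS.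
have cp : p = (p`_0)%:P.
  apply/polyP=> -[|i]; rewrite coefC //=.
  have := congr1 (fun q : {poly L} => q`_i) p'0; rewrite coef_deriv coef0.
  move/eqP; rewrite -mulr_natr mulf_eq0 (negPf (natf_neq0 _)) orbF.
  by move/eqP.
by move: pu; rewrite cp hornerC => ->.
Qed.

Lemma ker_indep4 d u c0 c1 c2 c3 : derivation d -> d u != 0 ->
  d c0 = 0 -> d c1 = 0 -> d c2 = 0 -> d c3 = 0 ->
  c0 + c1 * u + c2 * u ^+ 2 + c3 * u ^+ 3 = 0 ->
  [/\ c0 = 0, c1 = 0, c2 = 0 & c3 = 0].
Proof.
move=> hd du k0 k1 k2 k3 e0.
have p0 : Poly [:: c0; c1; c2; c3] = 0.
  apply: (ker_transcendental hd du).
    by move=> i; rewrite coef_Poly; case: i => [|[|[|[|i]]]] //=; rewrite nth_nil der0.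
  by rewrite horner_Poly /= -[RHS]e0; ring.
have ci i : (Poly [:: c0; c1; c2; c3])`_i = 0 by rewrite p0 coef0.
by split; [have := ci 0%N|have := ci 1%N|have := ci 2%N|have := ci 3%N]; rewrite coef_Poly.
Qed.

(** [polyrep d w F]: the element [F] lies in [k[w]], where [k] is the field of
    constants of [d]. *)
Definition polyrep (d : L -> L) (w F : L) : Prop :=
  exists2 p, kerpoly d p & F = p.[w].

Section PolyRep.

Variables (d : L -> L) (w : L) (hd : derivation d).

Lemma polyrepC c : d c = 0 -> polyrep d w c.
Proof. by move=> hc; exists c%:P; rewrite ?hornerC //; apply: kerpolyC. Qed.

Lemma polyrepX : polyrep d w w.
Proof. by exists 'X; rewrite ?hornerX //; apply: kerpolyX. Qed.

Lemma polyrepD F G : polyrep d w F -> polyrep d w G -> polyrep d w (F + G).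
Proof.
move=> [p hp ->] [q hq ->]; exists (p + q); last by rewrite hornerD.
exact: kerpolyD.
Qed.

Lemma polyrepM F G : polyrep d w F -> polyrep d w G -> polyrep d w (F * G).
Proof.
move=> [p hp ->] [q hq ->]; exists (p * q); last by rewrite hornerM.
exact: kerpolyM.
Qed.

Lemma polyrepN F : polyrep d w F -> polyrep d w (- F).
Proof.
move=> [p hp ->]; exists (- p); last by rewrite hornerN.
exact: kerpolyN.
Qed.

Lemma polyrepB F G : polyrep d w F -> polyrep d w G -> polyrep d w (F - G).
Proof. by move=> hF hG; apply: polyrepD => //; apply: polyrepN. Qed.

Lemma polyrepXn F n : polyrep d w F -> polyrep d w (F ^+ n).
Proof.
move=> hF; elim: n => [|n ih]; first by rewrite expr0; apply/polyrepC/der1.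
by rewrite exprS; apply: polyrepM.
Qed.

(** Powers of [w] are independent over the constants of [d]. *)
Lemma polyrep_low F c0 c1 c2 : d w != 0 ->
  d c0 = 0 -> d c1 = 0 -> d c2 = 0 -> polyrep d w F ->
  c0 + c1 * w + c2 * w ^+ 2 + w ^+ 3 * F = 0 -> [/\ c0 = 0, c1 = 0 & c2 = 0].
Proof.
move=> dw k0 k1 k2 [p hp ->] e0.
have p0 : c0%:P + c1%:P * 'X + c2%:P * 'X^2 + 'X^3 * p = 0.
  apply: (ker_transcendental hd dw).
    apply: kerpolyD => //; last by apply: kerpolyM => //; apply: kerpolyXn.
    apply: kerpolyD => //; last by apply: kerpolyM; [|exact: kerpolyC|exact: kerpolyXn].
    apply: kerpolyD => //; last by apply: kerpolyM; [|exact: kerpolyC|exact: kerpolyX].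
    exact: kerpolyC.
  by rewrite !(hornerD, hornerM, hornerC, hornerX, hornerXn).
have ci i : (c0%:P + c1%:P * 'X + c2%:P * 'X^2 + 'X^3 * p)`_i = 0 by rewrite p0 coef0.
have := ci 0%N; have := ci 1%N; have := ci 2%N.
rewrite !coefD !coefCM !coefC !coefX !coefXn !coefXnM /=.
by rewrite !mulr0 !mulr1 !addr0 !add0r.
Qed.

(** Degrees add under multiplication, so a unit has degree zero. *)
Lemma polyrep_unit F G : d w != 0 ->
  polyrep d w F -> polyrep d w G -> F * G = 1 -> d F = 0.
Proof.
move=> dw [p hp ->] [q hq ->] e.
have pq : p * q = 1.
  apply/eqP; rewrite -subr_eq0; apply/eqP.
  apply: (ker_transcendental hd dw); last by rewrite hornerD hornerN hornerM hornerC e subrr.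
  by apply: kerpolyB => //; [apply: kerpolyM | apply/kerpolyC/der1].
have : size p == 1%N.
  have /eqP := congr1 (fun r : {poly L} => size r) pq.
  rewrite size_poly1 size_mul_eq1; by case/andP.
move/size_poly1P=> [c _ pc]; rewrite pc hornerC.
by have := hp 0%N; rewrite pc coefC.
Qed.

End PolyRep.

(** After clearing denominators, the two polynomials divide a power of the
    indeterminate. *)
Lemma laurent_unit_monomial d w F G i j : derivation d -> d w != 0 -> w != 0 ->
  polyrep d w (F * w ^+ i) -> polyrep d w (G * w ^+ j) -> F * G = 1 ->
  exists c n, [/\ d c = 0, c != 0 & F * w ^+ i = c * w ^+ n].
Proof.
move=> hd dw w0 [p hp ep] [q hq eq] FG.
have pq : p * q = 'X^(i + j).
  apply/eqP; rewrite -subr_eq0; apply/eqP; apply: (ker_transcendental hd dw).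
    by apply: kerpolyB => //; [apply: kerpolyM | apply: kerpolyXn].
  rewrite hornerD hornerN hornerM hornerXn -ep -eq exprD.
  by rewrite mulrACA FG mul1r subrr.
have [m _ pm] : exists2 m, (m <= i + j)%N & p %= ('X - 0%:P) ^+ m.
  have : p %| ('X - 0%:P) ^+ (i + j) by rewrite subr0 -pq dvdp_mulr.
  by case/dvdp_exp_XsubCP=> m; exists m.
move: pm; rewrite subr0 => /eqpP [[a b] /= /andP[a0 b0] /(congr1 (fun r => a^-1 *: r))].
rewrite !scalerA mulVf // scale1r => epm.
have hc : d (a^-1 * b) = 0.
  by have := hp m; rewrite epm coefZ coefXn eqxx mulr1.
exists (a^-1 * b), m; split=> //; first by rewrite mulf_neq0 ?invr_eq0.
by rewrite ep epm hornerZ hornerXn.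
Qed.

End CharZero.

End Derivations.

(** * A localization argument for polynomials in two variables *)

Section TwoVariables.

Variables (L : fieldType) (char0 : [pchar L] =i pred0).
Variables (d d' : L -> L) (hd : derivation d) (hd' : derivation d').
Variables T0 T1 : L.
Hypothesis jac_neq0 : d T0 * d' T1 - d' T0 * d T1 != 0.

Definition constant2 u := d u = 0 /\ d' u = 0.

Lemma constant2D u u' : constant2 u -> constant2 u' -> constant2 (u + u').
Proof. by move=> [e1 e2] [e3 e4]; split; rewrite derD // ?e1 ?e2 ?e3 ?e4 addr0. Qed.

Lemma constant2M u u' : constant2 u -> constant2 u' -> constant2 (u * u').
Proof.
by move=> [e1 e2] [e3 e4]; split; rewrite derM // ?e1 ?e2 ?e3 ?e4 mul0r mulr0 addr0.
Qed.

Lemma constant2N u : constant2 u -> constant2 (- u).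
Proof. by move=> [e1 e2]; split; rewrite derN // ?e1 ?e2 oppr0. Qed.

Lemma constant2V u : constant2 u -> constant2 u^-1.
Proof. by move=> [e1 e2]; split; rewrite derV // ?e1 ?e2 mul0r oppr0. Qed.

Lemma constant2_nat n : constant2 n%:R.
Proof. by split; rewrite der_nat. Qed.

Lemma constant2X u n : constant2 u -> constant2 (u ^+ n).
Proof.
move=> hu; elim: n => [|n ih]; first exact: (constant2_nat 1).
by rewrite exprS; apply: constant2M.
Qed.

Definition constant2_poly (p : {poly {poly L}}) : Prop :=
  forall i, kerpoly d p`_i /\ kerpoly d' p`_i.

Definition eval2 (p : {poly {poly L}}) : L := p.[T1%:P].[T0].

(** The Jacobian determinant of [T0] and [T1] makes them algebraically
    independent over the common constants. *)
Lemma eval2_inj p : constant2_poly p -> eval2 p = 0 -> p = 0.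
Proof.
move=> hp; rewrite /eval2 => ev.
(* [E] kills [T0] and the common constants, but not [T1] *)
pose E u := d T0 * d' u + (- d' T0) * d u.
have hE : derivation E by apply: derivation_comb.
have ET1 : E T1 != 0 by rewrite /E mulNr.
pose q := map_poly (horner_eval T0) p.
have qi i : q`_i = (p`_i).[T0] by rewrite coef_map_id0 // /horner_eval horner0.
have hq : kerpoly E q.
  move=> i; rewrite qi /E; have [h1 h2] := hp i.
  by rewrite (der_horner_ker hd T0 h1) (der_horner_ker hd' T0 h2); ring.
have q0 : q = 0.
  apply: (ker_transcendental char0 hE ET1 hq).
  rewrite -ev -[p.[_].[_]]/(horner_eval T0 p.[T1%:P]) -horner_map /=.
  by rewrite /horner_eval hornerC.
apply/polyP=> i; rewrite coef0.
have pi0 : (p`_i).[T0] = 0 by rewrite -qi q0 coef0.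
have [h1 h2] := hp i.
have [dT0|dT0] := eqVneq (d T0) 0; last exact: (ker_transcendental char0 hd dT0).
apply: (ker_transcendental char0 hd' _ h2 pi0).
by apply: contraNneq jac_neq0 => ->; rewrite dT0 !mul0r subrr.
Qed.

Lemma constant2_polyD p q :
  constant2_poly p -> constant2_poly q -> constant2_poly (p + q).
Proof.
by move=> hp hq i; case: (hp i) (hq i) => a b [a' b']; rewrite coefD; split;
  apply: kerpolyD.
Qed.

Lemma constant2_polyN p : constant2_poly p -> constant2_poly (- p).
Proof. by move=> hp i; case: (hp i) => a b; rewrite coefN; split; apply: kerpolyN. Qed.

Lemma kerpoly_sum (e : L -> L) (I : Type) (r : seq I) (F : I -> {poly L}) :
  derivation e -> (forall i, kerpoly e (F i)) -> kerpoly e (\sum_(i <- r) F i).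
Proof.
move=> he h; elim: r => [|i r ih]; rewrite ?big_nil ?big_cons.
  exact: kerpoly0.
exact: kerpolyD.
Qed.

Lemma constant2_polyM p q :
  constant2_poly p -> constant2_poly q -> constant2_poly (p * q).
Proof.
move=> hp hq i; rewrite coefM; split; apply: kerpoly_sum => // j;
  have [a a'] := hp j; have [b b'] := hq (i - j)%N; exact: kerpolyM.
Qed.

Lemma constant2_polyC p : kerpoly d p -> kerpoly d' p -> constant2_poly p%:P.
Proof.
by move=> h1 h2 i; rewrite coefC; case: ifP => _; split=> //; apply: kerpoly0.
Qed.

Lemma constant2_polyXn n : constant2_poly 'X^n.
Proof.
by move=> i; rewrite coefXn -polyC_natr; split; apply: kerpolyC; rewrite ?der_nat.
Qed.

Lemma eval2D p q : eval2 (p + q) = eval2 p + eval2 q.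
Proof. by rewrite /eval2 !hornerD. Qed.

Lemma eval2N p : eval2 (- p) = - eval2 p.
Proof. by rewrite /eval2 !hornerN. Qed.

Lemma eval2M p q : eval2 (p * q) = eval2 p * eval2 q.
Proof. by rewrite /eval2 !hornerM. Qed.

Lemma eval2C p : eval2 p%:P = p.[T0].
Proof. by rewrite /eval2 hornerC. Qed.

Lemma eval2Xn n : eval2 'X^n = T1 ^+ n.
Proof. by rewrite /eval2 hornerXn -rmorphXn /= hornerC. Qed.

Definition poly2rep (R : L) : Prop := exists2 r, constant2_poly r & R = eval2 r.

Lemma poly2repC c : constant2 c -> poly2rep c.
Proof.
case=> h1 h2; exists c%:P%:P; last by rewrite eval2C hornerC.
by apply: constant2_polyC; apply: kerpolyC.
Qed.

Lemma poly2rep_T0 : poly2rep T0.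
Proof.
exists 'X%:P; last by rewrite eval2C hornerX.
by apply: constant2_polyC; apply: kerpolyX.
Qed.

Lemma poly2rep_T1 : poly2rep T1.
Proof.
by exists 'X^1; [apply: constant2_polyXn | rewrite eval2Xn expr1].
Qed.

Lemma poly2repD R R' : poly2rep R -> poly2rep R' -> poly2rep (R + R').
Proof.
move=> [r hr ->] [r' hr' ->]; exists (r + r'); last by rewrite eval2D.
exact: constant2_polyD.
Qed.

Lemma poly2repM R R' : poly2rep R -> poly2rep R' -> poly2rep (R * R').
Proof.
move=> [r hr ->] [r' hr' ->]; exists (r * r'); last by rewrite eval2M.
exact: constant2_polyM.
Qed.

Variable q0 : {poly L}.

(** The ring generated over the common constants by [T0], [T1] and
    [q0(T0) / T1]: Laurent polynomials in [T1] in which the coefficient of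
    the [m]-th negative power is divisible by [q0 ^+ m]. *)
Definition fibre_ring (F : L) : Prop :=
  exists n p, [/\ constant2_poly p, F * T1 ^+ n = eval2 p
                & forall i, q0 ^+ (n - i) %| p`_i].

Lemma fibre_ring_shift F n p m :
  [/\ constant2_poly p, F * T1 ^+ n = eval2 p & forall i, q0 ^+ (n - i) %| p`_i] ->
  [/\ constant2_poly (p * 'X^m), F * T1 ^+ (n + m) = eval2 (p * 'X^m)
    & forall i, q0 ^+ (n + m - i) %| (p * 'X^m)`_i].
Proof.
case=> hp e dv; split; first by apply: constant2_polyM => //; apply: constant2_polyXn.
  by rewrite eval2M eval2Xn -e exprD mulrA.
move=> i; rewrite coefMXn; case: ltnP => im; first exact: dvdp0.
by rewrite -{1}(subnK im) subnDr.
Qed.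

Lemma fibre_ringD F G : fibre_ring F -> fibre_ring G -> fibre_ring (F + G).
Proof.
move=> [n [p /(@fibre_ring_shift _ _ _) hp]] [m [q /(@fibre_ring_shift _ _ _) hq]].
have [p1 p2 p3] := hp m; have [r1 r2 r3] := hq n.
exists (n + m)%N, (p * 'X^m + q * 'X^n); split.
- exact: constant2_polyD.
- by rewrite mulrDl p2 addnC r2 eval2D.
- by move=> i; rewrite coefD dvdp_add // addnC.
Qed.

Lemma fibre_ringM F G : fibre_ring F -> fibre_ring G -> fibre_ring (F * G).
Proof.
move=> [n [p [p1 p2 p3]]] [m [q [r1 r2 r3]]].
exists (n + m)%N, (p * q); split; first exact: constant2_polyM.
  by rewrite eval2M -p2 -r2 exprD mulrACA.
move=> i; rewrite coefM; apply: (big_ind (fun u => _ %| u)) => [|u v|j _].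
- exact: dvdp0.
- exact: dvdp_add.
have := dvdp_mul (p3 j) (r3 (i - j)%N); rewrite -exprD; apply: dvdp_trans.
by apply: dvdp_exp2l; have := ltn_ord j; clear; lia.
Qed.

Lemma fibre_ring_quotient x R :
  poly2rep R -> kerpoly d q0 -> kerpoly d' q0 ->
  x * T1 = q0.[T0] + T1 * R -> fibre_ring x.
Proof.
move=> [r hr ->] h1 h2 e; exists 1%N, (q0%:P + 'X * r); split.
- apply: constant2_polyD; first exact: constant2_polyC.
  by apply: constant2_polyM => //; have := constant2_polyXn 1; rewrite expr1.
- by rewrite expr1 e eval2D eval2C eval2M -['X]expr1 eval2Xn expr1.
- case=> [|i]; last by rewrite subSS sub0n expr0 dvd1p.
  by rewrite expr1 coefD coefC coefXM addr0.
Qed.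

Lemma fibre_ring_poly2rep R : poly2rep R -> fibre_ring R.
Proof.
by move=> [r hr ->]; exists 0%N, r; split=> //; rewrite ?expr0 ?mulr1 // => i;
  rewrite sub0n expr0 dvd1p.
Qed.

Lemma fibre_ringC c : constant2 c -> fibre_ring c.
Proof. by move/poly2repC; apply: fibre_ring_poly2rep. Qed.

(** The residue [g(T0)] is the coefficient of the first negative power of [T1]. *)
Lemma fibre_ring_residue w g h :
  kerpoly d g -> kerpoly d' g -> constant2 h ->
  fibre_ring w -> w * T1 = g.[T0] + h * T1 -> q0 %| g.
Proof.
move=> g1 g2 [h1 h2] [n [p [hp e dv]]] ew.
have : p * 'X = (g%:P + h%:P%:P * 'X) * 'X^n.
  apply/eqP; rewrite -subr_eq0; apply/eqP; apply: eval2_inj.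
    have hX : constant2_poly 'X by have := constant2_polyXn 1; rewrite expr1.
    apply: constant2_polyD; first exact: constant2_polyM.
    apply: constant2_polyN; apply: constant2_polyM; last exact: constant2_polyXn.
    apply: constant2_polyD; first exact: constant2_polyC.
    apply: constant2_polyM => //.
    by apply: constant2_polyC; apply: kerpolyC.
  have eX : eval2 'X = T1 by have := eval2Xn 1; rewrite !expr1.
  rewrite eval2D eval2N !eval2M eval2D eval2M !eval2C eX eval2Xn -e hornerC.
  by rewrite mulrAC ew subrr.
move/(congr1 (fun r : {poly {poly L}} => r`_n)).
rewrite mulrDl coefD !coefMX coefMXn ltnn subnn coefC eqxx.
rewrite -mulrA -exprS coefMXn ltnSn addr0.
case: n e dv => [|n] e dv /=; first by move<-; apply: dvdp0.
by move<-; have := dv n; rewrite subSnn expr1.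
Qed.

End TwoVariables.

(** * Parity of vanishing orders *)

Section Parity.

Variables (L : fieldType) (char0 : [pchar L] =i pred0).
Variables (dd yy : L -> L) (hdd : derivation dd) (hyy : derivation yy).
Variables (O : L -> Prop) (xi : L).
Hypotheses (yy_xi : yy xi = 1) (xi_neq0 : xi != 0) (dd_xi : dd xi != 0).
Hypothesis commutator : forall u, yy (dd u) = dd (yy u) - xi^-1 * dd u.
Hypothesis O_dd : forall F, O F -> O (dd F).
Hypothesis O_polyrep : forall F, O F -> polyrep yy xi F.

(** [F] has a zero of order exactly [e] along [xi = 0]. *)
Definition xi_order (F : L) (e : nat) : Prop :=
  exists p, [/\ kerpoly yy p, F = xi ^+ e * p.[xi] & p`_0 != 0].

Lemma yy_xi_neq0 : yy xi != 0. Proof. by rewrite yy_xi oner_eq0. Qed.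

Lemma xi_order_unique F e e' : xi_order F e -> xi_order F e' -> e = e'.
Proof.
wlog lt_ee' : e e' / (e < e')%N.
  move=> h h1 h2; case: (ltngtP e e') => // lt_ee'; first exact: h.
  by apply/esym; apply: h.
move=> [p [hp -> p0]] [q [hq e1 q0]].
suff : p = 'X^(e' - e) * q.
  move/(congr1 (fun r : {poly L} => r`_0)); rewrite coefXnM subn_gt0 lt_ee'.
  by move/eqP; rewrite (negPf p0).
apply/eqP; rewrite -subr_eq0; apply/eqP.
apply: (ker_transcendental char0 hyy yy_xi_neq0).
  by apply: kerpolyB => //; apply: kerpolyM => //; apply: kerpolyXn.
apply: (mulfI (expf_neq0 e xi_neq0)).
rewrite mulr0 hornerD hornerN hornerM hornerXn mulrBr e1 mulrA -exprD.
by rewrite subnKC ?subrr // ltnW.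
Qed.

Lemma xi_order_exists F : F != 0 -> polyrep yy xi F -> exists e, xi_order F e.
Proof.
move=> F0 [p hp ep]; rewrite {F}ep in F0 *.
elim/poly_ind: p hp F0 => [|p c ih] hp F0; first by rewrite horner0 eqxx in F0.
have [c0|c0] := eqVneq c 0; last first.
  exists 0%N, (p * 'X + c%:P); split=> //; first by rewrite expr0 mul1r.
  by rewrite coefD coefMX coefC add0r.
have hp' : kerpoly yy p.
  by move=> i; have := hp i.+1; rewrite coefD coefMX coefC addr0.
move: F0; rewrite c0 !hornerE mulf_eq0 negb_or => /andP[F0 _].
have [e [q [q1 q2 q3]]] := ih hp' F0.
by exists e.+1, q; split=> //; rewrite q2 exprSr mulrAC.
Qed.

Lemma xi_order_mul F e : xi_order F e -> xi_order (xi * F) e.+1.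
Proof. by move=> [p [p1 -> p3]]; exists p; split; rewrite // exprS mulrA. Qed.

Lemma xi_order_neq0 F e : xi_order F e -> F != 0.
Proof.
move=> [p [p1 -> p3]]; rewrite mulf_neq0 ?expf_neq0 //.
apply: contraNneq p3 => h.
by rewrite (ker_transcendental char0 hyy yy_xi_neq0 p1 h) coef0.
Qed.

Lemma yy_xi_dd u : yy u = 0 -> yy (xi * dd u) = 0.
Proof.
by move=> h; rewrite derM // yy_xi commutator h der0 //; field.
Qed.

Lemma yy_xi_dd_xi : yy (xi * dd xi) = 0.
Proof.
by rewrite derM // yy_xi commutator yy_xi der1 //; field.
Qed.

(** Differentiating the coefficients loses one power of [xi], and differentiating
    the power of [xi] itself loses two: [xi * dd xi] is a constant of [yy]. *)
Lemma xi_dd_horner p : kerpoly yy p ->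
  exists2 q, kerpoly yy q
           & xi * dd p.[xi] = q.[xi] + xi * dd xi * p^`().[xi].
Proof.
elim/poly_ind: p => [|p c ih] hp.
  exists 0; first exact: kerpoly0.
  by rewrite deriv0 !horner0 der0 // !mulr0 addr0.
have hp' : kerpoly yy p.
  by move=> i; have := hp i.+1; rewrite coefD coefMX coefC addr0.
have hc : yy c = 0 by have := hp 0%N; rewrite coefD coefMX coefC add0r.
have [q hq eq] := ih hp'.
exists (q * 'X + (xi * dd c)%:P).
  apply: kerpolyD => //; last by apply: kerpolyC => //; apply: yy_xi_dd.
  by apply: kerpolyM => //; apply: kerpolyX.
rewrite derivD derivM derivX derivC addr0 mulr1 !hornerE.
rewrite (derD hdd) (derM hdd) mulrDr mulrDr mulrA eq; ring.
Qed.

(** The derivation [dd] lowers a positive order along [xi = 0] by exactly two,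
    and keeps polynomial functions polynomial. *)
Lemma xi_order_even e F : O F -> xi_order F e -> ~~ odd e.
Proof.
have [n] := ubnP e; elim: n e F => // n ih [//|e] F lt_en OF ordF.
have [p [hp eF p0]] := ordF.
have [q hq eq] := xi_dd_horner hp.
pose r := (e.+1%:R * (xi * dd xi))%:P * p + 'X * q + (xi * dd xi)%:P * 'X * p^`().
have ordG : xi_order (xi * dd F) e.
  have hX := kerpolyX hyy; have hl := yy_xi_dd_xi; have hp' := kerpoly_deriv hyy hp.
  exists r; split.
  - apply: kerpolyD => //; last by do 2?[apply: kerpolyM => //]; apply: kerpolyC.
    apply: kerpolyD => //; apply: kerpolyM => //; apply: kerpolyC => //.
    by rewrite derM // hl der_nat // mul0r mulr0 addr0.
  - rewrite eF derM // derX // mulrDr [xi * (xi ^+ _ * _)]mulrCA eq /r !hornerE /= exprS.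
    by ring.
  rewrite /r !coefD coefCM -mulrA coefCM !coefXM mulr0 !addr0.
  by rewrite !mulf_neq0 ?natf_neq0.
have dF0 : dd F != 0 by have := xi_order_neq0 ordG; rewrite mulf_eq0 negb_or => /andP[].
have [e' ord'] := xi_order_exists dF0 (O_polyrep (O_dd OF)).
have ee' : e = e'.+1 := xi_order_unique ordG (xi_order_mul ord').
have : ~~ odd e' by apply: (ih e' (dd F)) => //; [rewrite ee' in lt_en; lia | apply: O_dd].
by rewrite ee' /= !negbK.
Qed.

(** [xi] has order one, and a quotient of even orders is even. *)
Lemma xi_not_quotient F G : O F -> O G -> G != 0 -> xi = F / G -> False.
Proof.
move=> OF OG G0 exi.
have eF : F = xi * G by rewrite exi divfK.
have [e ordG] := xi_order_exists G0 (O_polyrep OG).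
have := xi_order_even OF; rewrite eF => /(_ _ (xi_order_mul ordG)) /=.
by rewrite negbK; apply/negP/(xi_order_even OG).
Qed.

End Parity.

(** * Polynomial functions inside the field of rational functions *)

Section PolynomialFunctions.

Variable L : fieldType.

(** An inductive predicate, rather than a polynomial type, lets an inclusion of
    rings be checked on generators. *)
Inductive polyfun (C : L -> Prop) (x y z : L) : L -> Prop :=
| PolyfunC c : C c -> polyfun C x y z c
| PolyfunX : polyfun C x y z x
| PolyfunY : polyfun C x y z y
| PolyfunZ : polyfun C x y z z
| PolyfunD F G : polyfun C x y z F -> polyfun C x y z G -> polyfun C x y z (F + G)
| PolyfunM F G : polyfun C x y z F -> polyfun C x y z G -> polyfun C x y z (F * G).

Record coordinates (dx dy dz : L -> L) (x y z : L) : Prop := Coordinates {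
  derx : derivation dx;
  dery : derivation dy;
  derz : derivation dz;
  dxdy : forall u, dx (dy u) = dy (dx u);
  dxdz : forall u, dx (dz u) = dz (dx u);
  dydz : forall u, dy (dz u) = dz (dy u);
  dxx : dx x = 1; dxy : dx y = 0; dxz : dx z = 0;
  dyx : dy x = 0; dyy : dy y = 1; dyz : dy z = 0;
  dzx : dz x = 0; dzy : dz y = 0; dzz : dz z = 1 }.

Definition constant3 (dx dy dz : L -> L) (c : L) : Prop :=
  [/\ dx c = 0, dy c = 0 & dz c = 0].

Lemma polyfun_sub (C : L -> Prop) (x y z : L) (S : L -> Prop) :
  (forall c, C c -> S c) -> S x -> S y -> S z ->
  (forall F G, S F -> S G -> S (F + G)) -> (forall F G, S F -> S G -> S (F * G)) ->
  forall F, polyfun C x y z F -> S F.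
Proof. by move=> hC hx hy hz hD hM F; elim=> {F} //; auto. Qed.

Section Coordinates.

Variables (dx dy dz : L -> L) (x y z : L).
Hypothesis cs : coordinates dx dy dz x y z.
Local Notation C := (constant3 dx dy dz).
Local Notation O := (polyfun C x y z).

Let hx := derx cs.
Let hy := dery cs.
Let hz := derz cs.

Lemma constant3_0 : C 0.
Proof. by split; apply: der0. Qed.

Lemma constant3_1 : C 1.
Proof. by split; apply: der1. Qed.

Lemma constant3_nat n : C n%:R.
Proof. by split; apply: der_nat. Qed.

Lemma constant3N c : C c -> C (- c).
Proof. by case=> a b e; split; rewrite derN // ?a ?b ?e oppr0. Qed.

Lemma constant3D c c' : C c -> C c' -> C (c + c').
Proof.
by case=> a b e [a' b' e']; split; rewrite derD // ?a ?b ?e ?a' ?b' ?e' addr0.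
Qed.

Lemma constant3M c c' : C c -> C c' -> C (c * c').
Proof.
case=> a b e [a' b' e'].
by split; rewrite derM // ?a ?b ?e ?a' ?b' ?e' mul0r mulr0 addr0.
Qed.

Lemma polyfunN F : O F -> O (- F).
Proof.
move=> OF; rewrite -mulN1r; apply: PolyfunM => //; apply: PolyfunC.
by apply: constant3N; apply: constant3_1.
Qed.

Lemma polyfunB F G : O F -> O G -> O (F - G).
Proof. by move=> OF OG; apply: PolyfunD => //; apply: polyfunN. Qed.

Lemma polyfun_stable (d : L -> L) : derivation d ->
  (forall c, C c -> d c = 0) -> C (d x) -> C (d y) -> C (d z) ->
  forall F, O F -> O (d F).
Proof.
move=> hd dC dX dY dZ F; elim=> {F} [c hc||||F G OF ih OG ih'|F G OF ih OG ih'];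
  try exact: PolyfunC.
- by rewrite dC //; apply/PolyfunC/constant3_0.
- by rewrite derD //; apply: PolyfunD.
by rewrite derM //; apply: PolyfunD; apply: PolyfunM.
Qed.

Lemma polyfun_dx F : O F -> O (dx F).
Proof.
have [c0 c1] := (constant3_0, constant3_1).
apply: polyfun_stable; rewrite ?(dxx cs) ?(dxy cs) ?(dxz cs) //.
by move=> c [].
Qed.

Lemma polyfun_dy F : O F -> O (dy F).
Proof.
have [c0 c1] := (constant3_0, constant3_1).
apply: polyfun_stable; rewrite ?(dyx cs) ?(dyy cs) ?(dyz cs) //.
by move=> c [].
Qed.

Lemma polyfun_dz F : O F -> O (dz F).
Proof.
have [c0 c1] := (constant3_0, constant3_1).
apply: polyfun_stable; rewrite ?(dzx cs) ?(dzy cs) ?(dzz cs) //.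
by move=> c [].
Qed.

Lemma polyfun_polyrep d w : derivation d -> (forall c, C c -> d c = 0) ->
  polyrep d w x -> polyrep d w y -> polyrep d w z ->
  forall F, O F -> polyrep d w F.
Proof.
move=> hd dC rx ry rz; apply: polyfun_sub => //.
- by move=> c /dC; apply: polyrepC.
- by move=> F G; apply: polyrepD.
by move=> F G; apply: polyrepM.
Qed.

(** The polynomial functions are a polynomial ring in each coordinate over the
    constants of its partial derivative, so their units are constant. *)
Lemma polyfun_unit F G c : [pchar L] =i pred0 -> O F -> O G -> C c -> c != 0 ->
  F * G = c -> C F.
Proof.
move=> char0 OF OG Cc c0 FG.
have [c1 c2 c3] := Cc.
have OGc : O (G * c^-1).
  by apply: PolyfunM => //; apply: PolyfunC; split; rewrite derV // ?c1 ?c2 ?c3 mul0r oppr0.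
have FG1 : F * (G * c^-1) = 1 by rewrite mulrA FG divff.
have unit d w : derivation d -> (forall c', C c' -> d c' = 0) -> d w = 1 ->
    polyrep d w x -> polyrep d w y -> polyrep d w z -> d F = 0.
  move=> hd dC dw rx ry rz.
  have dw0 : d w != 0 by rewrite dw oner_neq0.
  apply: (polyrep_unit char0 hd dw0) FG1; exact: (polyfun_polyrep hd dC rx ry rz).
split.
- apply: (unit dx x) => //; rewrite ?(dxx cs) //; first by move=> c' [].
  + exact: polyrepX.
  + by apply: polyrepC; rewrite ?(dxy cs).
  by apply: polyrepC; rewrite ?(dxz cs).
- apply: (unit dy y) => //; rewrite ?(dyy cs) //; first by move=> c' [].
  + by apply: polyrepC; rewrite ?(dyx cs).
  + exact: polyrepX.
  by apply: polyrepC; rewrite ?(dyz cs).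
apply: (unit dz z) => //; rewrite ?(dzz cs) //; first by move=> c' [].
- by apply: polyrepC; rewrite ?(dzx cs).
- by apply: polyrepC; rewrite ?(dzy cs).
exact: polyrepX.
Qed.

End Coordinates.

End PolynomialFunctions.

(** * Parallel gradients and algebraic dependence *)

Section FirstDependence.

Variables (L : fieldType) (D : nat) (w : nat -> 'rV[L]_D).

(** Stopping at the first vector that depends on its predecessors makes the
    dependence, once normalised, unique. *)
Lemma first_dependence : exists k r, [/\ (k <= D)%N, r k = 1,
  \sum_(i < k.+1) r i *: w i = 0 &
  forall s : nat -> L, \sum_(i < k) s i *: w i = 0 -> forall i, (i < k)%N -> s i = 0].
Proof.
pose M k : 'M[L]_(k, D) := \matrix_(i < k) w i.
have ME k (s : nat -> L) : \sum_(i < k) s i *: w i = (\row_(i < k) s i) *m M k.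
  by rewrite mulmx_sum_row; apply: eq_bigr => i _; rewrite mxE rowK.
have exk : exists k, ~~ row_free (M k).
  by exists D.+1; rewrite /row_free neq_ltn ltnS rank_leq_col.
case: (ex_minnP exk) => -[|k] nfree kmin.
  by move: nfree; rewrite /row_free -leqn0 rank_leq_row.
have free : row_free (M k) by apply: contraT => /kmin; rewrite ltnn.
have uniq_s (s : nat -> L) : \sum_(i < k) s i *: w i = 0 -> forall i, (i < k)%N -> s i = 0.
  rewrite ME => e i ltik.
  have := row_free_inj free; move/(_ 1%N (\row_i0 s i0) 0); rewrite mul0mx => /(_ e).
  by move/rowP/(_ (Ordinal ltik)); rewrite !mxE.
have kD : (k <= D)%N.
  by move: free; rewrite /row_free => /eqP <-; apply: rank_leq_col.
have [r0 r0M r00] : exists2 r0 : 'rV[L]_(k.+1), r0 *m M k.+1 = 0 & r0 != 0.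
  move: nfree; rewrite -kermx_eq0 => /rowV0Pn[r0 /sub_kermxP]; by exists r0.
pose s i := r0 0 (inord i).
have sM : \sum_(i < k.+1) s i *: w i = 0.
  rewrite ME -[RHS]r0M; congr (_ *m _); apply/rowP=> i; rewrite mxE /s.
  by rewrite inord_val.
have sk : s k != 0.
  apply: contraNneq r00 => sk0; apply/eqP/rowP=> i; rewrite mxE.
  move: sM; rewrite big_ord_recr /= sk0 scale0r addr0 => /uniq_s sE.
  have [ltik|] := ltnP i k; first by rewrite -(inord_val i) -/(s i) sE.
  by move=> leki; rewrite -(inord_val i) -/(s i) -[RHS]sk0; congr (s _);
    apply/eqP; rewrite eqn_leq leki -ltnS ltn_ord.
exists k, (fun i => (s k)^-1 * s i); split=> //; first by rewrite mulVf.
under eq_bigr => i _ do rewrite -scalerA.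
by rewrite -scaler_sumr sM scaler0.
Qed.

End FirstDependence.

Section JacobianCriterion.

Variables (L : fieldType) (char0 : [pchar L] =i pred0).
Variables (dx dy dz : L -> L) (x y z : L).
Hypothesis cs : coordinates dx dy dz x y z.
Local Notation C := (constant3 dx dy dz).
Local Notation O := (polyfun C x y z).

Lemma size_exp_mul_leq (p q : {poly L}) b i : (i < b * b)%N ->
  (size (p ^+ (i %/ b)%N * q ^+ (i %% b)%N : {poly L})%R <= b * (size p + size q) + 1)%N.
Proof.
move=> ib; have b0 : (0 < b)%N by case: b ib.
have h1 : (i %/ b <= b)%N by rewrite ltnW // ltn_divLR.
have h2 : (i %% b <= b)%N by rewrite ltnW // ltn_pmod.
have e1 := size_poly_exp_leq p (i %/ b); have e2 := size_poly_exp_leq q (i %% b).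
have h1' : ((size p).-1 * (i %/ b) <= size p * b)%N by rewrite leq_mul ?leq_pred.
have h2' : ((size q).-1 * (i %% b) <= size q * b)%N by rewrite leq_mul ?leq_pred.
apply: leq_trans (size_polyMleq _ _) _.
move: (size (p ^+ _)%R) (size (q ^+ _)%R) e1 e2 => s1 s2 e1 e2.
by rewrite mulnDr (mulnC b) (mulnC b (size q)); move: e1 e2 h1' h2'; clear; lia.
Qed.

(** Powers of [f] and [g] are linearly dependent over the constants of [dx] by
    a count of degrees in [x]; the first dependence among them, normalised, is
    unique, so the derivations that kill [f] and [g] kill its coefficients. *)
Lemma parallel_gradients_dependent f g : O f -> O g -> dx f != 0 ->
  dx f * dy g = dy f * dx g -> dx f * dz g = dz f * dx g ->
  exists b k r, [/\ (k < b * b)%N, forall i, (i <= k)%N -> C (r i), r k = 1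
    & \sum_(i < k.+1) r i * (f ^+ (i %/ b)%N * g ^+ (i %% b)%N) = 0].
Proof.
move=> Of Og fx0 parxy parxz.
have hx := derx cs; have hy := dery cs; have hz := derz cs.
have dxC c : C c -> dx c = 0 by case.
have x0 : dx x != 0 by rewrite (dxx cs) oner_neq0.
have rep u : O u -> polyrep dx x u.
  apply: (polyfun_polyrep hx dxC); first exact: polyrepX.
    by apply: polyrepC; rewrite ?(dxy cs).
  by apply: polyrepC; rewrite ?(dxz cs).
have [p hp ep] := rep f Of; have [q hq eq] := rep g Og.
pose b := (size p + size q).+2; pose D := (b * (size p + size q) + 1)%N.
have ltDb : (D < b * b)%N.
  by rewrite /D /b; move: (size p + size q)%N => n; clear; nia.
pose mon i : {poly L} := p ^+ (i %/ b)%N * q ^+ (i %% b)%N.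
have kerXn (t : {poly L}) n : kerpoly dx t -> kerpoly dx (t ^+ n).
  move=> ht; elim: n => [|n ih]; first by rewrite expr0; apply: (kerpolyC hx (der1 hx)).
  by rewrite exprS; apply: kerpolyM.
have kmon i : kerpoly dx (mon i) by apply: (kerpolyM hx); apply: kerXn.
have [k [r [kD rk rel uniq_r]]] := first_dependence (fun i => poly_rV (mon i) : 'rV[L]_D).
have ltkb : (k < b * b)%N := leq_ltn_trans kD ltDb.
have smon i : (i <= k)%N -> (size (mon i) <= D)%N.
  by move=> leik; apply: size_exp_mul_leq; apply: leq_ltn_trans ltkb.
have relp n (s : nat -> L) : (n <= k.+1)%N ->
    (\sum_(i < n) s i *: (poly_rV (mon i) : 'rV[L]_D) = 0) <-> \sum_(i < n) s i *: mon i = 0.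
  move=> len; have -> : \sum_(i < n) s i *: (poly_rV (mon i) : 'rV[L]_D) =
      poly_rV (\sum_(i < n) s i *: mon i).
    by rewrite linear_sum; apply: eq_bigr => i _; rewrite linearZ.
  split=> [e|->]; last by rewrite linear0.
  rewrite -[LHS](@poly_rV_K _ D) ?e ?linear0 //.
  apply: leq_trans (size_sum _ _ _) _; apply/bigmax_leqP=> i _.
  apply: leq_trans (size_scale_leq _ _) _; apply: smon.
  by rewrite -ltnS (leq_trans (ltn_ord i)).
have /(relp k.+1 r (leqnn _)) relr := rel.
have uniq_p (s : nat -> L) : \sum_(i < k) s i *: mon i = 0 -> forall i, (i < k)%N -> s i = 0.
  by move=> /(relp k s (leqnSn _)); apply: uniq_r.
have shrink d : derivation d -> (forall i, (i <= k)%N -> d (r i) = 0) \/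
    (\sum_(i < k.+1) d (r i) *: mon i = 0) -> forall i, (i <= k)%N -> d (r i) = 0.
  move=> hd [//|]; rewrite big_ord_recr /= rk (der1 hd) scale0r addr0.
  move/(uniq_p (fun i => d (r i))) => e i; rewrite leq_eqVlt => /orP[/eqP ->|]; last exact: e.
  by rewrite rk der1.
have rx i : (i <= k)%N -> dx (r i) = 0.
  apply: shrink => //; right; apply/polyP=> j; rewrite coef0 coef_sum.
  have := congr1 (fun t : {poly L} => dx t`_j) relr; rewrite coef_sum coef0 (der0 hx) (der_sum hx).
  move=> e; rewrite -[RHS]e; apply: eq_bigr => i' _.
  by rewrite !coefZ (derM hx) kmon mulr0 addr0.
have hor (s : nat -> L) n : (\sum_(i < n) s i *: mon i).[x] =
    \sum_(i < n) s i * (f ^+ (i %/ b)%N * g ^+ (i %% b)%N).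
  rewrite horner_sum; apply: eq_bigr => i _.
  by rewrite hornerZ /mon hornerM !horner_exp -ep -eq.
have stage d : derivation d -> (forall u, dx (d u) = d (dx u)) -> dx f * d g = d f * dx g ->
    forall i, (i <= k)%N -> d (r i) = 0.
  move=> hd cd par; apply: shrink => //; right.
  apply: (ker_transcendental char0 hx x0).
    move=> j; rewrite coef_sum (der_sum hx) big1 // => i _.
    by rewrite coefZ (derM hx) kmon cd rx ?(der0 hd) -1?ltnS // mul0r mulr0 addr0.
  have relf := hor r k.+1; rewrite relr horner0 in relf.
  pose E u := 1 * d u + (- (d f / dx f)) * dx u.
  have hE : derivation E by apply: derivation_comb.
  have Ef : E f = 0 by rewrite /E; field.
  have Eg : E g = 0.
    apply: (mulfI fx0); rewrite mulr0 /E.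
    by apply: (eq_lc1 (k := 1) par); field.
  have EX u n : E u = 0 -> E (u ^+ n) = 0.
    by move=> eu; rewrite (derX hE) eu mulr0.
  have := congr1 E relf; rewrite (der0 hE) (der_sum hE) (hor (fun i => d (r i))) => e.
  rewrite [RHS]e; apply: eq_bigr => i _.
  rewrite (derM hE) (derM hE (f ^+ _)) !EX // /E (rx i) -1?ltnS //.
  by rewrite !mul1r !mulr0 !mul0r !addr0 mulr0 addr0.
exists b, k, r; split=> //; last by rewrite -hor relr horner0.
by move=> i leik; split; [apply: rx|apply: (stage dy)|apply: (stage dz)] => // u;
  rewrite ?(dxdy cs) ?(dxdz cs).
Qed.

End JacobianCriterion.

(** * Sums of eigenvectors of the square of a derivation *)

Section Spectrum.

Variables (L : fieldType) (char0 : [pchar L] =i pred0).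
Variables (D : L -> L) (hD : derivation D) (W : L).
Hypotheses (W0 : W != 0) (DW : D W = 0).

(** Over a field containing a root [w] of [W], these are the sums of eigenvectors
    of [D] for [j * w] and [- j * w].  In weight zero, [D (D u) = 0] would also
    admit logarithms, which would break the grading. *)
Definition weight (j : nat) (u : L) : Prop :=
  if j is 0 then D u = 0 else D (D u) = j%:R ^+ 2 * W * u.

Inductive weights_below (n : nat) : L -> Prop :=
| Below0 : weights_below n 0
| BelowD j u w : (j < n)%N -> weight j u -> weights_below n w ->
    weights_below n (u + w).

Lemma weight_DD j u : weight j u -> D (D u) = j%:R ^+ 2 * W * u.
Proof.
by case: j => [|j] //= ->; rewrite (der0 hD) expr2 !mul0r.
Qed.

Lemma weightZ j k u : D k = 0 -> weight j u -> weight j (k * u).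
Proof.
case: j => [|j] /= Dk h; first by rewrite (derM hD) Dk h mul0r mulr0 addr0.
by rewrite !(derM hD, derD hD) Dk h (der0 hD); ring.
Qed.

Lemma weightD j u u' : weight j u -> weight j u' -> weight j (u + u').
Proof.
case: j => [|j] /= h h'; first by rewrite (derD hD) h h' addr0.
by rewrite !(derD hD) h h'; ring.
Qed.

Lemma weight0 j : weight j 0.
Proof. by case: j => [|j] /=; rewrite !(der0 hD) ?mulr0. Qed.

Lemma below_weight n j u : (j < n)%N -> weight j u -> weights_below n u.
Proof. by move=> jn h; rewrite -[u]addr0; apply: BelowD jn h _; apply: Below0. Qed.

Lemma belowD n u u' : weights_below n u -> weights_below n u' -> weights_below n (u + u').
Proof.
by elim=> [|j t w jn h _ ih] hu'; rewrite ?add0r // -addrA; apply: BelowD jn h (ih hu').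
Qed.

Lemma belowZ n k u : D k = 0 -> weights_below n u -> weights_below n (k * u).
Proof.
move=> Dk; elim=> [|j t w jn h _ ih]; first by rewrite mulr0; apply: Below0.
by rewrite mulrDr; apply: BelowD jn _ ih; apply: weightZ.
Qed.

Lemma belowN n u : weights_below n u -> weights_below n (- u).
Proof. by move=> h; rewrite -mulN1r; apply: belowZ => //; rewrite (derN hD) (der1 hD) oppr0. Qed.

Lemma belowB n u u' : weights_below n u -> weights_below n u' -> weights_below n (u - u').
Proof. by move=> h h'; apply: belowD => //; apply: belowN. Qed.

Lemma below_leq n m u : (n <= m)%N -> weights_below n u -> weights_below m u.
Proof.
move=> nm; elim=> [|j t w jn h _ ih]; first exact: Below0.
by apply: BelowD _ h ih; apply: leq_trans nm.
Qed.

Lemma below_DD n u : weights_below n u -> weights_below n (D (D u)).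
Proof.
elim=> [|j t w jn h _ ih]; first by rewrite !(der0 hD); apply: Below0.
rewrite !(derD hD); apply: BelowD jn _ ih; rewrite (weight_DD h).
by apply: weightZ => //; rewrite !(derE hD) DW; ring.
Qed.

Lemma below0 u : weights_below 0 u -> u = 0.
Proof. by case. Qed.

(** [D (D u) - m ^ 2 * W * u] kills the part of weight [m] and rescales the
    others. *)
Lemma below_lower m u : weights_below m.+1 u ->
  weights_below m (D (D u) - m%:R ^+ 2 * W * u).
Proof.
elim=> [|j t w]; first by rewrite !(der0 hD) mulr0 subr0; apply: Below0.
rewrite ltnS => jm h _ ih.
have -> : D (D (t + w)) - m%:R ^+ 2 * W * (t + w) =
   (j%:R ^+ 2 * W - m%:R ^+ 2 * W) * t + (D (D w) - m%:R ^+ 2 * W * w).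
  by rewrite !(derD hD) (weight_DD h); ring.
have [ejm|ltjm] : j = m \/ (j < m)%N by lia.
  by rewrite ejm subrr mul0r add0r.
by apply: BelowD ltjm _ ih; apply: weightZ => //; rewrite !(derE hD) DW; ring.
Qed.

Lemma natf_sqr_sub_neq0 n m : (m < n)%N -> (n%:R ^+ 2 - m%:R ^+ 2 : L) != 0.
Proof.
move=> mn; rewrite -!natrX -natrB; last by rewrite leq_exp2r // ltnW.
have : (0 < n ^ 2 - m ^ 2)%N by rewrite subn_gt0 ltn_exp2r.
by case: (n ^ 2 - m ^ 2)%N => // k _; apply: natf_neq0.
Qed.

Lemma weight_below_eq0 n m u : (m <= n)%N -> weight n u -> weights_below m u -> u = 0.
Proof.
elim: m u => [|m ih] u mn hu bu; first exact: below0.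
have e : D (D u) - m%:R ^+ 2 * W * u = (n%:R ^+ 2 - m%:R ^+ 2) * W * u.
  by rewrite (weight_DD hu); ring.
have := below_lower bu; rewrite e => bu'.
have h' : weight n ((n%:R ^+ 2 - m%:R ^+ 2) * W * u).
  by apply: weightZ => //; rewrite !(derE hD) DW; ring.
have := ih _ (ltnW mn) h' bu' => /eqP.
by rewrite !mulf_eq0 (negPf W0) (negPf (natf_sqr_sub_neq0 mn)) => /eqP.
Qed.

Lemma below_split n u : weights_below n.+1 u ->
  exists t w, [/\ weight n t, weights_below n w & u = t + w].
Proof.
elim=> [|j t w]; first by exists 0, 0; split; rewrite ?addr0 //; [apply: weight0|apply: Below0].
rewrite ltnS => jn h _ [t' [w' [ht' hw' ->]]].
have [ejn|ltjn] : j = n \/ (j < n)%N by lia.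
  rewrite -ejn in ht' hw' *; exists (t + t'), w'; split; rewrite ?addrA //.
  exact: weightD.
exists t', (t + w'); split=> //; last by rewrite addrCA.
exact: BelowD ltjn h hw'.
Qed.

Lemma below_top n u : u != 0 -> weights_below n u ->
  exists j t w, [/\ weight j t, t != 0, weights_below j w & u = t + w].
Proof.
elim: n u => [|n ih] u u0 hu; first by rewrite (below0 hu) eqxx in u0.
have [t [w [ht hw eu]]] := below_split hu.
have [t0|t0] := eqVneq t 0; last by exists n, t, w.
by apply: (ih _ u0); rewrite eu t0 add0r.
Qed.

Lemma DD_eq0 n u : weights_below n u -> D (D u) = 0 -> D u = 0.
Proof.
elim: n u => [|n ih] u hu DDu; first by rewrite (below0 hu) (der0 hD).
have [t [w [ht hw eu]]] := below_split hu.
case: n ih hu ht hw => [|n] ih hu ht hw.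
  by rewrite eu (below0 hw) addr0.
suff t0 : t = 0 by apply: ih => //; rewrite eu t0 add0r.
have k0 : n.+1%:R ^+ 2 * W != 0 by rewrite mulf_neq0 ?expf_neq0 ?natf_neq0.
have et : t = - (n.+1%:R ^+ 2 * W)^-1 * D (D w).
  apply: (mulfI k0); rewrite mulNr mulrN mulVKf //.
  by apply: (eq_lc2 (k := 1) (k' := -1) DDu (weight_DD ht)); rewrite eu !(derD hD); ring.
apply: (weight_below_eq0 (leqnn _) ht); rewrite et.
apply: belowZ; last exact: below_DD.
have Dk : D (n.+1%:R ^+ 2 * W) = 0 by rewrite !(derE hD) DW; ring.
by rewrite (derN hD) (derV hD) Dk mul0r !oppr0.
Qed.

(** A product of eigenvectors of weights [i] and [j] splits into parts of weights
    [i + j] and [|i - j|]: with exponentials in place of eigenvectors, these are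
    the sums over equal and over opposite signs. *)

Section Product.

Variables (i j : nat) (u v : L).
Hypotheses (hu : weight i u) (hv : weight j v).

Let s := (u * v + D u * D v / (i%:R * j%:R * W)) / 2.
Let t := (u * v - D u * D v / (i%:R * j%:R * W)) / 2.

Let n2 : (2 : L) != 0 := natf_neq0 char0 1.

Let uv_st : u * v = s + t.
Proof.
rewrite /s /t; have -> (p q : L) : (p + q) / 2 + (p - q) / 2 = p by field.
by [].
Qed.

Hypotheses (i0 : (0 < i)%N) (j0 : (0 < j)%N).

Let i1 : (i%:R : L) != 0. Proof. by case: i i0 => // k _; apply: natf_neq0. Qed.
Let j1 : (j%:R : L) != 0. Proof. by case: j j0 => // k _; apply: natf_neq0. Qed.

Let D_uv : D (u * v) = D u * v + u * D v. Proof. exact: derM. Qed.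

Let D_DuDv : D (D u * D v) = i%:R ^+ 2 * W * u * D v + j%:R ^+ 2 * W * D u * v.
Proof. by rewrite (derM hD) (weight_DD hu) (weight_DD hv); ring. Qed.

Let DD_uv : D (D (u * v)) = (i%:R ^+ 2 + j%:R ^+ 2) * W * (u * v) + 2 * (D u * D v).
Proof. by rewrite D_uv (derD hD) !(derM hD) (weight_DD hu) (weight_DD hv); ring. Qed.

Let DD_DuDv : D (D (D u * D v)) = (i%:R ^+ 2 + j%:R ^+ 2) * W * (D u * D v)
  + 2 * i%:R ^+ 2 * j%:R ^+ 2 * W ^+ 2 * (u * v).
Proof.
rewrite D_DuDv (derD hD) !(derM hD) (weight_DD hu) (weight_DD hv) ?(derX2 hD) !(der_nat hD) DW.
ring.
Qed.

Let D_comb k1 k2 p q : D k1 = 0 -> D k2 = 0 -> D (k1 * p + k2 * q) = k1 * D p + k2 * D q.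
Proof. by move=> e1 e2; rewrite (derD hD) !(derM hD) e1 e2; ring. Qed.

Let D_half : D 2^-1 = 0.
Proof. by rewrite (derV hD) (der_nat hD) mul0r oppr0. Qed.

Let D_ijW : D (i%:R * j%:R * W)^-1 = 0.
Proof. by rewrite (derV hD) !(derM hD) !(der_nat hD) DW; ring. Qed.

Let stE (sg : L) : (u * v + sg * (D u * D v / (i%:R * j%:R * W))) / 2 =
   2^-1 * (u * v) + (2^-1 * sg * (i%:R * j%:R * W)^-1) * (D u * D v).
Proof. by field; rewrite n2 i1 j1 W0. Qed.

Let weight_s : weight (i + j) s.
Proof.
have -> : s = 2^-1 * (u * v) + (2^-1 * 1 * (i%:R * j%:R * W)^-1) * (D u * D v).
  by rewrite -stE mul1r.
have hk : D (2^-1 * 1 * (i%:R * j%:R * W)^-1) = 0.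
  by rewrite !(derM hD) D_half (der1 hD) D_ijW; ring.
have ij : (i + j)%N = (i + j).-1.+1 by lia.
rewrite /weight {1}ij !(D_comb _ _ D_half hk) DD_uv DD_DuDv natrD.
by field; rewrite n2 i1 j1 W0.
Qed.

Let below_t : weights_below (i + j) t.
Proof.
have et : t = 2^-1 * (u * v) + (2^-1 * (- 1) * (i%:R * j%:R * W)^-1) * (D u * D v).
  by rewrite -stE mulN1r.
have hk : D (2^-1 * (- 1) * (i%:R * j%:R * W)^-1) = 0.
  by rewrite !(derM hD) D_half (derN hD) (der1 hD) D_ijW; ring.
have h2 k : k%:R ^+ 2 = (i%:R - j%:R) ^+ 2 :> L -> (k < i + j)%N -> (0 < k)%N ->
    weights_below (i + j) t.
  move=> ek kij k0; apply: (below_weight kij); case: k k0 ek kij => // k _ ek _.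
  rewrite /weight ek et !(D_comb _ _ D_half hk) DD_uv DD_DuDv.
  by field; rewrite n2 i1 j1 W0.
have [lt_ij|[lt_ji|eij]] : (i < j)%N \/ (j < i)%N \/ i = j by lia.
- by apply: (h2 (j - i)%N); [rewrite natrB ?(ltnW lt_ij) //; ring|lia|lia].
- by apply: (h2 (i - j)%N); [rewrite natrB ?(ltnW lt_ji) //; ring|lia|lia].
apply: (below_weight (j := 0)); first lia.
rewrite /weight et (D_comb _ _ D_half hk) D_uv D_DuDv -eij.
by field; rewrite n2 i1 W0.
Qed.

Lemma below_mul_pos : weights_below (i + j).+1 (u * v).
Proof.
rewrite uv_st; apply: belowD; first exact: below_weight weight_s.
exact: below_leq below_t.
Qed.

(** The part of weight [i + j] of the product vanishes; differentiating this
    equation and eliminating [D v] leaves an equation for [D u] alone. *)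
Lemma leading_eigenvector : u != 0 -> v != 0 -> weights_below (i + j) (u * v) ->
  (D u) ^+ 2 = i%:R ^+ 2 * W * u ^+ 2.
Proof.
move=> u0 v0 huv.
have s0 : s = 0.
  apply: (weight_below_eq0 (leqnn _) weight_s).
  have -> : s = u * v - t by rewrite uv_st; ring.
  by apply: belowB.
have e1 : i%:R * j%:R * W * (u * v) + D u * D v = 0.
  have k0 : 2 * (i%:R * j%:R * W) != 0 by rewrite !mulf_neq0.
  rewrite -[RHS](mulr0 (2 * (i%:R * j%:R * W))) -s0 /s.
  by field; rewrite n2 i1 j1 W0.
have e2 : j%:R * (D u * v) + i%:R * (u * D v) = 0.
  have ij0 : (i%:R + j%:R : L) != 0.
    have ij : (i + j)%N = (i + j).-1.+1 by lia.
    by rewrite -natrD ij; apply: natf_neq0.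
  apply: (mulfI (mulf_neq0 ij0 W0)); rewrite mulr0.
  have := congr1 D e1; rewrite (derD hD) (derM hD) D_uv D_DuDv !(derM hD) !(der_nat hD) DW (der0 hD).
  by move=> e3; apply: (eq_lc1 (k := 1) e3); ring.
apply: (mulfI (mulf_neq0 j1 v0)).
by apply: (eq_lc2 (k := D u) (k' := - i%:R * u) e2 e1); ring.
Qed.

End Product.

Lemma below_mul_weight i j u v : weight i u -> weight j v -> weights_below (i + j).+1 (u * v).
Proof.
case: i => [|i] hu; first by move=> hv; apply: (below_weight (j := j)) => //; apply: weightZ.
case: j => [|j] hv; last exact: below_mul_pos.
rewrite addn0 mulrC; apply: (below_weight (j := i.+1)) => //; exact: weightZ.
Qed.

Lemma belowM n m u v : weights_below n.+1 u -> weights_below m.+1 v ->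
  weights_below (n + m).+1 (u * v).
Proof.
elim=> [|i t w]; first by rewrite mul0r => _; apply: Below0.
rewrite ltnS => le_in ht _ ih hv; rewrite mulrDl; apply: belowD (ih hv).
elim: hv => [|j t' w']; first by rewrite mulr0; apply: Below0.
rewrite ltnS => le_jm ht' _ ih'; rewrite mulrDr; apply: belowD ih'.
by apply: below_leq (below_mul_weight ht ht'); lia.
Qed.

Definition finite_weight u := exists n, weights_below n u.

Lemma finite_weightC k : D k = 0 -> finite_weight k.
Proof. by move=> h; exists 1%N; apply: (below_weight (j := 0)). Qed.

Lemma finite_weightD u v : finite_weight u -> finite_weight v -> finite_weight (u + v).
Proof.
move=> [n hn] [m hm]; exists (n + m)%N; apply: belowD.
  by apply: below_leq hn; lia.
by apply: below_leq hm; lia.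
Qed.

Lemma finite_weightM u v : finite_weight u -> finite_weight v -> finite_weight (u * v).
Proof.
move=> [n hn] [m hm]; exists (n + m).+1; apply: belowM.
  by apply: below_leq hn; lia.
by apply: below_leq hm; lia.
Qed.

(** The leading parts of a non-constant unit and of its inverse multiply to zero
    in the top weight, so they are eigenvectors of [D] itself, and the logarithmic
    derivative of such an eigenvector is, up to an integer, a root of [W]. *)
Lemma finite_weight_unit u v : finite_weight u -> finite_weight v ->
  u * v = 1 -> D u != 0 -> exists2 w, w ^+ 2 = W & D w = 0.
Proof.
move=> [n hn] [m hm] uv Du.
have u0 : u != 0 by apply: contraNneq (oner_neq0 L) => e; rewrite -uv e mul0r.
have v0 : v != 0 by apply: contraNneq (oner_neq0 L) => e; rewrite -uv e mulr0.
have [i [t [r [ht t0 hr eu]]]] := below_top u0 hn.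
have [j [t' [r' [ht' t'0 hr' ev]]]] := below_top v0 hm.
have i0 : (0 < i)%N.
  case: i ht hr => // ht hr; move: Du.
  by rewrite eu (below0 hr) addr0 ht eqxx.
have j0 : (0 < j)%N.
  case: j ht' hr' => // ht' hr'; move: Du.
  have -> : u = t'^-1 by apply: (mulIf v0); rewrite uv ev (below0 hr') addr0 mulVf.
  by rewrite (derV hD) ht' mul0r oppr0 eqxx.
have hi : (i = i.-1.+1)%N by lia.
have hj : (j = j.-1.+1)%N by lia.
have b1 : weights_below (i + j) 1.
  by apply: (below_weight (j := 0)); [lia | rewrite /= (der1 hD)].
have tt' : weights_below (i + j) (t * t').
  have -> : t * t' = 1 - t * r' - r * t' - r * r' by rewrite -uv eu ev; ring.
  have bt : weights_below i.+1 t by apply: below_weight ht.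
  have bt' : weights_below j.+1 t' by apply: below_weight ht'.
  rewrite hj in hr'; rewrite hi in hr.
  apply: belowB; first apply: belowB; first apply: belowB => //.
  - by apply: below_leq (belowM bt hr'); lia.
  - by apply: below_leq (belowM hr bt'); lia.
  by apply: below_leq (belowM hr hr'); lia.
have e := leading_eigenvector ht ht' i0 j0 t0 t'0 tt'.
have i1 : (i%:R : L) != 0 by rewrite hi natf_neq0.
exists (D t / (i%:R * t)); first by rewrite expr_div_n e; field; rewrite i1 t0.
have hw : D ((D t / (i%:R * t)) ^+ 2) = 0.
  have -> : (D t / (i%:R * t)) ^+ 2 = W by rewrite expr_div_n e; field; rewrite i1 t0.
  exact: DW.
have Dt0 : D t != 0.
  apply/eqP=> Dt; move: e; rewrite Dt expr0n /= => /esym/eqP.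
  by rewrite !mulf_eq0 (negPf i1) (negPf t0) (negPf W0).
move/eqP: hw; rewrite (derX2 hD) !mulf_eq0 (negPf (natf_neq0 char0 1)) (negPf Dt0) invr_eq0.
by rewrite mulf_eq0 (negPf i1) (negPf t0) /= => /eqP.
Qed.

End Spectrum.

(** * The frame adapted to a nilpotent Jacobian matrix of rank two *)

Section Frame.

Variable L : fieldType.

(** The frame dual to the differentials of [a], [b] and [x].  Since [P], [Q] and
    [c] are constants of [d3], the last equation is that of a plane containing the
    fibre. *)
Record adapted_frame (dx dy dz : L -> L) (x y z a b f : L)
    (d1 d2 d3 : L -> L) (P Q c : L) : Prop := AdaptedFrame {
  fr_der1 : derivation d1;
  fr_der2 : derivation d2;
  fr_der3 : derivation d3;
  fr_comm12 : forall u, d1 (d2 u) = d2 (d1 u);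
  fr_comm13 : forall u, d3 (d1 u) = d1 (d3 u);
  fr_comm23 : forall u, d3 (d2 u) = d2 (d3 u);
  fr_1a : d1 a = 1; fr_2a : d2 a = 0; fr_3a : d3 a = 0;
  fr_1b : d1 b = 0; fr_2b : d2 b = 1; fr_3b : d3 b = 0;
  fr_1x : d1 x = 0; fr_2x : d2 x = 0; fr_3x : d3 x = 1;
  fr_dx : forall u, dx u = d3 u + dx a * d1 u + dx b * d2 u;
  fr_dy : forall u, dy u = dy a * d1 u + dy b * d2 u;
  fr_dz : forall u, dz u = dz a * d1 u + dz b * d2 u;
  fr_1f : d1 f = P; fr_2f : d2 f = Q; fr_3f : d3 f = 0;
  fr_3c : d3 c = 0;
  fr_z : z = P * x + Q * y + c }.

(** Combinations of [dy] and [dz] are determined by their values on [a] and [b],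
    which makes the frame commute; [det0] gives [d3 f = 0], and [minors0] is then
    the equation [d3 c = 0]. *)
Lemma frame_exists (dx dy dz : L -> L) (x y z a b f : L) :
  coordinates dx dy dz x y z ->
  dy a * dz b - dz a * dy b != 0 ->
  (dy a * dz b - dz a * dy b) * dx f + (dz a * dx b - dx a * dz b) * dy f
    + (dx a * dy b - dy a * dx b) * dz f = 0 ->
  (dx a * dy b - dy a * dx b) + (dx a * dz f - dz a * dx f)
    + (dy b * dz f - dz b * dy f) = 0 ->
  exists d1 d2 d3 P Q c, adapted_frame dx dy dz x y z a b f d1 d2 d3 P Q c.
Proof.
move=> cs v0 det0 minors0; have hx := derx cs; have hy := dery cs; have hz := derz cs.
pose v := dy a * dz b - dz a * dy b.
pose d1 u := dz b / v * dy u + - dy b / v * dz u.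
pose d2 u := - dz a / v * dy u + dy a / v * dz u.
pose p3 := (dz a * dx b - dx a * dz b) / v.
pose q3 := (dx a * dy b - dy a * dx b) / v.
pose d3 u := 1 * dx u + 1 * (p3 * dy u + q3 * dz u).
have h1 : derivation d1 by apply: derivation_comb.
have h2 : derivation d2 by apply: derivation_comb.
have h3 : derivation d3 by apply: derivation_comb => //; apply: derivation_comb.
have d1a : d1 a = 1 by rewrite /d1 /v; field.
have d1b : d1 b = 0 by rewrite /d1 /v; field.
have d2a : d2 a = 0 by rewrite /d2 /v; field.
have d2b : d2 b = 1 by rewrite /d2 /v; field.
have d3a : d3 a = 0 by rewrite /d3 /p3 /q3 /v; field.
have d3b : d3 b = 0 by rewrite /d3 /p3 /q3 /v; field.
have d1x : d1 x = 0 by rewrite /d1 (dyx cs) (dzx cs) !mulr0 addr0.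
have d2x : d2 x = 0 by rewrite /d2 (dyx cs) (dzx cs) !mulr0 addr0.
have d3x : d3 x = 1 by rewrite /d3 (dyx cs) (dzx cs) (dxx cs) !mulr0 addr0 mulr0 addr0 mulr1.
have only0 (E : L -> L) s t : (forall u, E u = s * dy u + t * dz u) ->
    E a = 0 -> E b = 0 -> forall u, E u = 0.
  move=> eE; rewrite !eE => ea eb u.
  have s0 : s = 0.
    apply: (mulIf v0); rewrite mul0r.
    have -> : s * v = dz b * (s * dy a + t * dz a) - dz a * (s * dy b + t * dz b).
      by rewrite /v; ring.
    by rewrite ea eb !mulr0 subrr.
  have t0 : t = 0.
    apply: (mulIf v0); rewrite mul0r.
    have -> : t * v = dy a * (s * dy b + t * dz b) - dy b * (s * dy a + t * dz a).
      by rewrite /v; ring.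
    by rewrite ea eb !mulr0 subrr.
  by rewrite eE s0 t0 !mul0r addr0.
have comm (p q p' q' : L) (s s' : L) (e e' : L -> L) :
    derivation e -> derivation e' -> s = s \/ s' = 0 ->
    (forall u, e u = p * dy u + q * dz u) ->
    (forall u, e' u = s' * dx u + p' * dy u + q' * dz u) -> e s' = 0 ->
    e' (e a) = e (e' a) -> e' (e b) = e (e' b) -> forall u, e' (e u) = e (e' u).
  move=> he he' _ ee ee' es' ha hb u; apply/eqP; rewrite -subr_eq0; apply/eqP.
  pose E u := e' (e u) - e (e' u).
  apply: (only0 E (e' p - e p') (e' q - e q')).
  - move=> w; rewrite /E [e w]ee [e' w]ee' !(derD he, derD he', derM he, derM he').
    rewrite es' !ee !ee' (dxdy cs) (dxdz cs) (dydz cs); ring.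
  - by rewrite /E ha subrr.
  - by rewrite /E hb subrr.
have e1 u : d1 u = dz b / v * dy u + - dy b / v * dz u by [].
have e2 u : d2 u = - dz a / v * dy u + dy a / v * dz u by [].
have e2' u : d2 u = 0 * dx u + - dz a / v * dy u + dy a / v * dz u.
  by rewrite e2 mul0r add0r.
have e3 u : d3 u = 1 * dx u + p3 * dy u + q3 * dz u by rewrite /d3; ring.
have c12 u : d1 (d2 u) = d2 (d1 u).
  apply/esym; apply: (comm _ _ _ _ 0 _ d1 d2) e1 e2' _ _ _ _ => //; rewrite ?der0 //; first by left.
    by rewrite d1a d2a der1 // der0.
  by rewrite d1b d2b der1 // der0.
have c13 u : d3 (d1 u) = d1 (d3 u).
  apply: (comm _ _ _ _ 0 _ d1 d3) e1 e3 _ _ _ _ => //; rewrite ?der1 //; first by left.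
    by rewrite d1a d3a der1 // der0.
  by rewrite d1b d3b !der0.
have c23 u : d3 (d2 u) = d2 (d3 u).
  apply: (comm _ _ _ _ 0 _ d2 d3) e2 e3 _ _ _ _ => //; rewrite ?der1 //; first by left.
    by rewrite d2a d3a !der0.
  by rewrite d2b d3b der1 // der0.
have fdx u : dx u = d3 u + dx a * d1 u + dx b * d2 u.
  by rewrite /d1 /d2 /d3 /p3 /q3 /v; field.
have fdy u : dy u = dy a * d1 u + dy b * d2 u by rewrite /d1 /d2 /v; field.
have fdz u : dz u = dz a * d1 u + dz b * d2 u by rewrite /d1 /d2 /v; field.
have d3f : d3 f = 0.
  by apply: (mulfI v0); rewrite mulr0 -[RHS]det0 /d3 /p3 /q3 /v; field.
have d3P : d3 (d1 f) = 0 by rewrite c13 d3f der0.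
have d3Q : d3 (d2 f) = 0 by rewrite c23 d3f der0.
exists d1, d2, d3, (d1 f), (d2 f), (z - d1 f * x - d2 f * y); split=> //; last by ring.
rewrite (derB h3) (derB h3) (derM h3 (d1 f)) (derM h3 (d2 f)) d3P d3Q d3x.
have -> : d3 z = q3.
  by rewrite e3 (dxz cs) (dyz cs) (dzz cs); ring.
have -> : d3 y = p3.
  by rewrite e3 (dxy cs) (dyy cs) (dzy cs); ring.
rewrite /q3 /p3.
have hxf : dx f = dx a * d1 f + dx b * d2 f by rewrite fdx d3f add0r.
move: minors0; rewrite hxf (fdy f) (fdz f) => minors0.
apply: (mulfI v0); rewrite mulr0 -[RHS]minors0.
by rewrite /v; field.
Qed.

End Frame.

(** * The fibres of a map with nilpotent Jacobian matrix *)

Section NilpotentFrame.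

Variables (L : fieldType) (char0 : [pchar L] =i pred0).
Variables (dx dy dz : L -> L) (x y z a b f : L).
Hypothesis cs : coordinates dx dy dz x y z.
Variables (d1 d2 d3 : L -> L) (P Q c : L).
Hypothesis fr : adapted_frame dx dy dz x y z a b f d1 d2 d3 P Q c.
Local Notation C := (constant3 dx dy dz).
Local Notation O := (polyfun C x y z).
Local Notation v := (dy a * dz b - dz a * dy b).
Hypotheses (Oa : O a) (Ob : O b) (Of : O f).
Hypotheses (v0 : v != 0) (trace0 : dx a + dy b + dz f = 0).

(** [A] and [B] are the derivatives of [P x + Q y + c] along [d1] and [d2] with
    [x] and [y] held fixed, [e] is the equation of the fibre in its plane, and
    [B / N] turns out to be the cofactor [v]. *)
Variables (A B e N : L).
Hypothesis eA : A = d1 c + x * d1 P + y * d2 P.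
Hypothesis eB : B = d2 c + x * d2 P + y * d2 Q.
Hypothesis eN : N = B * (B * d1 y - A * d2 y).
Hypothesis ee : e = d1 c * x + d2 c * y
  + (d1 P * x ^+ 2 + 2 * d2 P * x * y + d2 Q * y ^+ 2) / 2.

Hypothesis fracO : forall u, exists F G, [/\ O F, O G, G != 0 & u = F / G].

(** The Gauss map of the image surface takes its values in a line. *)
Definition gauss_dependent : Prop :=
  exists k1 k2 k3, [/\ C k1, C k2, C k3, (k1 != 0) || (k2 != 0)
                     & k1 * P + k2 * Q = k3].

Let h1 := fr_der1 fr.
Let h2 := fr_der2 fr.
Let h3 := fr_der3 fr.
Let c12 := fr_comm12 fr.
Let c13 := fr_comm13 fr.
Let c23 := fr_comm23 fr.

Let n2 : (2 : L) != 0 := natf_neq0 char0 1.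
Let n3 : (3 : L) != 0 := natf_neq0 char0 2.
Let n4 : (4 : L) != 0 := natf_neq0 char0 3.

Lemma M_d1 u : d3 u = 0 -> d3 (d1 u) = 0.
Proof. by move=> hu; rewrite c13 hu der0. Qed.

Lemma M_d2 u : d3 u = 0 -> d3 (d2 u) = 0.
Proof. by move=> hu; rewrite c23 hu der0. Qed.

Lemma M_P : d3 P = 0.
Proof. by rewrite -(fr_1f fr) c13 (fr_3f fr) der0. Qed.

Lemma M_Q : d3 Q = 0.
Proof. by rewrite -(fr_2f fr) c23 (fr_3f fr) der0. Qed.

Let M_c := fr_3c fr.

Lemma d1Q : d1 Q = d2 P.
Proof. by rewrite -(fr_2f fr) -(fr_1f fr) c12. Qed.

Lemma constant_d c' : C c' -> [/\ d1 c' = 0, d2 c' = 0 & d3 c' = 0].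
Proof.
case=> hcx hcy hcz.
have := fr_dy fr c'; have := fr_dz fr c'; have := fr_dx fr c'.
rewrite hcx hcy hcz => ex ez ey.
have e1 : d1 c' = 0.
  apply: (mulIf v0); rewrite mul0r.
  have -> : d1 c' * v = dz b * (dy a * d1 c' + dy b * d2 c')
     - dy b * (dz a * d1 c' + dz b * d2 c') by ring.
  by rewrite -ey -ez !mulr0 subrr.
have e2 : d2 c' = 0.
  apply: (mulIf v0); rewrite mul0r.
  have -> : d2 c' * v = dy a * (dz a * d1 c' + dz b * d2 c')
     - dz a * (dy a * d1 c' + dy b * d2 c') by ring.
  by rewrite -ey -ez !mulr0 subrr.
by split=> //; rewrite ex e1 e2 !mulr0 !addr0.
Qed.

Lemma d_constant c' : d1 c' = 0 -> d2 c' = 0 -> d3 c' = 0 -> C c'.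
Proof.
by move=> e1 e2 e3; split; [rewrite (fr_dx fr)|rewrite (fr_dy fr)|rewrite (fr_dz fr)];
  rewrite e1 e2 ?e3 !mulr0 ?addr0.
Qed.

Lemma d1z : d1 z = A + Q * d1 y.
Proof. by rewrite (fr_z fr) !(derE h1) (fr_1x fr) d1Q eA; ring. Qed.

Lemma d2z : d2 z = B + Q * d2 y.
Proof. by rewrite (fr_z fr) !(derE h2) (fr_2x fr) eB; ring. Qed.

Lemma d3z : d3 z = P + Q * d3 y.
Proof. by rewrite (fr_z fr) !(derE h3) (fr_3x fr) M_P M_Q M_c; ring. Qed.

Lemma jac_y : [/\ 0 = d3 y + dx a * d1 y + dx b * d2 y,
  1 = dy a * d1 y + dy b * d2 y & 0 = dz a * d1 y + dz b * d2 y].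
Proof.
by split; [rewrite -(fr_dx fr) (dxy cs)|rewrite -(fr_dy fr) (dyy cs)|
  rewrite -(fr_dz fr) (dzy cs)].
Qed.

(** The derivatives of both sides of [z = P x + Q y + c]. *)
Lemma jac_AB : [/\ dx a * A + dx b * B = - P, dy a * A + dy b * B = - Q
  & dz a * A + dz b * B = 1].
Proof.
have [ex ey ez] := jac_y; split.
- have := fr_dx fr z; rewrite d1z d2z d3z (dxz cs) => ee0.
  by apply: (eq_lc2 (k := - 1) (k' := Q) ee0 ex); ring.
- have := fr_dy fr z; rewrite d1z d2z (dyz cs) => ee0.
  by apply: (eq_lc2 (k := - 1) (k' := Q) ee0 ey); ring.
have := fr_dz fr z; rewrite d1z d2z (dzz cs) => ee0.
by apply: (eq_lc2 (k := - 1) (k' := Q) ee0 ez); ring.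
Qed.

(** The Jacobian matrices of [(a, b)] in [(y, z)] and of [(y, z)] in [(a, b)] are
    inverse to each other. *)
Lemma v_inv : v * (B * d1 y - A * d2 y) = 1.
Proof.
have [ex ey ez] := jac_y; have [eP eQ e1] := jac_AB.
have -> : v * (B * d1 y - A * d2 y) =
  (dy a * d1 y + dy b * d2 y) * (dz a * A + dz b * B)
  - (dy a * A + dy b * B) * (dz a * d1 y + dz b * d2 y) by ring.
by rewrite -ey -ez e1 eQ; ring.
Qed.

(** The trace of the Jacobian matrix, up to the factor [v]. *)
Lemma fibre_direction : A + B * d3 y = 0.
Proof.
have [ex ey ez] := jac_y; have [eP eQ e1] := jac_AB.
have [Dt eD] : exists t, t = B * d1 y - A * d2 y by eexists.
have xa : dx a * Dt = - B * d3 y + P * d2 y.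
  by apply: (eq_lc2 (k := - B) (k' := - d2 y) ex eP); rewrite eD; ring.
have yb : dy b * Dt = - A - Q * d1 y.
  by apply: (eq_lc2 (k := A) (k' := d1 y) ey eQ); rewrite eD; ring.
have za : dz a * Dt = - d2 y.
  by apply: (eq_lc2 (k := - B) (k' := - d2 y) ez e1); rewrite eD; ring.
have zb : dz b * Dt = d1 y.
  by apply: (eq_lc2 (k := A) (k' := d1 y) ez e1); rewrite eD; ring.
have zf : dz f * Dt = - P * d2 y + Q * d1 y.
  rewrite (fr_dz fr) (fr_1f fr) (fr_2f fr).
  by apply: (eq_lc2 (k := P) (k' := Q) za zb); ring.
have : (dx a + dy b + dz f) * Dt = 0 by rewrite trace0 mul0r.
by move=> tr; apply: (eq_lc4 (k1 := - 1) (k2 := 1) (k3 := 1) (k4 := 1) tr xa yb zf); ring.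
Qed.

Lemma B_neq0 : B != 0.
Proof.
apply/eqP=> B0; have := fibre_direction; rewrite B0 mul0r addr0 => A0.
by have := v_inv; rewrite A0 B0 !mul0r subrr mulr0 => /esym/eqP; rewrite oner_eq0.
Qed.

Lemma d3y : d3 y = - A / B.
Proof.
apply: (mulfI B_neq0); rewrite mulrCA divff ?B_neq0 // mulr1.
by apply/eqP; rewrite -addr_eq0 addrC fibre_direction.
Qed.

Lemma O_v : O v.
Proof.
by apply: polyfunB => //; apply: PolyfunM; do ?[apply: polyfun_dy cs _ _|apply: polyfun_dz cs _ _].
Qed.

Lemma O_v_d3y : O (v * d3 y).
Proof.
have [ex ey ez] := jac_y.
have -> : v * d3 y = dz a * dx b - dx a * dz b.
  have -> : d3 y = - (dx a * d1 y + dx b * d2 y).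
    by apply/eqP; rewrite -addr_eq0 addrA -ex.
  have -> : v * - (dx a * d1 y + dx b * d2 y) =
    (dz a * dx b - dx a * dz b) * (dy a * d1 y + dy b * d2 y)
    + (dx a * dy b - dy a * dx b) * (dz a * d1 y + dz b * d2 y) by ring.
  by rewrite -ey -ez mulr1 mulr0 addr0.
by apply: polyfunB => //; apply: PolyfunM; do ?[apply: polyfun_dx cs _ _|apply: polyfun_dz cs _ _].
Qed.

(** The fibre is the conic [e = const] in the plane [z = P x + Q y + c]. *)
Lemma M_e : d3 e = 0.
Proof.
rewrite ee !(derE h3) (fr_3x fr) !M_d1 ?M_d2 ?M_P ?M_Q //.
by apply: (eq_lc1 (k := 1) fibre_direction); rewrite eA eB; field; rewrite ?n4 ?n2.
Qed.

Lemma N_neq0 : N != 0.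
Proof.
rewrite eN mulf_neq0 ?B_neq0 //; apply/eqP=> e0; have := v_inv.
by rewrite e0 mulr0 => /esym/eqP; rewrite oner_eq0.
Qed.

Lemma vN : v * N = B.
Proof. by rewrite eN mulrCA v_inv mulr1. Qed.

Lemma d1e : d1 e = d1 (d1 c) * x + d1 (d2 c) * y + (d1 (d1 P) * x ^+ 2
   + 2 * d1 (d2 P) * x * y + d1 (d2 Q) * y ^+ 2) / 2 + B * d1 y.
Proof. by rewrite ee !(derE h1) (fr_1x fr) eB; field; rewrite ?n4 ?n2. Qed.

Lemma d2e : d2 e = d2 (d1 c) * x + d2 (d2 c) * y + (d2 (d1 P) * x ^+ 2
   + 2 * d2 (d2 P) * x * y + d2 (d2 Q) * y ^+ 2) / 2 + B * d2 y.
Proof. by rewrite ee !(derE h2) (fr_2x fr) eB; field; rewrite ?n4 ?n2. Qed.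

Lemma frame_zero s1 s2 s3 :
  (forall u, u = x \/ u = y \/ u = z -> s1 * d1 u + s2 * d2 u + s3 * d3 u = 0) ->
  [/\ s1 = 0, s2 = 0 & s3 = 0].
Proof.
move=> h; have ex := h x (or_introl erefl); have ey := h y (or_intror (or_introl erefl)).
have ez := h z (or_intror (or_intror erefl)).
have s30 : s3 = 0 by rewrite -ex (fr_1x fr) (fr_2x fr) (fr_3x fr); ring.
rewrite s30 mul0r addr0 in ey; rewrite s30 mul0r addr0 d1z d2z in ez.
have Dt0 : B * d1 y - A * d2 y != 0.
  by apply: contraNneq (oner_neq0 L) => e0; rewrite -v_inv e0 mulr0.
split=> //; apply: (mulIf Dt0); rewrite mul0r.
  by apply: (eq_lc2 (k := B + Q * d2 y) (k' := - d2 y) ey ez); ring.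
by apply: (eq_lc2 (k := - (A + Q * d1 y)) (k' := d1 y) ey ez); ring.
Qed.

(** A vector field is determined by its values on the coordinates. *)
Lemma frame_combination (E : L -> L) s1 s2 s3 u :
  (forall w, E w = s1 * d1 w + s2 * d2 w + s3 * d3 w) ->
  E u = E x * dx u + E y * dy u + E z * dz u.
Proof.
move=> EE.
have E_x t1 t2 t3 w : s1 * d1 w + s2 * d2 w + s3 * d3 w - (t1 * dx w + t2 * dy w + t3 * dz w) =
    (s1 - (t1 * dx a + t2 * dy a + t3 * dz a)) * d1 w
    + (s2 - (t1 * dx b + t2 * dy b + t3 * dz b)) * d2 w + (s3 - t1) * d3 w.
  by rewrite (fr_dx fr w) (fr_dy fr w) (fr_dz fr w); ring.
have [|e1 e2 e3] := @frame_zero (s1 - (E x * dx a + E y * dy a + E z * dz a))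
  (s2 - (E x * dx b + E y * dy b + E z * dz b)) (s3 - E x).
  move=> w hw; rewrite -E_x -EE.
  have : E w - (E x * dx w + E y * dy w + E z * dz w) = 0.
    case: hw => [->|[->|->]]; rewrite ?(dxx cs) ?(dxy cs) ?(dxz cs) ?(dyx cs) ?(dyy cs)
      ?(dyz cs) ?(dzx cs) ?(dzy cs) ?(dzz cs); ring.
  by [].
apply/eqP; rewrite -subr_eq0; apply/eqP; rewrite {1}EE.
by rewrite E_x e1 e2 e3 !mul0r !addr0.
Qed.

(** * Developable images *)

Section RankOne.

Hypotheses (Q2 : d2 Q != 0) (Delta0 : d1 P * d2 Q = d2 P ^+ 2).
Variables (m : L) (dr : L -> L).
Hypotheses (em : m = - d2 P / d2 Q) (edr : forall u, dr u = d1 u + m * d2 u).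

Let M_m : d3 m = 0.
Proof. by rewrite em mulNr derN // der_div0 ?oppr0 // M_d2 // ?M_P ?M_Q. Qed.

Let hr : derivation dr.
Proof.
by split=> u w; rewrite !edr ?(derD h1, derD h2) ?(derM h1, derM h2); ring.
Qed.

Let M_dr u : d3 u = 0 -> d3 (dr u) = 0.
Proof.
by move=> hu; rewrite edr derD // derM // M_m M_d1 // M_d2 // !mul0r mulr0 !addr0.
Qed.

Let mQ2 : m * d2 Q = - d2 P.
Proof. by rewrite em divfK. Qed.

Let drQ : dr Q = 0.
Proof. by rewrite edr d1Q mQ2 subrr. Qed.

Let drP : dr P = 0.
Proof.
apply: (mulfI Q2); rewrite mulr0 edr.
by apply: (eq_lc2 (k := 1) (k' := d2 P) Delta0 mQ2); ring.
Qed.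

Let dr_d2 u : dr (d2 u) = d2 (dr u) - d2 m * d2 u.
Proof. by rewrite !edr c12 (derD h2) (derM h2); ring. Qed.

Let drm : dr m = 0.
Proof.
have := congr1 dr mQ2; rewrite derM // derN // !dr_d2 drQ drP der0 //.
move=> e0; apply: (mulIf Q2); rewrite mul0r.
by apply: (eq_lc2 (k := 1) (k' := d2 m) e0 mQ2); ring.
Qed.

Let drx : dr x = 0.
Proof. by rewrite edr (fr_1x fr) (fr_2x fr) mulr0 addr0. Qed.

(** [P] and [Q] are constant in the direction [dr] of the rulings; when this
    direction is constant, the normals are orthogonal to [(1, m, P + m Q)]. *)
Lemma rank_one_constant_ruling : d2 m = 0 -> gauss_dependent.
Proof.
move=> m2; have m1 : d1 m = 0 by have := drm; rewrite edr m2 mulr0 addr0.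
exists 1, m, (P + m * Q); rewrite oner_neq0 mul1r; split=> //.
- by apply: constant3_1 cs.
- exact: d_constant.
apply: d_constant.
- rewrite derD // derM // m1 d1Q.
  by have := drP; rewrite edr => e0; apply: (eq_lc1 (k := 1) e0); ring.
- rewrite derD // derM // m2.
  by apply: (eq_lc1 (k := 1) mQ2); ring.
by rewrite derD // derM // M_P M_Q M_m; ring.
Qed.

Hypothesis m2 : d2 m != 0.

Variables (G Y : L) (ds : L -> L).
Hypotheses (eG : G = (d2 m)^-1) (eds : forall u, ds u = G * d2 u).
Hypothesis eY : Y = y - m * x.

Let G0 : G != 0. Proof. by rewrite eG invr_eq0. Qed.

Let M_G : d3 G = 0.
Proof. by rewrite eG (derV h3) M_d2 // mul0r oppr0. Qed.

Let drG : dr G = 1.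
Proof. by rewrite eG (derV hr) dr_d2 drm (der0 h2) sub0r; field. Qed.

Let hs : derivation ds.
Proof. by split=> u w; rewrite !eds ?(derD h2) ?(derM h2); ring. Qed.

Let drs u : dr (ds u) = ds (dr u).
Proof. by rewrite !eds (derM hr) drG dr_d2 eG; field. Qed.

Let M_ds u : d3 u = 0 -> d3 (ds u) = 0.
Proof. by move=> hu; rewrite eds (derM h3) M_G M_d2 // mul0r mulr0 addr0. Qed.

Let AmB : A + m * B = dr c.
Proof.
rewrite eA eB edr; have := drP; have := drQ; rewrite !edr d1Q => eq ep.
by apply: (eq_lc2 (k := x) (k' := y) ep eq); ring.
Qed.

Let B_Y : B = d2 c + d2 Q * Y.
Proof. by rewrite eB eY; apply: (eq_lc1 (k := x) mQ2); ring. Qed.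

Let d3Y : d3 Y = - dr c / B.
Proof.
rewrite eY (derB h3) (derM h3) M_m (fr_3x fr) d3y -AmB.
by have := B_neq0; move=> ?; field.
Qed.

Section Planes.

(** Here the fibres are lines, and the preimage of a ruling of the image is a
    plane. *)
Hypothesis tau0 : dr c = 0.

Let w := ds c / ds Q.
Let xi := Y + w.

Let dsQ : ds Q != 0. Proof. by rewrite eds mulf_neq0. Qed.

Let B_xi : B = d2 Q * xi.
Proof. by rewrite B_Y /xi /w !eds; field; rewrite G0 Q2. Qed.

Let xi0 : xi != 0.
Proof. by apply/eqP=> e0; have := B_neq0; rewrite B_xi e0 mulr0 eqxx. Qed.

Let dz_r u : dr u = 0 -> dz u = d2 u / B.
Proof.
move=> hu; have B0 := B_neq0; have [_ _ e1] := jac_AB.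
have hA := AmB; rewrite tau0 in hA.
apply: (mulIf B0); rewrite divfK // (fr_dz fr); move: hu; rewrite edr => hu.
by apply: (eq_lc3 (k := d2 u) (k' := B * dz a) (k'' := - dz a * d2 u) e1 hu hA); ring.
Qed.

Let yy u := dy u + Q * dz u.

Let hyy : derivation yy.
Proof.
split=> u u'; rewrite /yy ?(derD (dery cs), derD (derz cs)) ?(derM (dery cs), derM (derz cs)).
  by ring.
by ring.
Qed.

Let yy_r u : dr u = 0 -> yy u = 0.
Proof.
move=> hu; have B0 := B_neq0; have [_ eQ e1] := jac_AB.
have hA := AmB; rewrite tau0 in hA.
apply: (mulIf B0); rewrite mul0r /yy (fr_dy fr) (fr_dz fr); move: hu; rewrite edr => hu.
apply: (eq_lc4 (k1 := d2 u) (k2 := Q * d2 u) (k3 := B * (dy a + Q * dz a))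
  (k4 := - (dy a + Q * dz a) * d2 u) eQ e1 hu hA); ring.
Qed.

Let drw : dr w = 0.
Proof. by rewrite der_div0 // drs ?tau0 ?drQ der0. Qed.

Let yyY : yy Y = 1.
Proof.
rewrite eY (derB hyy) (derM hyy) (yy_r drm) (yy_r drx) /yy (dyy cs) (dzy cs); ring.
Qed.

Let yy_xi : yy xi = 1.
Proof. by rewrite derD // (yy_r drw) yyY addr0. Qed.

(** The function [xi] vanishes to first order along a line in the preimage of a
    ruling, whereas [dz] lowers vanishing orders there by exactly two, which makes
    the order of any polynomial even. *)
Lemma planes_absurd : False.
Proof.
have [F [F' [OF OF' F'0 exi]]] := fracO xi.
apply: (xi_not_quotient char0 (derz cs) hyy yy_xi xi0 _ _ _ _ OF OF' F'0 exi).
- apply/eqP=> dxi.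
  have : x * d2 m = d2 w.
    have := dxi; rewrite /xi eY (derD (derz cs)) (derB (derz cs)) (derM (derz cs) m).
    rewrite (dzy cs) (dzx cs) !dz_r // => e0; have B0 := B_neq0.
    apply: (mulIf (invr_neq0 B0)).
    by apply: (eq_lc1 (k := - 1) e0); ring.
  move/(congr1 d3); rewrite derM // (fr_3x fr) !M_d2 //.
    by rewrite mulr0 addr0 mul1r => /eqP; rewrite (negPf m2).
  by rewrite der_div0 // M_ds // M_Q.
- move=> u; rewrite /yy (derD (derz cs)) (derM (derz cs)) (dydz cs) (dz_r drQ) B_xi.
  by field; rewrite Q2 xi0.
- exact: polyfun_dz.
apply: polyfun_polyrep => //.
- by move=> c' [e1 e2 e3]; rewrite /yy e2 e3 mulr0 addr0.
- exact/polyrepC/yy_r.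
- have -> : y = xi - w + m * x by rewrite /xi eY; ring.
  apply: polyrepD => //; last first.
    by apply: polyrepM => //; exact/polyrepC/yy_r.
  by apply: polyrepB => //; [exact: polyrepX|exact/polyrepC/yy_r].
have -> : z = (P + Q * m) * x + Q * (xi - w) + c by rewrite (fr_z fr) /xi eY; ring.
apply: polyrepD => //; last exact/polyrepC/yy_r.
apply: polyrepD => //.
  apply: polyrepC => //; apply: yy_r.
  by rewrite (derM hr) (derD hr) (derM hr) drP drQ drm drx; ring.
apply: polyrepM => //; first exact/polyrepC/yy_r.
by apply: polyrepB => //; [exact: polyrepX|exact/polyrepC/yy_r].
Qed.

End Planes.

Section Parabolas.

(** Here the fibres are parabolas whose axis is a ruling of the image. *)
Hypothesis tau0 : dr c != 0.

Variables (tau b0 : L).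
Hypotheses (etau : tau = dr c) (eb0 : b0 = d2 c).

Let tau1 : tau != 0. Proof. by rewrite etau. Qed.

Let M_tau : d3 tau = 0. Proof. by rewrite etau M_dr. Qed.
Let M_b0 : d3 b0 = 0. Proof. by rewrite eb0 M_d2. Qed.

Let M_Q2 : d3 (d2 Q) = 0. Proof. by rewrite M_d2 // M_Q. Qed.

Let d3Y0 : d3 Y != 0.
Proof. by rewrite d3Y mulf_neq0 ?oppr_eq0 ?invr_eq0 ?B_neq0. Qed.

Let d1P : d1 P = m ^+ 2 * d2 Q.
Proof.
by have := drP; rewrite edr => e0; apply: (eq_lc2 (k := 1) (k' := - m) e0 mQ2); ring.
Qed.

Let d2P : d2 P = - m * d2 Q.
Proof. by apply: (eq_lc1 (k := 1) mQ2); ring. Qed.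

Let e_Y : e = tau * x + b0 * Y + d2 Q * Y ^+ 2 / 2.
Proof.
have e1 : tau = d1 c + m * b0 by rewrite etau edr eb0.
by rewrite ee d1P d2P e1 eb0 eY; field; rewrite ?n2.
Qed.

Let B_Y' : B = b0 + d2 Q * Y. Proof. by rewrite B_Y eb0. Qed.

Let x_Y : x = (e - b0 * Y - d2 Q * Y ^+ 2 / 2) / tau.
Proof. by apply: (mulIf tau1); rewrite divfK // e_Y; field; rewrite ?n2. Qed.

Let polyrep_O F : O F -> polyrep d3 Y F.
Proof.
have rC u : d3 u = 0 -> polyrep d3 Y u by exact: polyrepC.
have rY : polyrep d3 Y Y by apply: polyrepX.
have rx : polyrep d3 Y x.
  rewrite x_Y; apply: polyrepM => //; last by apply: rC; rewrite (derV h3) M_tau mul0r oppr0.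
  apply: polyrepB => //.
    by apply: polyrepB => //; [apply/rC/M_e|apply: polyrepM => //; apply: rC].
  apply: polyrepM => //; last by apply: rC; rewrite (derV h3) der_nat // mul0r oppr0.
  by apply: polyrepM => //; [apply: rC|apply: polyrepXn].
have ry : polyrep d3 Y y.
  have -> : y = Y + m * x by rewrite eY; ring.
  by apply: polyrepD => //; apply: polyrepM => //; apply: rC.
apply: polyfun_polyrep => //; first by move=> c' /constant_d[].
rewrite (fr_z fr); apply: polyrepD => //; last exact: rC.
by apply: polyrepD => //; apply: polyrepM => //; apply: rC; rewrite ?M_P ?M_Q.
Qed.

Let drb0 : dr b0 = d2 tau - d2 m * b0.
Proof. by rewrite eb0 dr_d2 etau. Qed.

Let drQ2 : dr (d2 Q) = - d2 m * d2 Q.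
Proof. by rewrite dr_d2 drQ (der0 h2); ring. Qed.

Let dre : B * dr y = dr e - x * dr tau - Y * dr b0 - Y ^+ 2 * dr (d2 Q) / 2.
Proof.
have drY : dr Y = dr y by rewrite eY (derB hr) (derM hr) drm drx; ring.
by rewrite e_Y !(derE hr) drx drY B_Y'; field; rewrite ?n4 ?n2.
Qed.

Let d2e' : B * d2 y = d2 e - x * d2 tau - Y * d2 b0 - Y ^+ 2 * d2 (d2 Q) / 2
   + B * x * d2 m.
Proof.
have d2Y : d2 Y = d2 y - x * d2 m by rewrite eY (derB h2) (derM h2) (fr_2x fr); ring.
have -> : d2 y = d2 Y + x * d2 m by rewrite d2Y; ring.
by rewrite e_Y !(derE h2) (fr_2x fr) B_Y'; field; rewrite ?n4 ?n2.
Qed.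

Let N_x : N = B * (dr e - x * dr tau - Y * (d2 tau - d2 m * b0)
     + Y ^+ 2 * d2 m * d2 Q / 2)
   - tau * (d2 e - x * d2 tau - Y * d2 b0 - Y ^+ 2 * d2 (d2 Q) / 2 + B * x * d2 m).
Proof.
have hA : A = tau - m * B by rewrite etau -AmB; ring.
have -> : N = B * (B * dr y) - tau * (B * d2 y) by rewrite eN hA edr; ring.
by rewrite dre d2e' drb0 drQ2; field; rewrite ?n4 ?n2.
Qed.

Let mu := d2 m.

(* the coefficients of [N] as a polynomial in [Y] over the kernel of [d3] *)
Let p0 := b0 * (dr e - e * (dr tau + tau * mu) / tau) - tau * d2 e + e * d2 tau.
Let p1 := d2 Q * (dr e - e * (dr tau + tau * mu) / tau)
  + b0 * (b0 * (dr tau + tau * mu) / tau - (d2 tau - mu * b0))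
  - b0 * d2 tau + tau * d2 b0.
Let p2 := d2 Q * (b0 * (dr tau + tau * mu) / tau - (d2 tau - mu * b0))
  + b0 * (d2 Q * (dr tau + tau * mu) / tau / 2 + mu * d2 Q / 2)
  - d2 Q * d2 tau / 2 + tau * d2 (d2 Q) / 2.
Let p3 := d2 Q * (d2 Q * (dr tau + tau * mu) / tau / 2 + mu * d2 Q / 2).

Let N_Y : N = p0 + p1 * Y + p2 * Y ^+ 2 + p3 * Y ^+ 3.
Proof.
rewrite N_x x_Y /p0 /p1 /p2 /p3 B_Y' -/mu.
move: Y (dr e) (d2 e) (dr tau) (d2 tau) (d2 b0) (d2 (d2 Q)) (d2 Q) mu e b0 => *.
by field; rewrite n2 tau1.
Qed.

Let M_mu : d3 mu = 0. Proof. exact: M_d2. Qed.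

Let M_ps : [/\ d3 p0 = 0, d3 p1 = 0, d3 p2 = 0 & d3 p3 = 0].
Proof.
have Me := M_e; have Mre : d3 (dr e) = 0 by rewrite M_dr.
have Mrt : d3 (dr tau) = 0 by rewrite M_dr.
have M2e : d3 (d2 e) = 0 by rewrite M_d2.
have M2t : d3 (d2 tau) = 0 by rewrite M_d2.
have M2b : d3 (d2 b0) = 0 by rewrite M_d2.
have M2Q : d3 (d2 (d2 Q)) = 0 by rewrite M_d2.
rewrite /p0 /p1 /p2 /p3.
by split; rewrite !(derE h3) ?Mre ?Mrt ?M2e ?M2t ?M2b ?M2Q ?Me ?M_b0 ?M_tau ?M_Q2 ?M_mu;
  rewrite !(mul0r, mulr0, addr0, oppr0, subr0).
Qed.

(** [N] is invertible in [M[Y]], hence constant along the fibres. *)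
Let M_N : d3 N = 0.
Proof.
have [k0 k1 k2 k3] := M_ps.
have rC u : d3 u = 0 -> polyrep d3 Y u by exact: polyrepC.
have rY : polyrep d3 Y Y by apply: polyrepX.
have rN : polyrep d3 Y N.
  rewrite N_Y; do 3?[apply: polyrepD => //]; try exact: rC.
  - by apply: polyrepM => //; apply: rC.
  - by apply: polyrepM => //; [apply: rC|apply: polyrepXn].
  by apply: polyrepM => //; [apply: rC|apply: polyrepXn].
have rv := polyrep_O O_v; have rv' := polyrep_O O_v_d3y.
apply: (polyrep_unit char0 h3 d3Y0 rN (G := (m * v - v * d3 y) / tau)).
  apply: polyrepM => //; last by apply: rC; rewrite (derV h3) M_tau mul0r oppr0.
  by apply: polyrepB => //; apply: polyrepM => //; apply: rC.
apply: (mulIf tau1); rewrite mulrA divfK // mul1r.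
have := vN; have := fibre_direction; have := AmB; rewrite -etau => q1 q2 q3.
by apply: (eq_lc3 (k := m - d3 y) (k' := - 1) (k'' := 1) q3 q2 q1); ring.
Qed.

Let ps0 : [/\ p1 = 0 & p3 = 0].
Proof.
have [k0 k1 k2 k3] := M_ps.
have [] := @ker_indep4 _ char0 d3 Y (p0 - N) p1 p2 p3 h3 d3Y0 _ k1 k2 k3.
- by rewrite (derB h3) k0 M_N subrr.
- by rewrite N_Y; ring.
by move=> _ -> _ ->.
Qed.

Let dr_tau : dr tau = - 2 * mu * tau.
Proof.
have [_ e3] := ps0; apply: (mulIf (expf_neq0 2 Q2)).
by apply: (eq_lc1 (k := 2 * tau) e3); rewrite /p3; field; rewrite ?n4 ?n2 ?tau1.
Qed.

Let dr_e : d2 Q * (dr e + mu * e) = 2 * b0 * d2 tau - tau * d2 b0.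
Proof.
have [e1 _] := ps0.
by apply: (eq_lc1 (k := 1) e1); rewrite /p1 dr_tau; field; rewrite ?tau1.
Qed.

Local Notation K := (constant2 d3 dr).

(** Over the field [K] of functions constant on the rulings, [x] is congruent to
    [q(Y) / X1] with [q] of degree two, and [a] to [c0 / X1] with a nonzero [c0]:
    the residue of [a] is not a multiple of [q]. *)
Lemma parabolas_absurd : False.
Proof.
have Gmu : mu = G^-1 by rewrite eG invrK.
have [c0 ec0] : exists t, t = - tau * G ^+ 2 by eexists.
have [c1 ec1] : exists t, t = c + tau * G by eexists.
have [X1 eX1] : exists t, t = - tau * G by eexists.
have [g0 eg0] : exists t, t = a - G by eexists.
have etau0 : tau = - c0 / G ^+ 2 by rewrite ec0; field.
have c00 : c0 != 0 by rewrite ec0 mulf_neq0 ?oppr_eq0 ?expf_neq0.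
have dtau : dr tau = - 2 * tau / G by rewrite dr_tau Gmu; field.
have K1 u : d3 u = 0 -> dr u = 0 -> K u by [].
have Kc0 : K c0.
  split; rewrite ec0 !(derE h3, derE hr) ?M_tau ?M_G ?dtau ?drG; first by ring.
  by field.
have Kc1 : K c1.
  split; rewrite ec1 !(derE h3, derE hr) ?M_tau ?M_G ?M_c ?dtau ?drG -?etau; first by ring.
  by field.
have Kg0 : K g0.
  split; rewrite eg0 (derB h3, derB hr) ?(fr_3a fr) ?M_G ?drG; first by ring.
  by rewrite edr (fr_1a fr) (fr_2a fr); ring.
have Kds u : K u -> K (ds u).
  by move=> [e1 e2]; split; [apply: M_ds | rewrite drs e2 der0].
have KdG : K (ds G) by split; [apply: M_ds | rewrite drs drG der1].
have KQ : K Q by split; rewrite ?M_Q.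
have Km : K m by [].
have KP : K P by split; rewrite ?M_P.
have M_X1 : d3 X1 = 0 by rewrite eX1 !(derE h3) M_tau M_G; ring.
have drX1 : dr X1 = tau by rewrite eX1 !(derE hr) dtau drG; field.
have X1G : X1 = c0 / G by rewrite eX1 ec0; field.
have c_X1 : c = c1 + X1 by rewrite ec1 eX1; ring.
(* derivatives along the constants of the ruling, as polynomials in [1 / G] *)
have dsc : ds c = ds c1 + ds c0 / G - c0 * ds G / G ^+ 2.
  by rewrite c_X1 X1G !(derE hs); field.
have dsdsc : ds (ds c) = ds (ds c1) + ds (ds c0) / G - 2 * ds c0 * ds G / G ^+ 2
   - c0 * ds (ds G) / G ^+ 2 + 2 * c0 * ds G ^+ 2 / G ^+ 3.
  by rewrite dsc !(derE hs); field.
have dstau : ds tau = - ds c0 / G ^+ 2 + 2 * c0 * ds G / G ^+ 3.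
  by rewrite etau0 !(derE hs); field.
have b0G : b0 = ds c / G by rewrite eds eb0; field.
have dsb0 : ds b0 = ds (ds c) / G - ds c * ds G / G ^+ 2.
  by rewrite b0G !(derE hs); field.
have q0n : ds Q != 0 by rewrite eds mulf_neq0.
pose k0' := ds c0; pose k0'' := ds (ds c0); pose k1' := ds c1; pose k1'' := ds (ds c1).
pose g1 := ds G; pose g2 := ds (ds G).
pose H0 := (c0 * k1'' - 2 * k0' * k1') / ds Q.
pose H1 := (c0 * k0'' - 2 * k0' * k0' + 3 * c0 * g1 * k1') / ds Q.
pose H2 := (c0 * (- 2 * k0' * g1 - c0 * g2) + 2 * k0' * c0 * g1 + 3 * c0 * g1 * k0') / ds Q.
pose H3 := (2 * c0 ^+ 2 * g1 ^+ 2 - 3 * c0 ^+ 2 * g1 ^+ 2) / ds Q.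
have drGe : dr (G * e) = H0 / G ^+ 2 + H1 / G ^+ 3 + H2 / G ^+ 4 + H3 / G ^+ 5.
  have -> : dr (G * e) = G * (dr e + mu * e).
    by rewrite (derM hr) drG Gmu; field.
  apply: (mulfI q0n).
  have -> : ds Q * (G * (dr e + mu * e)) = G ^+ 2 * (d2 Q * (dr e + mu * e)).
    by rewrite eds; ring.
  rewrite dr_e.
  have -> : G ^+ 2 * (2 * b0 * d2 tau - tau * d2 b0) = G * (2 * b0 * ds tau - tau * ds b0).
    by rewrite !eds; ring.
  rewrite dsb0 dstau b0G dsdsc dsc etau0 /H0 /H1 /H2 /H3 -/k0' -/k0'' -/k1' -/k1'' -/g1 -/g2.
  by field; rewrite q0n G0.
(* the corrections are primitives along [dr] of the terms of [dr (G * e)] *)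
have [E0 eE0] : exists t, t = G * e + H0 / G + H1 / G ^+ 2 / 2 + H2 / G ^+ 3 / 3 + H3 / G ^+ 4 / 4.
  by eexists.
have cD := @constant2D _ _ _ h3 hr; have cM := @constant2M _ _ _ h3 hr.
have cN := @constant2N _ _ _ h3 hr; have cV := @constant2V _ _ _ h3 hr.
have cX := @constant2X _ _ _ h3 hr; have cn := @constant2_nat _ _ _ h3 hr.
have KH : [/\ K H0, K H1, K H2 & K H3].
  rewrite /H0 /H1 /H2 /H3 /k0' /k0'' /k1' /k1'' /g1 /g2.
  by split; repeat first [assumption|apply cn|apply Kds|apply cD|apply cN|apply cV|apply cM|apply cX].
have [KH0 KH1 KH2 KH3] := KH.
have KE0 : K E0.
  have [a0 a1] := KH0; have [a2 a3] := KH1; have [a4 a5] := KH2; have [a6 a7] := KH3.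
  split; rewrite eE0.
    rewrite (derD h3) (derD h3) (derD h3) (derD h3).
    rewrite (derM h3 G) M_e M_G (derM h3 H0) a0 (derM h3 _ 2^-1) (derM h3 H1) a2.
    rewrite (derM h3 _ 3^-1) (derM h3 H2) a4 (derM h3 _ 4^-1) (derM h3 H3) a6.
    by rewrite !(derV h3) !(derX h3) M_G !(der_nat h3); ring.
  rewrite (derD hr) (derD hr) (derD hr) (derD hr) drGe.
  rewrite (derM hr H0) a1 (derM hr _ 2^-1) (derM hr H1) a3.
  rewrite (derM hr _ 3^-1) (derM hr H2) a5 (derM hr _ 4^-1) (derM hr H3) a7.
  rewrite !(derV hr) !(derX hr) drG !(der_nat hr).
  by field; rewrite !(natf_neq0 char0) ?G0.
pose R := H0 / c0 + H1 / c0 ^+ 2 / 2 * X1 + H2 / c0 ^+ 3 / 3 * X1 ^+ 2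
  + H3 / c0 ^+ 4 / 4 * X1 ^+ 3 + k0' / c0 * Y - g1 / c0 * X1 * Y.
pose q : {poly L} := (- E0)%:P + k1'%:P * 'X + (ds Q / 2)%:P * 'X^2.
have xX1 : x * X1 = q.[Y] + X1 * R.
  rewrite /q !(hornerD, hornerM, hornerC, hornerX, hornerXn) /R.
  have -> : x * X1 = - (G * e) + G * b0 * Y + G * d2 Q * Y ^+ 2 / 2.
    by rewrite e_Y eX1; field; rewrite ?n2.
  have -> : G * b0 = ds c by rewrite eds eb0.
  have -> : G * e = E0 - (H0 / G + H1 / G ^+ 2 / 2 + H2 / G ^+ 3 / 3 + H3 / G ^+ 4 / 4).
    by rewrite eE0; ring.
  rewrite -eds dsc X1G -/k0' -/k1' -/g1.
  by field; rewrite !(natf_neq0 char0) ?G0 ?c00.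
have jac : d3 Y * dr X1 - dr Y * d3 X1 != 0.
  by rewrite drX1 M_X1 mulr0 subr0 mulf_neq0.
have rD := @poly2repD _ _ _ h3 hr Y X1; have rM := @poly2repM _ _ _ h3 hr Y X1.
have rC := @poly2repC _ _ _ h3 hr Y X1.
have rT := poly2rep_T0 h3 hr Y X1; have rU := poly2rep_T1 h3 hr Y X1.
have rR : poly2rep d3 dr Y X1 R.
  have -> : R = H0 / c0 + H1 / c0 ^+ 2 / 2 * X1 + H2 / c0 ^+ 3 / 3 * (X1 * X1)
    + H3 / c0 ^+ 4 / 4 * (X1 * (X1 * X1)) + k0' / c0 * Y + - g1 / c0 * (X1 * Y).
    by rewrite /R; ring.
  have Kk0' : K k0' by apply: Kds.
  have Kg1 : K g1 by [].
  have r0 := rC _ KH0; have r1 := rC _ KH1; have r2 := rC _ KH2; have r3 := rC _ KH3.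
  have r4 := rC _ Kk0'; have r5 := rC _ (cN _ Kg1).
  have rV n : poly2rep d3 dr Y X1 (c0 ^+ n)^-1 by apply rC; apply cV; apply cX.
  have rV1 := rV 1%N; rewrite expr1 in rV1.
  have rn n : poly2rep d3 dr Y X1 (n%:R)^-1 by apply rC; apply cV; apply cn.
  by repeat first [assumption|apply rV|apply rn|apply rD|apply rM].
have Kq d : (d = d3 \/ d = dr) -> kerpoly d q.
  move=> hd; have [dE dk dQ] : [/\ d E0 = 0, d k1' = 0 & d (ds Q / 2) = 0].
    have [e1 e2] := KE0; have [e3 e4] := Kds _ Kc1.
    have [e5 e6] : K (ds Q / 2) by apply cM; [apply Kds|apply cV; apply cn].
    by case: hd => ->.
  have hd' : derivation d by case: hd => ->.
  rewrite /q; apply: (kerpolyD hd'); [apply: (kerpolyD hd')|].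
  - by apply: (kerpolyC hd'); rewrite (derN hd') dE oppr0.
  - by apply: (kerpolyM hd'); [apply: (kerpolyC hd')|apply: (kerpolyX hd')].
  by apply: (kerpolyM hd'); [apply: (kerpolyC hd')|apply: (kerpolyXn hd')].
have fC u : K u -> fibre_ring d3 dr Y X1 q u by exact: fibre_ringC.
have fY : fibre_ring d3 dr Y X1 q Y by apply: fibre_ring_poly2rep.
have fX : fibre_ring d3 dr Y X1 q X1 by apply: fibre_ring_poly2rep.
have fD := @fibre_ringD _ _ _ h3 hr Y X1 q; have fM := @fibre_ringM _ _ _ h3 hr Y X1 q.
have fx : fibre_ring d3 dr Y X1 q x.
  by apply: (fibre_ring_quotient h3 hr rR _ _ xX1); apply: Kq; [left|right].
have fO F : O F -> fibre_ring d3 dr Y X1 q F.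
  apply: polyfun_sub => //.
  - by move=> c' /constant_d[e1 e2 e3]; apply: fC; split; rewrite ?edr ?e1 ?e2 ?mulr0 ?addr0.
  - have -> : y = Y + m * x by rewrite eY; ring.
    by apply: (fD) => //; apply: (fM) => //; apply: fC.
  have -> : z = (P + m * Q) * x + (Q * Y + (c1 + X1)).
    by rewrite (fr_z fr) c_X1 eY; ring.
  apply fD; first by apply fM => //; apply: fC; apply cD => //; apply cM.
  by apply fD; [apply fM => //; apply: fC|apply fD => //; apply: fC].
have ea : a * X1 = (c0%:P).[Y] + g0 * X1.
  by rewrite hornerC eg0 X1G; field.
have := fibre_ring_residue char0 h3 hr jac _ _ Kg0 (fO a Oa) ea.
have [e1 e2] := Kc0; move=> /(_ (kerpolyC h3 e1) (kerpolyC hr e2)) /dvdp_leq.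
rewrite polyC_eq0 => /(_ c00); rewrite size_polyC c00 => sq.
have : q`_2 = 0 by rewrite nth_default // (leq_trans sq).
rewrite /q !coefD coefC coefCM coefX coefCM coefXn /= mulr0 !add0r mulr1 => /eqP.
by rewrite mulf_eq0 invr_eq0 (negPf n2) orbF (negPf q0n).
Qed.

End Parabolas.

End RankOne.

(** * Non-developable images *)

Section RankTwo.

Hypotheses (Q2 : d2 Q != 0) (Delta0 : d2 P ^+ 2 - d1 P * d2 Q != 0).

Let M_P1 : d3 (d1 P) = 0. Proof. by rewrite M_d1 ?M_P. Qed.
Let M_P2 : d3 (d2 P) = 0. Proof. by rewrite M_d2 ?M_P. Qed.
Let M_Q2 : d3 (d2 Q) = 0. Proof. by rewrite M_d2 ?M_Q. Qed.

Let d3A : d3 A = d1 P + d2 P * d3 y.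
Proof.
by rewrite eA !(derE h3) M_d1 // M_P1 M_P2 (fr_3x fr); ring.
Qed.

Let d3B : d3 B = d2 P + d2 Q * d3 y.
Proof.
by rewrite eB !(derE h3) M_d2 // M_P2 M_Q2 (fr_3x fr); ring.
Qed.

(** The second fundamental form on the tangent vector [(B, - A)] of the fibre; it
    is constant along the fibre, and zero when the conic is singular. *)
Definition conic_level := A ^+ 2 * d2 Q - 2 * d2 P * A * B + d1 P * B ^+ 2.

Let polyrep_x F : O F -> polyrep d3 x y -> polyrep d3 x F.
Proof.
move=> OF ry; have rC u : d3 u = 0 -> polyrep d3 x u by exact: polyrepC.
have rx : polyrep d3 x x by apply: polyrepX.
apply: polyfun_polyrep OF => //; first by move=> c' /constant_d[].
rewrite (fr_z fr); apply: polyrepD => //; last exact: rC.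
by apply: polyrepD => //; apply: polyrepM => //; apply: rC; rewrite ?M_P ?M_Q.
Qed.

(** If the conic is a pair of lines, the fibre meets the centre of the conic,
    where the inverse of the Jacobian determinant would have a pole. *)
Lemma line_pair_absurd : conic_level = 0 -> False.
Proof.
rewrite /conic_level => k0; have B0 := B_neq0.
have [m em] : exists t, t = d3 y by eexists.
have mB : A = - m * B by rewrite em; apply: (eq_lc1 (k := 1) fibre_direction); ring.
have quad : d2 Q * m ^+ 2 + 2 * d2 P * m + d1 P = 0.
  apply: (mulIf (expf_neq0 2 B0)); rewrite mul0r -[RHS]k0 mB; ring.
have [om eom] : exists t, t = d2 P + m * d2 Q by eexists.
have om0 : om != 0.
  apply: contraNneq Delta0 => om0.
  have e1 : d2 P + m * d2 Q = 0 by rewrite -eom.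
  by apply/eqP; apply: (eq_lc2 (k := d2 P + m * d2 Q) (k' := - d2 Q) e1 quad); ring.
have M_m : d3 m = 0.
  have := congr1 d3 quad; rewrite !(derE h3) M_P1 M_P2 M_Q2 => e1.
  apply: (mulfI om0); rewrite mulr0 eom; apply: (mulfI n2); rewrite mulr0.
  by apply: (eq_lc1 (k := 1) e1); ring.
pose dr u := d1 u + m * d2 u.
have hr : derivation dr.
  by split=> u w; rewrite /dr ?(derD h1, derD h2) ?(derM h1, derM h2); ring.
have M_dr u : d3 u = 0 -> d3 (dr u) = 0.
  by move=> hu; rewrite (derD h3) (derM h3) M_m M_d1 // M_d2 // !mul0r mulr0 !addr0.
have [Y eY] : exists t, t = y - m * x by eexists.
have Y_M : Y = - dr c / om.
  apply: (mulIf om0); rewrite divfK // eY eom /dr.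
  have hA : A + m * B = 0 by rewrite mB; ring.
  by apply: (eq_lc2 (k := 1) (k' := - x) hA quad); rewrite eA eB; ring.
have M_om : d3 om = 0 by rewrite eom (derD h3) (derM h3) M_P2 M_m M_Q2; ring.
have M_Y : d3 Y = 0 by rewrite Y_M der_div0 // (derN h3) M_dr // oppr0.
have rC u : d3 u = 0 -> polyrep d3 x u by exact: polyrepC.
have rx : polyrep d3 x x by apply: polyrepX.
have yY : y = Y + m * x by rewrite eY; ring.
have ry : polyrep d3 x y.
  by rewrite yY; apply: polyrepD => //; [apply: rC|apply: polyrepM => //; apply: rC].
have rB : polyrep d3 x B.
  rewrite eB; apply: polyrepD => //; last by apply: polyrepM => //; apply: rC.
  by apply: polyrepD => //; [apply/rC/M_d2|apply: polyrepM => //; apply: rC].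
have dry : dr y = dr Y + x * dr m.
  have drx : dr x = 0 by rewrite /dr (fr_1x fr) (fr_2x fr); ring.
  by rewrite {1}yY (derD hr) (derM hr) drx; ring.
have rdry : polyrep d3 x (dr y).
  by rewrite dry; apply: polyrepD => //; [apply: rC|apply: polyrepM => //; apply: rC];
    apply: M_dr.
have vB : B * (v * dr y) = 1.
  by rewrite -v_inv mB /dr; ring.
have rv : polyrep d3 x (v * dr y).
  by apply: polyrepM => //; apply: polyrep_x => //; apply: O_v.
have x0 : d3 x != 0 by rewrite (fr_3x fr) oner_neq0.
have := polyrep_unit char0 h3 x0 rB rv vB.
by rewrite d3B -em mulrC -eom => /eqP; rewrite (negPf om0).
Qed.

(** * The asymptotic directions of the image *)

Hypothesis kap0 : conic_level != 0.

Let D u := B * d3 u.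

Let hD : derivation D. Proof. exact: derivation_scale. Qed.

Let D0P u : D u = 0 -> d3 u = 0.
Proof. by move/eqP; rewrite mulf_eq0 (negPf B_neq0) => /eqP. Qed.

Let D0 u : d3 u = 0 -> D u = 0.
Proof. by move=> h; rewrite /D h mulr0. Qed.

Let Bd3y : B * d3 y = - A.
Proof. by apply: (eq_lc1 (k := 1) fibre_direction); ring. Qed.

Let DA : D A = d1 P * B - d2 P * A.
Proof. by rewrite /D d3A; apply: (eq_lc1 (k := d2 P) Bd3y); ring. Qed.

Let DB : D B = d2 P * B - d2 Q * A.
Proof. by rewrite /D d3B; apply: (eq_lc1 (k := d2 Q) Bd3y); ring. Qed.

Lemma M_conic_level : d3 conic_level = 0.
Proof.
apply: D0P; rewrite /conic_level.
have M2 : D 2 = 0 by apply: der_nat.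
rewrite !(derD hD) !(derM hD) (derN hD) !(derM hD) DA DB M2.
by rewrite (D0 M_Q2) (D0 M_P2) (D0 M_P1); ring.
Qed.

Let W := d2 P ^+ 2 - d1 P * d2 Q.

Let DW : D W = 0.
Proof.
by apply: D0; rewrite !(derE h3) M_P1 M_P2 M_Q2; ring.
Qed.

Let weight_A : weight D W 1 A.
Proof.
rewrite /weight DA (derB hD) !(derM hD) (D0 M_P1) (D0 M_P2) DA DB /W; ring.
Qed.

Let weight_B : weight D W 1 B.
Proof.
rewrite /weight DB (derB hD) !(derM hD) (D0 M_Q2) (D0 M_P2) DA DB /W; ring.
Qed.

Let fin := finite_weight D W.
Let finC k : d3 k = 0 -> fin k.
Proof. by move=> h; apply: finite_weightC; apply: D0. Qed.
Let finD u w : fin u -> fin w -> fin (u + w).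
Proof. exact: finite_weightD. Qed.
Let finM u w : fin u -> fin w -> fin (u * w).
Proof. exact: (finite_weightM char0 hD Delta0 DW). Qed.
Let finN u : fin u -> fin (- u).
Proof.
by move=> h; rewrite -mulN1r; apply: finM => //; apply: finC; rewrite (derN h3) (der1 h3) oppr0.
Qed.
Let finX u n : fin u -> fin (u ^+ n).
Proof.
move=> h; elim: n => [|n ih]; first by apply: finC; rewrite expr0 (der1 h3).
by rewrite exprS; apply: finM.
Qed.

Let finA : fin A. Proof. by exists 2%N; apply: (below_weight (j := 1)). Qed.
Let finB : fin B. Proof. by exists 2%N; apply: (below_weight (j := 1)). Qed.

Let M_V k : d3 k = 0 -> d3 k^-1 = 0.
Proof. by move=> h; rewrite (derV h3) h mul0r oppr0. Qed.

Let M_W : d3 W = 0.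
Proof. exact: D0P. Qed.

Let x_AB : x = (d2 P * (B + - d2 c) + - (d2 Q * (A + - d1 c))) * W^-1.
Proof.
  by rewrite eA eB; have := Delta0; rewrite -/W => ?; rewrite -[LHS](mulfK (x := W)) //; congr (_ / _);
    rewrite /W; ring.
Qed.

Let y_AB : y = (d2 P * (A + - d1 c) + - (d1 P * (B + - d2 c))) * W^-1.
Proof.
  by rewrite eA eB; have := Delta0; rewrite -/W => ?; rewrite -[LHS](mulfK (x := W)) //; congr (_ / _);
    rewrite /W; ring.
Qed.

Let finx : fin x.
Proof.
rewrite x_AB; apply: finM; last by apply: finC; apply: M_V.
apply: finD; last apply: finN; (apply: finM; first exact: finC); apply: finD => //;
  by apply: finN; apply: finC; rewrite ?M_d1 ?M_d2.
Qed.

Let finy : fin y.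
Proof.
rewrite y_AB; apply: finM; last by apply: finC; apply: M_V.
apply: finD; last apply: finN; (apply: finM; first exact: finC); apply: finD => //;
  by apply: finN; apply: finC; rewrite ?M_d1 ?M_d2.
Qed.

Let finO F : O F -> fin F.
Proof.
apply: polyfun_sub => //; first by move=> c' /constant_d[_ _ h]; apply: finC.
rewrite (fr_z fr); apply: finD; last exact: finC.
by apply: finD; apply: finM => //; apply: finC; rewrite ?M_P ?M_Q.
Qed.

(** [N] is, up to sign, the derivative along the fibre of [Psi]: a primitive of
    the closed form obtained by differentiating the equation of the conic. *)
Let Psi := (d1 (d1 c) * x ^+ 2 + 2 * d1 (d2 c) * x * y + d2 (d2 c) * y ^+ 2) / 2
  + (d1 (d1 P) * x ^+ 3 + 3 * d1 (d2 P) * x ^+ 2 * y + 3 * d2 (d2 P) * x * y ^+ 2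
     + d2 (d2 Q) * y ^+ 3) / 6 - d1 e * x - d2 e * y.

Let M_dd : [/\ d3 (d1 (d1 c)) = 0, d3 (d1 (d2 c)) = 0 & d3 (d2 (d2 c)) = 0].
Proof. by split; rewrite !(c13, c23) M_c !(der0 h1, der0 h2). Qed.

Let M_ddP : [/\ d3 (d1 (d1 P)) = 0, d3 (d1 (d2 P)) = 0, d3 (d2 (d2 P)) = 0 & d3 (d2 (d2 Q)) = 0].
Proof. by split; rewrite !(c13, c23) ?M_P ?M_Q !(der0 h1, der0 h2). Qed.

Let M_de : [/\ d3 (d1 e) = 0 & d3 (d2 e) = 0].
Proof. by split; rewrite ?c13 ?c23 M_e ?(der0 h1) ?(der0 h2). Qed.

Let alpha := d1 (d1 c) * x + d1 (d2 c) * y + (d1 (d1 P) * x ^+ 2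
   + 2 * d1 (d2 P) * x * y + d2 (d2 P) * y ^+ 2) / 2 - d1 e.
Let beta := d1 (d2 c) * x + d2 (d2 c) * y + (d1 (d2 P) * x ^+ 2
   + 2 * d2 (d2 P) * x * y + d2 (d2 Q) * y ^+ 2) / 2 - d2 e.

Let N_ab : N = A * beta - B * alpha.
Proof.
rewrite eN /alpha /beta d1e d2e -!(c12 c) -(c12 P) (c12 Q) d1Q.
by field; rewrite !(natf_neq0 char0).
Qed.

Let DPsi : D Psi = - N.
Proof.
have [a1 a2 a3] := M_dd; have [a4 a5 a6 a7] := M_ddP; have [a8 a9] := M_de.
have e1 : d3 Psi = alpha + beta * d3 y.
  rewrite /Psi !(derD h3, derN h3, derV h3, der_nat h3, derX2 h3, derX3 h3, derM h3).
  rewrite a1 a2 a3 a4 a5 a6 a7 a8 a9 (fr_3x fr) ?(der1 h3) /alpha /beta.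
  by field; rewrite !(natf_neq0 char0).
rewrite /D e1 N_ab.
by apply: (eq_lc1 (k := beta) Bd3y); ring.
Qed.

Let finPsiN : fin Psi /\ fin N.
Proof.
have [a1 a2 a3] := M_dd; have [a4 a5 a6 a7] := M_ddP; have [a8 a9] := M_de.
have fV n : fin (n%:R)^-1 by apply: finC; rewrite (derV h3) (der_nat h3) mul0r oppr0.
have fn n : fin n%:R by apply: finC; rewrite (der_nat h3).
have fx := finx; have fy := finy; have fX := finX.
rewrite N_ab; have fA := finA; have fB := finB.
by split; rewrite /Psi /alpha /beta; repeat first [exact: fV|exact: fn|assumption|exact: finC
  |apply: fX|apply: finN|apply: finD|apply: finM].
Qed.

Let N_D_neq0 : D N != 0.
Proof.
apply/eqP=> DN; have [[n hn] _] := finPsiN.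
have DDPsi : D (D Psi) = 0 by rewrite DPsi (derN hD) DN oppr0.
have := DD_eq0 char0 hD Delta0 DW hn DDPsi; rewrite DPsi => /eqP.
by rewrite oppr_eq0 (negPf N_neq0).
Qed.

Let N1_conic : N^-1 = conic_level^-1 * (- (A * d2 Q) * (v * d3 y) + - (2 * d2 P * A * v)
   + d1 P * B * v).
Proof.
  have N0 := N_neq0.
  apply: (mulfI kap0); rewrite mulVKf //; apply: (mulIf N0); rewrite mulfVK //.
  have e1 := vN.
  have e2 : v * d3 y * N = - A by apply: (eq_lc2 (k := d3 y) (k' := 1) e1 Bd3y); ring.
  rewrite /conic_level.
  by apply: (eq_lc2 (k := A * d2 Q) (k' := 2 * d2 P * A - d1 P * B) e2 e1); ring.
Qed.

Let finN1 : fin N^-1.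
Proof.
rewrite N1_conic; have fv := finO O_v; have fv' := finO O_v_d3y.
apply: finM; first by apply: finC; apply: M_V; apply: M_conic_level.
apply: finD; last by do 2?[apply: finM => //]; apply: finC.
apply: finD.
  by apply: finM => //; apply: finN; apply: finM => //; apply: finC.
apply: finN; do 3?[apply: finM => //]; apply: finC => //.
by rewrite der_nat.
Qed.

(** [N] and its inverse are polynomials in [A] and [B] over [M], hence of finite
    weight, and [N] is not constant because it is a derivative along the fibre. *)
Lemma asymptotic_rational : exists2 w, w ^+ 2 = W & d3 w = 0.
Proof.
have NN : N * N^-1 = 1 by rewrite divff ?N_neq0.
have [_ finNN] := finPsiN.
have [w ew Dw] := finite_weight_unit char0 hD Delta0 DW finNN finN1 NN N_D_neq0.
by exists w => //; apply: D0P.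
Qed.

Section Ruling.

Variables (om m mu t t' kap : L).
Hypotheses (om2 : om ^+ 2 = d2 P ^+ 2 - d1 P * d2 Q) (M_om : d3 om = 0).
Hypotheses (em : m = (om - d2 P) / d2 Q) (emu : mu = (- om - d2 P) / d2 Q).
Hypotheses (et : t = A + m * B) (et' : t' = A + mu * B).
Hypothesis ekap : kap = conic_level / d2 Q.

Let om0 : om != 0.
Proof. by apply: contraNneq Delta0 => e0; rewrite -om2 e0 expr0n. Qed.

Let M_m : d3 m = 0.
Proof. by rewrite em der_div0 // (derB h3) M_om M_P2 subrr. Qed.
Let M_mu : d3 mu = 0.
Proof. by rewrite emu der_div0 // (derB h3) (derN h3) M_om M_P2 !oppr0 addr0. Qed.

Let mQ2 : m * d2 Q = om - d2 P. Proof. by rewrite em divfK. Qed.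
Let muQ2 : mu * d2 Q = - om - d2 P. Proof. by rewrite emu divfK. Qed.

Let mP2 : d1 P + m * d2 P = - m * om.
Proof.
apply: (mulIf Q2).
by apply: (eq_lc2 (k := d2 P + om) (k' := 1) mQ2 om2); ring.
Qed.

Let muP2 : d1 P + mu * d2 P = mu * om.
Proof.
apply: (mulIf Q2).
by apply: (eq_lc2 (k := d2 P - om) (k' := 1) muQ2 om2); ring.
Qed.

Let tt' : t * t' = kap.
Proof.
apply: (mulIf Q2); rewrite ekap divfK // et et' /conic_level.
apply: (mulIf Q2).
have -> : (A + m * B) * (A + mu * B) * d2 Q * d2 Q =
  (A * d2 Q + m * d2 Q * B) * (A * d2 Q + mu * d2 Q * B) by ring.
by rewrite mQ2 muQ2; apply: (eq_lc1 (k := - B ^+ 2) om2); ring.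
Qed.

Let kap1 : kap != 0. Proof. by rewrite ekap mulf_neq0 ?invr_eq0. Qed.
Let M_kap : d3 kap = 0. Proof. by rewrite ekap der_div0 // M_conic_level. Qed.

Let t0 : t != 0.
Proof. by apply: contraNneq kap1 => e0; rewrite -tt' e0 mul0r. Qed.

Let Dt : D t = - om * t.
Proof.
rewrite et (derD hD) (derM hD) (D0 M_m) DA DB.
apply: (mulIf Q2); have e1 := mQ2.
by apply: (eq_lc2 (k := (d2 P * B - d2 Q * A) + om * B) (k' := B) e1 om2); ring.
Qed.

Let d3t : d3 t != 0.
Proof.
apply/eqP=> e0; have := Dt; rewrite /D e0 mulr0 => /esym/eqP.
by rewrite mulf_eq0 oppr_eq0 (negPf om0) (negPf t0).
Qed.

(* the Laurent polynomials in [t] over the kernel of [d3]; they contain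
   [t' = kap / t], hence [A] and [B] *)
Let laur F := exists i, polyrep d3 t (F * t ^+ i).

Let laurC k : d3 k = 0 -> laur k.
Proof. by move=> h; exists 0%N; rewrite expr0 mulr1; apply: polyrepC. Qed.

Let laurD F G : laur F -> laur G -> laur (F + G).
Proof.
move=> [i hi] [j hj]; exists (i + j)%N.
have -> : (F + G) * t ^+ (i + j) = F * t ^+ i * t ^+ j + G * t ^+ j * t ^+ i.
  by rewrite exprD; ring.
by apply: polyrepD => //; apply: polyrepM => //; apply: polyrepXn => //; apply: polyrepX.
Qed.

Let laurM F G : laur F -> laur G -> laur (F * G).
Proof.
move=> [i hi] [j hj]; exists (i + j)%N.
have -> : (F * G) * t ^+ (i + j) = (F * t ^+ i) * (G * t ^+ j) by rewrite exprD; ring.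
exact: polyrepM.
Qed.

Let laurN F : laur F -> laur (- F).
Proof.
move=> h; rewrite -mulN1r; apply: laurM => //; apply: laurC.
by rewrite (derN h3) (der1 h3) oppr0.
Qed.

Let laurX F n : laur F -> laur (F ^+ n).
Proof.
move=> h; elim: n => [|n ih]; first by apply: laurC; rewrite expr0 (der1 h3).
by rewrite exprS; apply: laurM.
Qed.

Let laur_t : laur t.
Proof. by exists 0%N; rewrite expr0 mulr1; apply: polyrepX. Qed.

Let laur_t' : laur t'.
Proof. by exists 1%N; rewrite expr1 mulrC tt'; apply: polyrepC. Qed.

Let B_tt' : B = (t - t') * (d2 Q / (2 * om)).
Proof.
have k0 : 2 * om != 0 by rewrite mulf_neq0.
rewrite mulrA -[LHS](mulfK k0); congr (_ / _); rewrite et et'.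
by apply: (eq_lc2 (k := - B) (k' := B) mQ2 muQ2); ring.
Qed.

Let laurB : laur B.
Proof.
rewrite B_tt'; apply: laurM; first by apply: laurD => //; apply: laurN.
apply: laurC; rewrite der_div0 //.
by rewrite (derM h3) (der_nat h3) M_om mul0r mulr0 addr0.
Qed.

Let laurA : laur A.
Proof.
have -> : A = t + - (m * B) by rewrite et; ring.
by apply: laurD => //; apply: laurN; apply: laurM => //; apply: laurC.
Qed.

Let laurx : laur x.
Proof.
rewrite x_AB; apply: laurM; last by apply: laurC; apply: M_V.
apply: laurD; last apply: laurN; (apply: laurM; first exact: laurC); apply: laurD => //;
  by apply: laurN; apply: laurC; rewrite ?M_d1 ?M_d2.
Qed.

Let laury : laur y.
Proof.
rewrite y_AB; apply: laurM; last by apply: laurC; apply: M_V.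
apply: laurD; last apply: laurN; (apply: laurM; first exact: laurC); apply: laurD => //;
  by apply: laurN; apply: laurC; rewrite ?M_d1 ?M_d2.
Qed.

Let laurO F : O F -> laur F.
Proof.
apply: polyfun_sub => //; first by move=> c' /constant_d[_ _ h]; apply: laurC.
rewrite (fr_z fr); apply: laurD; last exact: laurC.
by apply: laurD; apply: laurM => //; apply: laurC; rewrite ?M_P ?M_Q.
Qed.

Let laur_N : laur N.
Proof.
have [a1 a2 a3] := M_dd; have [a4 a5 a6 a7] := M_ddP; have [a8 a9] := M_de.
have fV n : laur (n%:R)^-1 by apply: laurC; rewrite (derV h3) (der_nat h3) mul0r oppr0.
have fn n : laur n%:R by apply: laurC; rewrite (der_nat h3).
have fx := laurx; have fy := laury; have fX := laurX; have fA := laurA; have fB := laurB.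
by rewrite N_ab /alpha /beta; repeat first [exact: fV|exact: fn|assumption|exact: laurC
  |apply: fX|apply: laurN|apply: laurD|apply: laurM].
Qed.

Let laur_N1 : laur N^-1.
Proof.
have fv := laurO O_v; have fv' := laurO O_v_d3y.
rewrite N1_conic; apply: laurM; first by apply: laurC; apply: M_V; apply: M_conic_level.
apply: laurD; last by do 2?[apply: laurM => //]; apply: laurC.
apply: laurD.
  by apply: laurM => //; apply: laurN; apply: laurM => //; apply: laurC.
apply: laurN; do 3?[apply: laurM => //]; apply: laurC => //.
by rewrite der_nat.
Qed.

(** [N] is a unit among the Laurent polynomials in [t] and is not constant. *)
Lemma N_monomial : exists nu n, [/\ d3 nu = 0, nu != 0
  & N = nu * t ^+ n.+1 \/ N = nu * t' ^+ n.+1].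
Proof.
have [i hi] := laur_N; have [j hj] := laur_N1.
have NN : N * N^-1 = 1 by rewrite divff ?N_neq0.
have [nu [n [M_nu nu0 eN']]] := laurent_unit_monomial char0 h3 d3t t0 hi hj NN.
have nat1 k l : (k < l)%N -> ((l - k).-1.+1 + k = l)%N by clear; lia.
case: (ltngtP i n) => ltin.
- exists nu, (n - i).-1; split=> //; left; apply: (mulIf (expf_neq0 i t0)).
  by rewrite eN' -mulrA -exprD nat1.
- exists (nu / kap ^+ (i - n).-1.+1), (i - n).-1; split.
  + by rewrite der_div0 // (derX h3) M_kap mulr0.
  + by rewrite mulf_neq0 ?invr_eq0 ?expf_neq0.
  right; apply: (mulIf (expf_neq0 i t0)); rewrite eN' -{3}(nat1 _ _ ltin) exprD.
  rewrite -!mulrA [t' ^+ _ * _]mulrA -exprMn [t' * t]mulrC tt'.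
  by rewrite [_^-1 * _]mulrA mulVf ?mul1r // expf_neq0.
have eNnu : N = nu.
  by apply: (mulIf (expf_neq0 i t0)); rewrite eN' ltin.
by have := N_D_neq0; rewrite eNnu D0 ?eqxx.
Qed.

(** * The rulings of the image *)

Variables (nu : L) (n : nat) (del tau tau' : L) (dr dq : L -> L).
Hypotheses (M_nu : d3 nu = 0) (eNt : N = nu * t ^+ n.+1) (edel : del = m - mu).
Hypotheses (edr : forall u, dr u = d1 u + m * d2 u)
  (edq : forall u, dq u = d1 u + mu * d2 u).
Hypotheses (etau : tau = dr c) (etau' : tau' = dq c).

Let delQ2 : del * d2 Q = 2 * om.
Proof. by apply: (eq_lc2 (k := 1) (k' := -1) mQ2 muQ2); rewrite edel; ring. Qed.

Let del0 : del != 0.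
Proof.
by apply: contraNneq om0 => e0; move/eqP: delQ2; rewrite e0 mul0r eq_sym mulf_eq0 (negPf n2).
Qed.

Let M_del : d3 del = 0. Proof. by rewrite edel (derB h3) M_m M_mu subrr. Qed.

Let hr : derivation dr.
Proof.
by split=> u w; rewrite !edr ?(derD h1, derD h2) ?(derM h1, derM h2); ring.
Qed.

Let hq : derivation dq.
Proof.
by split=> u w; rewrite !edq ?(derD h1, derD h2) ?(derM h1, derM h2); ring.
Qed.

Let M_dr u : d3 u = 0 -> d3 (dr u) = 0.
Proof.
by move=> hu; rewrite edr (derD h3) (derM h3) M_m M_d1 // M_d2 // !mul0r mulr0 !addr0.
Qed.

Let M_dq u : d3 u = 0 -> d3 (dq u) = 0.
Proof.
by move=> hu; rewrite edq (derD h3) (derM h3) M_mu M_d1 // M_d2 // !mul0r mulr0 !addr0.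
Qed.

Let M_tau : d3 tau = 0. Proof. by rewrite etau M_dr. Qed.
Let M_tau' : d3 tau' = 0. Proof. by rewrite etau' M_dq. Qed.

Let t_y : t = tau + om * (y - m * x).
Proof.
rewrite et eA eB etau edr.
by apply: (eq_lc2 (k := x) (k' := y) mP2 mQ2); ring.
Qed.

Let t'_y : t' = tau' - om * (y - mu * x).
Proof.
rewrite et' eA eB etau' edq.
by apply: (eq_lc2 (k := x) (k' := y) muP2 muQ2); ring.
Qed.

Let s := tau + tau'.

Let omx : om * x = - (t + t' - s) / del.
Proof.
apply: (mulIf del0); rewrite divfK // /s edel.
by apply: (eq_lc2 (k := 1) (k' := 1) t_y t'_y); ring.
Qed.

(** The logarithmic derivative of the conic along a field [d] that kills [x]. *)
Let F (d : L -> L) := d kap - t' * d tau - t * d tau'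
  - d om / om * (2 * kap - tau * t' - tau' * t) - (t + t' - s) / del * (t' * d m - t * d mu).

Let F_y d : derivation d -> d x = 0 -> - om * del * B * d y = F d.
Proof.
move=> hd dx0.
have dB : del * B = t - t' by rewrite edel et et'; ring.
have dt : d t = d tau + d om * (y - m * x) + om * (d y - x * d m).
  by rewrite {1}t_y (derD hd) (derM hd) (derB hd) (derM hd) dx0; ring.
have dt' : d t' = d tau' - d om * (y - mu * x) - om * (d y - x * d mu).
  by rewrite {1}t'_y (derB hd) (derM hd) (derB hd) (derM hd) dx0; ring.
have dkap : d kap = d t * t' + t * d t' by rewrite -tt' (derM hd).
have ey : y - m * x = (t - tau) / om.
  by apply: (mulIf om0); rewrite divfK //; apply: (eq_lc1 (k := -1) t_y); ring.
have ey' : y - mu * x = (tau' - t') / om.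
  by apply: (mulIf om0); rewrite divfK //; apply: (eq_lc1 (k := 1) t'_y); ring.
have -> : - om * del * B * d y = - om * (t - t') * d y by rewrite -dB; ring.
have -> : F d = d kap - t' * d tau - t * d tau'
  - d om / om * (2 * kap - tau * t' - tau' * t) + om * x * (t' * d m - t * d mu).
  by rewrite /F omx; ring.
rewrite dkap dt dt' ey ey' -tt'.
by field.
Qed.

Let drx : dr x = 0. Proof. by rewrite edr (fr_1x fr) (fr_2x fr) mulr0 addr0. Qed.
Let dqx : dq x = 0. Proof. by rewrite edq (fr_1x fr) (fr_2x fr) mulr0 addr0. Qed.

Let N_F : - om * del ^+ 2 * N = t * F dq - t' * F dr.
Proof.
rewrite -(F_y hr drx) -(F_y hq dqx) eN !edr !edq et et' edel; ring.
Qed.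

Let a0 (d : L -> L) := - kap ^+ 2 * d m / del.
Let a1 (d : L -> L) := kap * (- d tau + d om / om * tau + s * d m / del).
Let a2 (d : L -> L) := d kap - 2 * kap * d om / om - kap / del * (d m - d mu).
Let a3 (d : L -> L) := - d tau' + d om / om * tau' - s * d mu / del.
Let a4 (d : L -> L) := d mu / del.

Let F_t d : t ^+ 2 * F d = a0 d + a1 d * t + a2 d * t ^+ 2 + a3 d * t ^+ 3 + a4 d * t ^+ 4.
Proof.
rewrite /F /a0 /a1 /a2 /a3 /a4 -tt'; move: (d m) (d mu) (d om) (d tau) (d tau') (d (t * t')) s => *.
by field; rewrite del0 om0.
Qed.

Let C0 := - kap * a0 dr.
Let C1 := - kap * a1 dr.
Let C2 := a0 dq - kap * a2 dr.
Let R := a1 dq + a2 dq * t + a3 dq * t ^+ 2 + a4 dq * t ^+ 3 - kap * (a3 dr + a4 dr * t)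
  + om * del ^+ 2 * nu * t ^+ n.+1.

Let low : C0 + C1 * t + C2 * t ^+ 2 + t ^+ 3 * R = 0.
Proof.
have e1 := F_t dr; have e2 := F_t dq; have e3 := N_F; rewrite eNt in e3.
have e4 := tt'.
rewrite /C0 /C1 /C2 /R.
apply: (eq_lc4 (k1 := kap) (k2 := - t ^+ 2) (k3 := - t ^+ 3) (k4 := t ^+ 2 * F dr) e1 e2 e3 e4).
by ring.
Qed.

Let M_a d : (forall u, d3 u = 0 -> d3 (d u) = 0) ->
  [/\ d3 (a0 d) = 0, d3 (a1 d) = 0, d3 (a2 d) = 0, d3 (a3 d) = 0 & d3 (a4 d) = 0].
Proof.
move=> hd; have [b1 b2] := (hd _ M_m, hd _ M_mu); have [b3 b4] := (hd _ M_om, hd _ M_tau).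
have [b5 b6] := (hd _ M_tau', hd _ M_kap).
have Ms : d3 s = 0 by rewrite /s (derD h3) M_tau M_tau' addr0.
rewrite /a0 /a1 /a2 /a3 /a4; split;
rewrite !(derD h3, derN h3, derM h3, derV h3) ?b1 ?b2 ?b3 ?b4 ?b5 ?b6 ?Ms ?M_kap ?M_om ?M_del
  ?M_tau ?M_tau' ?(der1 h3); ring.
Qed.

(** Multiplied by a power of [t], the equation for [N] is polynomial in [t] with
    right-hand side divisible by [t ^ 3], so its three lowest coefficients vanish:
    the first of them says that the direction [dr] is constant along itself. *)
Lemma ruling_equations : [/\ dr m = 0, dr tau = dr om / om * tau &
  dr kap = 2 * kap * dr om / om - kap * (dr mu + dq m) / del].
Proof.
have [r0 r1 r2 r3 r4] := M_a M_dr; have [q0 q1 q2 q3 q4] := M_a M_dq.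
have MC0 : d3 C0 = 0 by rewrite /C0 (derM h3) (derN h3) M_kap r0; ring.
have MC1 : d3 C1 = 0 by rewrite /C1 (derM h3) (derN h3) M_kap r1; ring.
have MC2 : d3 C2 = 0 by rewrite /C2 (derB h3) (derM h3) q0 M_kap r2; ring.
have rC u : d3 u = 0 -> polyrep d3 t u by exact: polyrepC.
have rt i : polyrep d3 t (t ^+ i) by apply: polyrepXn => //; apply: polyrepX.
have rt1 : polyrep d3 t t by apply: polyrepX.
have hR : polyrep d3 t R.
  rewrite /R; apply: polyrepD => //; last first.
    by apply: polyrepM => //; apply: rC; rewrite !(derM h3, derX2 h3) M_om M_del M_nu; ring.
  apply: polyrepB => //; last first.
    apply: polyrepM => //; first exact: rC.
    by apply: polyrepD => //; [exact: rC|apply: polyrepM => //; exact: rC].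
  have rM k i : d3 k = 0 -> polyrep d3 t (k * t ^+ i).
    by move=> hk; apply: polyrepM => //; apply: rC.
  have rM1 k : d3 k = 0 -> polyrep d3 t (k * t).
    by move=> hk; apply: polyrepM => //; apply: rC.
  apply: polyrepD => //; last exact: rM.
  apply: polyrepD => //; last exact: rM.
  by apply: polyrepD => //; [exact: rC|exact: rM1].
have [z0 z1 z2] := polyrep_low char0 h3 d3t MC0 MC1 MC2 hR low.
have drm : dr m = 0.
  move/eqP: z0; rewrite /C0 /a0 !mulf_eq0 !oppr_eq0 invr_eq0 (negPf kap1) (negPf del0).
  by rewrite mulf_eq0 (negPf kap1) orbF /= => /eqP.
split=> //.
  move/eqP: z1; rewrite /C1 /a1 !mulf_eq0 !oppr_eq0 (negPf kap1) drm /= => /eqP e1.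
  by apply: (eq_lc1 (k := -1) e1); ring.
move: z2; rewrite /C2 /a0 /a2 drm => z2; apply: (mulfI kap1).
by apply: (eq_lc1 (k := -1) z2); ring.
Qed.

Let drm : dr m = 0. Proof. by have [] := ruling_equations. Qed.

(** * Preimages of the rulings *)

Let m2 := d2 m.

Let dr_d2 u : dr (d2 u) = d2 (dr u) - m2 * d2 u.
Proof. by rewrite !edr c12 (derD h2) (derM h2) /m2; ring. Qed.

Let drm2 : dr m2 = - m2 ^+ 2.
Proof. by rewrite /m2 dr_d2 drm (der0 h2) /m2; ring. Qed.

Let drQ : dr Q = om.
Proof. by rewrite edr d1Q mQ2; ring. Qed.

Let drP : dr P = - m * om.
Proof. by rewrite edr mP2. Qed.

Variables (nn : L).
Hypothesis enn : nn = P + m * Q.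

Let drnn : dr nn = 0.
Proof. by rewrite enn (derD hr) (derM hr) drP drQ drm; ring. Qed.

Let d2nn : d2 nn = om + m2 * Q.
Proof. by rewrite enn (derD h2) (derM h2) mQ2 /m2; ring. Qed.

Let M_nn : d3 nn = 0.
Proof. by rewrite enn (derD h3) (derM h3) M_P M_Q M_m; ring. Qed.

Let drom : dr om = - 2 * m2 * om.
Proof.
have e1 := dr_d2 nn; rewrite drnn (der0 h2) d2nn (derD hr) (derM hr) drQ drm2 in e1.
by apply: (eq_lc1 (k := 1) e1); ring.
Qed.

Let dqm : dq m = - del * m2.
Proof.
have := drm; rewrite edr edq edel /m2 => e1.
by apply: (eq_lc1 (k := 1) e1); ring.
Qed.

Let drdel : dr del = - dr mu.
Proof. by rewrite edel (derB hr) drm; ring. Qed.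

Let drtau : dr tau = - 2 * m2 * tau.
Proof.
by have [_ e1 _] := ruling_equations; rewrite e1 drom; field.
Qed.

Let drkap : dr kap = - 3 * m2 * kap - kap * dr mu / del.
Proof.
by have [_ _ e1] := ruling_equations; rewrite e1 drom dqm; field; rewrite del0 om0.
Qed.

(** [G] parametrizes the rulings: it is affine in [a] with slope [eta], and [eta]
    is zero when [m] is a constant. *)
Lemma ruling_scale : exists G eta, [/\ G != 0, d3 G = 0, dr G = d2 m * G, eta = G * d2 m
  & eta = 1 \/ eta = 0 /\ G * om = 1].
Proof.
have [m20|m20] := eqVneq m2 0.
  exists om^-1, 0; split; rewrite ?invr_eq0 ?M_V //.
  - by rewrite (derV hr) drom m20 -/m2 m20; ring.
  - by rewrite -/m2 m20 mulr0.
  by right; rewrite mulVf.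
exists m2^-1, 1; split; rewrite ?invr_eq0 ?M_V ?mulVf //; last by left.
  by rewrite M_d2.
by rewrite (derV hr) drm2 -/m2; field.
Qed.

Variables (G eta : L) (ds : L -> L).
Hypotheses (G1 : G != 0) (M_G : d3 G = 0) (drG : dr G = d2 m * G).
Hypotheses (eeta : eta = G * d2 m) (C_eta : C eta).
Hypothesis eds : forall u, ds u = G * d2 u.

Local Notation K := (constant2 d3 dr).

Let hs : derivation ds.
Proof. by split=> u w; rewrite !eds ?(derD h2) ?(derM h2); ring. Qed.

Let drs u : dr (ds u) = ds (dr u).
Proof. by rewrite !eds (derM hr) drG dr_d2 /m2; ring. Qed.

Let M_ds u : d3 u = 0 -> d3 (ds u) = 0.
Proof. by move=> hu; rewrite eds (derM h3) M_G M_d2 // mul0r mulr0 addr0. Qed.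

Let Kds u : K u -> K (ds u).
Proof. by move=> [e1 e2]; split; rewrite ?drs ?e2 ?(der0 hs) //; apply: M_ds. Qed.

Let KC k : C k -> K k.
Proof. by move=> /constant_d[e1 e2 e3]; split; rewrite ?edr ?e1 ?e2 ?mulr0 ?addr0. Qed.

Let dsC k : C k -> ds k = 0.
Proof. by move=> /constant_d[e1 e2 e3]; rewrite eds e2 mulr0. Qed.

Let KG0 : K (G - eta * a).
Proof.
have [e1 e2] := KC C_eta; split.
  by rewrite (derB h3) (derM h3) M_G e1 (fr_3a fr); ring.
by rewrite (derB hr) (derM hr) drG e2 edr (fr_1a fr) (fr_2a fr) eeta; ring.
Qed.

(** On the preimage of a ruling, [X1] and [X0 = a X1] are coordinates over the
    field [K] of functions constant on the rulings: [y] and [z] are affine in [x],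
    [X0] and [X1], and [x X1] is quadratic in [X0] and [X1]; the remaining names
    stand for the coefficients, which lie in [K]. *)
Variables (G0 ph c1 c0 n' q1 X0 X1 psi al psi1 psi0 Cc z0 z1 : L).
Hypotheses (eG0 : G0 = G - eta * a) (eph : ph = G ^+ 2 * om).
Hypotheses (ec1 : c1 = tau / om) (ec0 : c0 = c - c1 * Q).
Hypotheses (en' : n' = ds nn) (eq1 : q1 = Q * G - n' * a).
Hypotheses (eX1 : X1 = - G * t) (eX0 : X0 = a * X1).
Hypotheses (epsi : psi = G ^+ 3 * d2 Q) (eal : al = eta * ds n').
Hypotheses (epsi1 : psi1 = dr psi - 2 * al * a).
Hypothesis epsi0 : psi0 = psi - al * a ^+ 2 - psi1 * a.
Hypothesis eCc : Cc = G * kap / (om * del).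
Hypothesis ez1 : z1 = - (eta * ds c0 + n' * ds c1) / ph.
Hypothesis ez0 : z0 = - (ds c0 * G0 + ds c1 * q1) / ph.

Let ph1 : ph != 0. Proof. by rewrite eph mulf_neq0 ?expf_neq0. Qed.

Let dra : dr a = 1. Proof. by rewrite edr (fr_1a fr) (fr_2a fr); ring. Qed.

Let Kph : K ph.
Proof.
split; first by rewrite eph (derM h3) (derX2 h3) M_G M_om; ring.
by rewrite eph (derM hr) (derX2 hr) drG drom /m2; ring.
Qed.

Let n'E : n' = G * om + eta * Q.
Proof. by rewrite en' eds d2nn eeta /m2; ring. Qed.

Let Kn : K nn. Proof. by []. Qed.
Let Kn' : K n'. Proof. by rewrite en'; apply: Kds. Qed.
Let Km : K m. Proof. by []. Qed.

Let Kc1 : K c1.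
Proof.
split; first by rewrite ec1 der_div0.
by rewrite ec1 (derM hr) (derV hr) drtau drom; field.
Qed.

Let Kc0 : K c0.
Proof.
have [e1 e2] := Kc1; split; first by rewrite ec0 (derB h3) (derM h3) e1 M_c M_Q; ring.
by rewrite ec0 (derB hr) (derM hr) e2 drQ -etau ec1; field.
Qed.

Let Kq1 : K q1.
Proof.
have [e1 e2] := Kn'; split; rewrite eq1.
  by rewrite (derB h3) !(derM h3) M_Q M_G e1 (fr_3a fr); ring.
by rewrite (derB hr) !(derM hr) drQ drG e2 dra n'E eeta; ring.
Qed.

Let drQ2 : dr (d2 Q) = d2 om - m2 * d2 Q.
Proof. by rewrite dr_d2 drQ. Qed.

Let eta0 : ds eta = 0. Proof. exact: dsC. Qed.

Let dsn' : ds n' = ds G * om + G * ds om + eta * ds Q.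
Proof. by rewrite n'E !(derE hs) eta0; ring. Qed.

Let KdsG : K (ds G).
Proof.
split; first exact: M_ds.
by rewrite drs drG mulrC -eeta eta0.
Qed.

Let drpsi : dr psi = eta * G ^+ 2 * d2 Q + G * ds n' - ph * ds G / G.
Proof.
rewrite epsi (derM hr) (derX3 hr) drG drQ2 dsn' !eds eeta eph /m2.
by field.
Qed.

Let drdrpsi : dr (dr psi) = 2 * al.
Proof.
have [e1 e2] := Kds Kn'; have [e3 e4] := Kph; have [e5 e6] := KdsG.
have [e7 e8] := KC C_eta.
rewrite drpsi (derB hr) (derD hr) !(derM hr) (derV hr) e2 e4 e6 e8 drG drQ2.
by rewrite eal dsn' !eds eeta eph /m2; field.
Qed.

Let Kal : K al.
Proof. by rewrite eal; apply: constant2M => //; [apply: KC|apply: Kds]. Qed.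

Let M_psi : d3 psi = 0.
Proof. by rewrite epsi (derM h3) (derX3 h3) M_G M_Q2; ring. Qed.

Let Kpsi1 : K psi1.
Proof.
have [e1 e2] := Kal; split; rewrite epsi1.
  by rewrite (derB h3) !(derM h3) e1 (fr_3a fr) (M_dr M_psi) (der_nat h3); ring.
by rewrite (derB hr) !(derM hr) e2 drdrpsi dra (der_nat hr); ring.
Qed.

Let Kpsi0 : K psi0.
Proof.
have [e1 e2] := Kal; have [e3 e4] := Kpsi1; split; rewrite epsi0.
  by rewrite !(derB h3) !(derM h3) e1 e3 M_psi (fr_3a fr); ring.
rewrite !(derB hr) !(derM hr) e2 e4 dra epsi1; ring.
Qed.

Let KCc : K Cc.
Proof.
split; first by rewrite eCc der_div0 // (derM h3) ?M_G ?M_kap ?M_om ?M_del; ring.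
rewrite eCc (derM hr) (derV hr) !(derM hr) drG drkap drom drdel /m2.
by field; rewrite om0 del0.
Qed.

Let Cc1 : Cc != 0.
Proof. by rewrite eCc !mulf_neq0 ?invr_eq0 ?mulf_neq0. Qed.

Let Kz1 : K z1.
Proof.
have cM := @constant2M _ _ _ h3 hr; have cN := @constant2N _ _ _ h3 hr.
have cD := @constant2D _ _ _ h3 hr; have cV := @constant2V _ _ _ h3 hr.
by rewrite ez1; apply cM; [apply cN; apply cD; apply cM; auto|apply cV].
Qed.

Let KG0' : K G0. Proof. by rewrite eG0. Qed.

Let Kz0 : K z0.
Proof.
have cM := @constant2M _ _ _ h3 hr; have cN := @constant2N _ _ _ h3 hr.
have cD := @constant2D _ _ _ h3 hr; have cV := @constant2V _ _ _ h3 hr.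
by rewrite ez0; apply cM; [apply cN; apply cD; apply cM; auto|apply cV].
Qed.

Let zeta : (tau + tau') / (om * del) = z0 + z1 * a.
Proof.
have etd : tau' = tau - del * d2 c by rewrite etau etau' edr edq edel; ring.
have -> : tau = c1 * om by rewrite ec1 divfK.
have e1 : tau' = c1 * om - del * d2 c by rewrite etd ec1 divfK.
have ec : d2 c = d2 c0 + d2 c1 * Q + c1 * d2 Q.
  have -> : c = c0 + c1 * Q by rewrite ec0; ring.
  by rewrite (derD h2) (derM h2); ring.
have -> : z0 + z1 * a = - (ds c0 * (G0 + eta * a) + ds c1 * (q1 + n' * a)) / ph.
  by rewrite ez0 ez1; ring.
rewrite e1 ec eG0 eq1 !eds eph.
have -> : G - eta * a + eta * a = G by ring.
have -> : Q * G - n' * a + n' * a = Q * G by ring.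
have -> : del = 2 * om / d2 Q by rewrite -delQ2; field.
by field; rewrite om0 Q2 n2 G1.
Qed.

Let x_X : x * X1 = al / (2 * ph ^+ 2) * X0 ^+ 2 + z1 * X0 + Cc
  + X1 * (psi1 / (2 * ph ^+ 2) * X0 + psi0 / (2 * ph ^+ 2) * X1 + z0).
Proof.
have ex : x = - (t + t' - s) / del / om by rewrite -omx mulrC mulKf.
have e1 : x * X1 = G * t ^+ 2 / (om * del) + Cc + (z0 + z1 * a) * X1.
  rewrite -zeta ex eX1 eCc -tt' /s; move: (tau + tau') => w.
  by field; rewrite om0 del0.
have e2 : psi = al * a ^+ 2 + psi1 * a + psi0 by rewrite epsi0; ring.
have e3 : G * t ^+ 2 / (om * del) = psi / (2 * ph ^+ 2) * X1 ^+ 2.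
  have -> : del = 2 * om / d2 Q by rewrite -delQ2; field.
  by rewrite epsi eph eX1; field; rewrite om0 Q2 n2 G1.
by rewrite e1 e3 e2 eX0; field; rewrite n2 ph1.
Qed.

Let Y1E : t / om = - (G0 * X1 + eta * X0) / ph.
Proof. by rewrite eG0 eX0 eX1 eph; field; rewrite om0 G1. Qed.

Let QY1E : Q * (t / om) = - (n' * X0 + q1 * X1) / ph.
Proof. by rewrite eq1 eX0 eX1 eph; field; rewrite om0 G1. Qed.

Let y_X : y = t / om - c1 + m * x.
Proof. by rewrite t_y ec1; field. Qed.

Let z_X : z = nn * x + Q * (t / om) + c0.
Proof. by rewrite (fr_z fr) {1}y_X enn ec0; ring. Qed.

Let X1_neq0 : X1 != 0.
Proof. by rewrite eX1 mulf_neq0 ?oppr_eq0. Qed.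

Let d3X1 : d3 X1 != 0.
Proof.
by rewrite eX1 (derM h3) (derN h3) M_G oppr0 mul0r add0r mulf_neq0 ?oppr_eq0.
Qed.

Let jac : d3 X0 * dr X1 - dr X0 * d3 X1 != 0.
Proof.
have -> : d3 X0 * dr X1 - dr X0 * d3 X1 = - X1 * d3 X1.
  by rewrite eX0 (derM h3) (derM hr) dra (fr_3a fr); ring.
by rewrite mulf_neq0 ?oppr_eq0.
Qed.

(** The preimage of a ruling is a quadric surface, on which [X1 a = X0]: the
    polynomial [a] would have a pole where [X1] vanishes and [X0] does not, and
    such points exist unless [al] and [z1] vanish. *)
Lemma quadric_exceptional : al = 0 /\ z1 = 0.
Proof.
pose q : {poly L} := (al / (2 * ph ^+ 2))%:P * 'X^2 + z1%:P * 'X + Cc%:P.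
pose S := psi1 / (2 * ph ^+ 2) * X0 + psi0 / (2 * ph ^+ 2) * X1 + z0.
have cM := @constant2M _ _ _ h3 hr; have cV := @constant2V _ _ _ h3 hr.
have cX := @constant2X _ _ _ h3 hr; have cn := @constant2_nat _ _ _ h3 hr.
have cD := @constant2D _ _ _ h3 hr; have cN := @constant2N _ _ _ h3 hr.
have Kp u : K u -> K (u / (2 * ph ^+ 2)).
  by move=> hu; apply cM => //; apply cV; apply cM; [apply cn|apply cX].
have Kalp := Kp _ Kal.
have Kq d : (d = d3 \/ d = dr) -> kerpoly d q.
  move=> hd; have hd' : derivation d by case: hd => ->.
  have [dA' dz' dC'] : [/\ d (al / (2 * ph ^+ 2)) = 0, d z1 = 0 & d Cc = 0].
    have [e1 e2] := Kalp; have [e3 e4] := Kz1; have [e5 e6] := KCc.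
    by case: hd => ->.
  rewrite /q; apply: (kerpolyD hd'); last exact: (kerpolyC hd').
  apply: (kerpolyD hd'); apply: (kerpolyM hd'); try exact: (kerpolyC hd').
    exact: (kerpolyXn hd').
  exact: (kerpolyX hd').
have rD := @poly2repD _ _ _ h3 hr X0 X1; have rM := @poly2repM _ _ _ h3 hr X0 X1.
have rC := @poly2repC _ _ _ h3 hr X0 X1.
have rT := poly2rep_T0 h3 hr X0 X1; have rU := poly2rep_T1 h3 hr X0 X1.
have rR : poly2rep d3 dr X0 X1 S.
  have k1 := rC _ (Kp _ Kpsi1); have k0 := rC _ (Kp _ Kpsi0).
  by apply rD; [apply rD; apply rM|apply rC].
have xX1 : x * X1 = q.[X0] + X1 * S.
  by rewrite /q !(hornerD, hornerM, hornerC, hornerX, hornerXn) /S x_X.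
have fC u : K u -> fibre_ring d3 dr X0 X1 q u by exact: fibre_ringC.
have fY : fibre_ring d3 dr X0 X1 q X0 by apply: fibre_ring_poly2rep.
have fX : fibre_ring d3 dr X0 X1 q X1 by apply: fibre_ring_poly2rep.
have fD := @fibre_ringD _ _ _ h3 hr X0 X1 q; have fM := @fibre_ringM _ _ _ h3 hr X0 X1 q.
have fx : fibre_ring d3 dr X0 X1 q x.
  by apply: (fibre_ring_quotient h3 hr rR _ _ xX1); apply: Kq; [left|right].
have fO u : O u -> fibre_ring d3 dr X0 X1 q u.
  apply: polyfun_sub => //.
  - by move=> c' /KC /fC.
  - rewrite y_X Y1E; apply fD; last by apply fM => //; apply: fC.
    have -> : - (G0 * X1 + eta * X0) / ph - c1 =
      - G0 / ph * X1 + (- eta / ph * X0 + - c1) by ring.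
    apply fD; first by apply fM => //; apply: fC; apply cM; [apply cN|apply cV].
    apply fD; last by apply: fC; apply cN.
    by apply fM => //; apply: fC; apply cM; [apply cN; apply: KC|apply cV].
  rewrite z_X QY1E.
  have -> : nn * x + - (n' * X0 + q1 * X1) / ph + c0 =
    nn * x + (- n' / ph * X0 + (- q1 / ph * X1 + c0)) by ring.
  apply fD; first by apply fM => //; apply: fC.
  apply fD; first by apply fM => //; apply: fC; apply cM; [apply cN|apply cV].
  apply fD; last exact: fC.
  by apply fM => //; apply: fC; apply cM; [apply cN|apply cV].
have ea : a * X1 = 'X.[X0] + 0 * X1 by rewrite hornerX eX0; ring.
have K0 : K 0 := cn 0%N.
have dvq := fibre_ring_residue char0 h3 hr jac (kerpolyX h3) (kerpolyX hr) K0 (fO a Oa) ea.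
have cop : coprimep q ('X - 0%:P).
  rewrite coprimep_XsubC /root /q !(hornerD, hornerM, hornerC, hornerX, hornerXn).
  by rewrite ?expr0n /= !mulr0 !add0r.
have sq : size q == 1%N.
  move: cop; rewrite subr0 /coprimep => /eqP <-.
  by apply/eqP/eqp_size; rewrite eqp_sym; apply: dvdp_gcd_idl.
have q1c i : (0 < i)%N -> q`_i = 0.
  by move=> hi; rewrite nth_default // (eqP sq).
have := q1c 2%N isT; have := q1c 1%N isT.
rewrite /q !coefD !coefCM !coefXn !coefX !coefC /= !mulr0 !mulr1 !addr0 !add0r => -> /eqP.
rewrite mulf_eq0 invr_eq0 mulf_eq0 expf_eq0 (negPf n2) (negPf ph1) !orbF => /eqP.
by [].
Qed.

(** * Preimages with a pole at infinity *)

Section Exceptional.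

Hypotheses (al0 : al = 0) (z10 : z1 = 0).
Variables (th h2' : L).
Hypothesis eta_case : (eta = 1 /\ (th = m /\ h2' = b))
  \/ ((eta = 0 /\ G * om = 1) /\ (th = nn /\ h2' = f)).

Let dsn'0 : ds n' = 0.
Proof.
case: eta_case => [[e1 _]|[[e1 e2] _]].
  by move: eal; rewrite al0 e1 mul1r => <-.
by rewrite n'E e1 mul0r addr0 e2 (der1 hs).
Qed.

Let K_C u : K u -> ds u = 0 -> C u.
Proof.
move=> [e1 e2] /eqP; rewrite eds mulf_eq0 (negPf G1) => /eqP e3.
apply: d_constant => //; move: e2; rewrite edr e3; rewrite mulr0 addr0; exact.
Qed.

Let C_n' : C n'. Proof. exact: K_C. Qed.

Let C_k0 : C (eta * c0 + n' * c1).
Proof.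
apply: K_C.
  by apply: (constant2D h3 hr); apply: (constant2M h3 hr) => //; apply: KC.
rewrite (derD hs) !(derM hs) dsn'0 eta0.
move/eqP: z10; rewrite ez1 mulf_eq0 invr_eq0 (negPf ph1) orbF oppr_eq0 => /eqP e1.
by rewrite !mul0r !add0r.
Qed.

Let dsm : ds m = eta. Proof. by rewrite eds eeta. Qed.
Let dsnn : ds nn = n'. Proof. by []. Qed.

Variable r : L.
Hypothesis er : r = n' * m - eta * nn.

Let C_r : C r.
Proof.
rewrite er; apply: K_C.
  apply: (constant2D h3 hr); last apply: (constant2N h3 hr); apply: (constant2M h3 hr) => //.
  exact: KC.
by rewrite (derB hs) !(derM hs) dsn'0 eta0 dsm dsnn; ring.
Qed.

Let X1E : X1 = eta * z - n' * y + r * x - (eta * c0 + n' * c1).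
Proof.
have en := n'E.
rewrite z_X {1}y_X er eX1.
by apply: (eq_lc1 (k := t / om) en); field.
Qed.

Let polyfun_C u : C u -> O u. Proof. exact: PolyfunC. Qed.

Let O_X1 : O X1.
Proof.
rewrite X1E; apply: polyfunB => //; last exact: polyfun_C.
apply: PolyfunD; last by apply: PolyfunM; [apply: polyfun_C|apply: PolyfunX].
by apply: polyfunB => //; (apply: PolyfunM; [apply: polyfun_C|]) => //;
  [apply: PolyfunZ|apply: PolyfunY].
Qed.

Let X1_no_unit w : O w -> C (X1 * w) -> X1 * w = 0.
Proof.
move=> Ow Cw; apply/eqP/negPn/negP=> w0.
have [_ _ e3] := constant_d (polyfun_unit cs char0 O_X1 Ow Cw w0 (erefl _)).
by move: d3X1; rewrite e3 eqxx.
Qed.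

Variable u0 : L.
Hypothesis eu0 : u0 = eta * f - n' * b + r * a.

Let O_u0 : O u0.
Proof.
rewrite eu0; apply: PolyfunD; last by apply: PolyfunM => //; apply: polyfun_C.
by apply: polyfunB => //; apply: PolyfunM => //; apply: polyfun_C.
Qed.

Let drb : dr b = m. Proof. by rewrite edr (fr_1b fr) (fr_2b fr); ring. Qed.
Let drf : dr f = nn. Proof. by rewrite edr (fr_1f fr) (fr_2f fr) enn. Qed.

Let Ku0 : K u0.
Proof.
have [e1 e2] := KC C_eta; have [e3 e4] := KC C_n'; have [e5 e6] := KC C_r.
split; rewrite eu0.
  by rewrite (derD h3) (derB h3) !(derM h3) e1 e3 e5 (fr_3a fr) (fr_3b fr) (fr_3f fr); ring.
by rewrite (derD hr) (derB hr) !(derM hr) e2 e4 e6 dra drb drf er; ring.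
Qed.

Let dsu0 : ds u0 = - ph.
Proof.
have := dsC C_r; rewrite eu0 (derD hs) (derB hs) !(derM hs) eta0 dsn'0 => ->.
by rewrite !eds (fr_2f fr) (fr_2b fr) (fr_2a fr) eph n'E; ring.
Qed.

Let dsth : ds th = 1.
Proof.
case: eta_case => [[e1 [-> _]]|[[e1 e2] [-> _]]]; first by rewrite dsm e1.
by rewrite dsnn n'E e1 e2; ring.
Qed.

Let Kth : K th.
Proof. by case: eta_case => [[_ [-> _]]|[_ [-> _]]]. Qed.

Let h2'_facts : [/\ O h2', d3 h2' = 0 & dr h2' = th].
Proof.
case: eta_case => [[_ [-> ->]]|[_ [-> ->]]]; split=> //; [exact: fr_3b fr|exact: fr_3f fr].
Qed.

Let chi := psi1 / (2 * ph ^+ 2).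

Let psi1_ph : psi1 = - ds ph.
Proof.
have dsQ : ds Q = G * d2 Q by rewrite eds.
have e1 := dsn'; rewrite dsn'0 dsQ in e1.
have e2 : ph * ds G / G = G * om * ds G by rewrite eph; field.
have e3 : ds ph = 2 * G * ds G * om + G ^+ 2 * ds om.
  by rewrite eph (derM hs) (derX2 hs).
rewrite epsi1 al0 drpsi dsn'0 e2 e3.
by apply: (eq_lc1 (k := - G) e1); ring.
Qed.

Let x_X1 : x = Cc / X1 + chi * X0 + psi0 / (2 * ph ^+ 2) * X1 + z0.
Proof.
apply: (mulIf X1_neq0); rewrite x_X al0 z10 /chi; field.
by rewrite X1_neq0 ph1 n2.
Qed.

(* the field that kills [K] and [X1], with [E X0 = 1] *)
Let E u := X1^-1 * dr u - dr X1 / (X1 * d3 X1) * d3 u.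

Let hE : derivation E.
Proof.
by split=> u w; rewrite /E ?(derD hr, derD h3) ?(derM hr, derM h3); ring.
Qed.

Let E_K u : K u -> E u = 0.
Proof. by move=> [e1 e2]; rewrite /E e1 e2; ring. Qed.

Let E_X1 : E X1 = 0.
Proof. by rewrite /E; field; rewrite X1_neq0 d3X1. Qed.

Let E_X0 : E X0 = 1.
Proof. by rewrite eX0 (derM hE) E_X1 /E dra (fr_3a fr); field; rewrite X1_neq0 d3X1. Qed.

Let K_p : [/\ K chi, K (psi0 / (2 * ph ^+ 2)) & K ph^-1].
Proof.
have Kp u : K u -> K (u / (2 * ph ^+ 2)).
  move=> hu; apply: (constant2M h3 hr) => //; apply: (constant2V h3 hr).
  by apply: (constant2M h3 hr); [apply: (constant2_nat h3 hr 2)|apply: (constant2X h3 hr)].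
by split; [apply: Kp|apply: Kp|apply: (constant2V h3 hr)].
Qed.

Let E_Km k u : K k -> E (k * u) = k * E u.
Proof. by move=> hk; rewrite (derM hE) (E_K hk) mul0r add0r. Qed.

Let E_x : E x = chi.
Proof.
have [k1 k2 k3] := K_p.
rewrite x_X1 !(derD hE) (E_Km _ KCc) (E_Km _ k1) (E_Km _ k2) (E_K Kz0) (derV hE) E_X1 E_X0.
ring.
Qed.

Let E_quotient g g' : K g -> K g' -> E (- (g * X0 + g' * X1) / ph) = - g / ph.
Proof.
have [k1 k2 k3] := K_p => hs' hs''.
have -> : - (g * X0 + g' * X1) / ph = ph^-1 * - (g * X0 + g' * X1) by ring.
by rewrite (E_Km _ k3) (derN hE) (derD hE) !E_Km // E_X1 E_X0; ring.
Qed.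

Let E_y : E y = chi * m - eta / ph.
Proof.
rewrite y_X Y1E [G0 * _ + _]addrC (derD hE) (derB hE) E_quotient //; last exact: KC.
by rewrite (E_K Kc1) (E_Km _ Km) E_x; ring.
Qed.

Let E_z : E z = chi * nn - n' / ph.
Proof.
rewrite z_X QY1E !(derD hE) E_quotient // (E_K Kc0) (E_Km _ Kn) E_x; ring.
Qed.

(* two fields with constant coefficients; [E] is a combination of them over [K] *)
Let W1 u := dx u + (m - th * eta) * dy u + (nn - th * n') * dz u.
Let W2 u := eta * dy u + n' * dz u.

Let E_W u : E u = chi * W1 u + (chi * th - ph^-1) * W2 u.
Proof.
have EE w : E w = (X1^-1) * d1 w + (X1^-1 * m) * d2 w + (- dr X1 / (X1 * d3 X1)) * d3 w.
  by rewrite /E edr; ring.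
by rewrite (frame_combination u EE) E_x E_y E_z /W1 /W2; ring.
Qed.

Let C_W : [/\ C eta, C n', C (m - th * eta) & C (nn - th * n')].
Proof.
have [k1 k2] := (KC C_eta, KC C_n').
split=> //; apply: K_C.
- by apply: (constant2D h3 hr) => //; apply: (constant2N h3 hr); apply: (constant2M h3 hr).
- by rewrite (derB hs) (derM hs) dsm dsth eta0; ring.
- by apply: (constant2D h3 hr) => //; apply: (constant2N h3 hr); apply: (constant2M h3 hr).
by rewrite (derB hs) (derM hs) dsnn dsth dsn'0; ring.
Qed.

Let hW1 : derivation W1.
Proof.
by split=> u w; rewrite /W1 ?(derD (derx cs), derD (dery cs), derD (derz cs))
  ?(derM (derx cs), derM (dery cs), derM (derz cs)); ring.
Qed.

Let hW2 : derivation W2.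
Proof.
by split=> u w; rewrite /W2 ?(derD (dery cs), derD (derz cs))
  ?(derM (dery cs), derM (derz cs)); ring.
Qed.

Let O_W1 u : O u -> O (W1 u).
Proof.
have [e1 e2 e3 e4] := C_W => OF.
apply: PolyfunD; first apply: PolyfunD.
- exact: (polyfun_dx cs).
- by apply: PolyfunM; [apply: polyfun_C|apply: (polyfun_dy cs)].
by apply: PolyfunM; [apply: polyfun_C|apply: (polyfun_dz cs)].
Qed.

Let O_W2 u : O u -> O (W2 u).
Proof.
have [e1 e2 e3 e4] := C_W => OF.
apply: PolyfunD.
- by apply: PolyfunM; [apply: polyfun_C|apply: (polyfun_dy cs)].
by apply: PolyfunM; [apply: polyfun_C|apply: (polyfun_dz cs)].
Qed.

Let W12 u : W1 (W2 u) = W2 (W1 u).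
Proof.
have hx := derx cs; have hy := dery cs; have hz := derz cs.
case: C_W; rewrite /W1 /W2; move: (m - th * eta) (nn - th * n') => p q.
move=> [e1 e2 e3] [e4 e5 e6] [e7 e8 e9] [e10 e11 e12].
rewrite !(derD hx, derD hy, derD hz) !(derM hx, derM hy, derM hz).
rewrite e1 e2 e3 e4 e5 e6 e8 e9 e11 e12 (dxdy cs) (dxdz cs) (dydz cs); ring.
Qed.

Let W2_neq0 : (eta != 0) || (n' != 0).
Proof.
case: eta_case => [[-> _]|[[e1 e2] _]]; first by rewrite oner_eq0.
by rewrite n'E e1 e2 mul0r addr0 oner_eq0 orbT.
Qed.

(** Here [X1] is a polynomial of degree one, and [E a = X1^-1].  Up to a factor in
    [K], the field [E] is [W2], or [W1 + kp W2] with a constant [kp]; applied to a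
    suitable polynomial, such a field gives a constant multiple of [X1^-1], so
    that [X1] would be a unit among the polynomials. *)
Lemma exceptional_absurd : False.
Proof.
have [k1 k2 k3] := K_p.
have Ea : E a = X1^-1.
  by rewrite /E dra (fr_3a fr); ring.
have [chi0|chi0] := eqVneq chi 0.
  (* then [ph] is a constant and [- ph^-1 * W2 a] is the inverse of [X1] *)
  have dph : ds ph = 0.
    move/eqP: chi0; rewrite /chi psi1_ph mulf_eq0 oppr_eq0 invr_eq0 mulf_eq0.
    by rewrite expf_eq0 (negPf n2) (negPf ph1) /= orbF => /eqP.
  have e1 : X1 * W2 a = - ph.
    have := E_W a; rewrite Ea chi0 => e1.
    by apply: (eq_lc1 (k := X1 * ph) e1); field; rewrite X1_neq0 ph1.
  have Cph : C (X1 * W2 a) by rewrite e1; apply: (constant3N cs); apply: K_C.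
  by have := X1_no_unit (O_W2 Oa) Cph; rewrite e1 => /eqP; rewrite oppr_eq0 (negPf ph1).
pose s1 := (ph * chi)^-1; pose kp := th - s1.
have Ks1 : K s1 by apply: (constant2V h3 hr); apply: (constant2M h3 hr).
have Kkp : K kp by apply: (constant2D h3 hr) => //; apply: (constant2N h3 hr).
pose W3 u := W1 u + kp * W2 u.
have hW3 : derivation W3.
  by split=> u w; rewrite /W3 ?(derD hW1, derD hW2) ?(derM hW1, derM hW2); ring.
have W3E u : W3 u = E u / chi.
  rewrite E_W /W3 /kp /s1; field; rewrite chi0 ph1 //.
have W3K u : K u -> W3 u = 0 by move=> hu; rewrite W3E E_K // mul0r.
have W2K u : K u -> W2 u * ds u0 = ds u * W2 u0.
  move=> hu; have wK w : K w -> W2 w = (eta * dy b + n' * dz b - m * (eta * dy a + n' * dz a)) * d2 w.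
    move=> [_ ]; rewrite edr => /eqP; rewrite addr_eq0 => /eqP hw.
    by rewrite /W2 (fr_dy fr w) (fr_dz fr w) hw; ring.
  by rewrite !wK // !eds; ring.
have W2u0 : W2 u0 != 0.
  apply/eqP=> e0.
  have e2 : eta * dy b + n' * dz b - m * (eta * dy a + n' * dz a) = 0.
    have wK : W2 u0 = (eta * dy b + n' * dz b - m * (eta * dy a + n' * dz a)) * d2 u0.
      have [_ ] := Ku0; rewrite edr => /eqP; rewrite addr_eq0 => /eqP hw.
      by rewrite /W2 (fr_dy fr u0) (fr_dz fr u0) hw; ring.
    move/eqP: e0; rewrite wK mulf_eq0 => /orP[/eqP //|/eqP e1].
    by move: ph1; rewrite -oppr_eq0 -dsu0 eds e1 mulr0 eqxx.
  have W2E w : W2 w = W2 a * dr w.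
    rewrite edr /W2 (fr_dy fr w) (fr_dz fr w).
    by apply: (eq_lc1 (k := d2 w) e2); ring.
  have W2X1 : W2 X1 = 0.
    have [e4 e5 e6 _] := C_W; have [_ ry rz] := C_r; have [_ ey ez] := e4; have [_ n'y n'z] := e5.
    have [k0 [[_ k0y k0z] ->]] : exists k0, C k0 /\ X1 = eta * z - n' * y + r * x - k0.
      by eexists; split; [exact: C_k0|exact: X1E].
    rewrite /W2 !(derD (dery cs), derD (derz cs)) !(derN (dery cs), derN (derz cs)).
    rewrite k0y k0z !(derM (dery cs), derM (derz cs)) ey ez n'y n'z ry rz.
    by rewrite (dyx cs) (dyy cs) (dyz cs) (dzx cs) (dzy cs) (dzz cs); ring.
  have W2a0 : W2 a != 0.
    apply/eqP=> W2a; have := W2E y; have := W2E z; rewrite W2a !mul0r /W2.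
    rewrite (dyy cs) (dyz cs) (dzy cs) (dzz cs) !mulr0 !mulr1 add0r addr0 => e4 e5.
    by move: W2_neq0; rewrite e4 e5 eqxx.
  have drX1 : dr X1 = 0.
    by apply: (mulfI W2a0); rewrite -W2E W2X1 mulr0.
  have := E_x; rewrite /E drx drX1 !mul0r mulr0 subrr => /esym/eqP.
  by rewrite (negPf chi0).
(* [W2 u0] is a polynomial in [x] over the constants of [W3], and its inverse is
   one of degree at most one, so both are constants of [W3] *)
have Ckp : C kp.
  have e1 : W3 (W2 u0) = - W2 kp * W2 u0.
    have e1 : W3 (W2 u0) = W2 (W3 u0) - W2 kp * W2 u0.
      by rewrite /W3 W12 (derD hW2) (derM hW2); ring.
    by rewrite e1 W3K // (der0 hW2); ring.
  have e2 := W2K _ Kkp.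
  have e3 : W3 (W2 u0)^-1 = ds kp / ds u0.
    rewrite (derV hW3) e1; apply: (mulIf (expf_neq0 2 W2u0)).
    have ds0 : ds u0 != 0 by rewrite dsu0 oppr_eq0.
    apply: (mulIf ds0).
    by apply: (eq_lc1 (k := W2 u0) e2); field; rewrite W2u0 ds0.
  have Kq : K (ds kp / ds u0).
    by apply: (constant2M h3 hr); [apply: Kds|apply: (constant2V h3 hr); apply: Kds].
  have W3x : W3 x = 1.
    by rewrite W3E E_x divff.
  have W3C k : C k -> W3 k = 0 by move=> /KC; apply: W3K.
  have lin w : W3 (W3 w) = 0 -> polyrep W3 x w.
    move=> hw; have -> : w = W3 w * x + (w - W3 w * x) by ring.
    apply: (polyrepD hW3).
      by apply: (polyrepM hW3); [apply: polyrepC|apply: polyrepX].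
    by apply: (polyrepC _ hW3); rewrite (derB hW3) (derM hW3) hw W3x; ring.
  have r1 : polyrep W3 x (W2 u0).
    apply: (polyfun_polyrep hW3 W3C) (O_W2 O_u0); apply: lin; apply: W3K; rewrite W3E.
    - by rewrite E_x; apply: (constant2M h3 hr) => //; apply: (constant2V h3 hr).
    - rewrite E_y; apply: (constant2M h3 hr); last exact: (constant2V h3 hr).
      apply: (constant2D h3 hr); first exact: (constant2M h3 hr).
      by apply: (constant2N h3 hr); apply: (constant2M h3 hr) => //; apply: KC.
    rewrite E_z; apply: (constant2M h3 hr); last exact: (constant2V h3 hr).
    apply: (constant2D h3 hr); first exact: (constant2M h3 hr).
    by apply: (constant2N h3 hr); apply: (constant2M h3 hr).
  have r2 : polyrep W3 x (W2 u0)^-1 by apply: lin; rewrite e3 W3K.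
  have W3x0 : W3 x != 0 by rewrite W3x oner_neq0.
  have e4 : W3 (W2 u0) = 0.
    by apply: (polyrep_unit char0 hW3 W3x0 r1 r2); rewrite divff.
  apply: K_C => //; apply/eqP; have := e4; rewrite e1 mulNr => /eqP.
  rewrite oppr_eq0 mulf_eq0 (negPf W2u0) orbF => /eqP e5.
  by move: e2; rewrite e5 mul0r => /esym/eqP; rewrite mulf_eq0 (negPf W2u0) orbF.
have [Oh2 M_h2 drh2] := h2'_facts.
have Eh : E (h2' - kp * a) = s1 / X1.
  rewrite (derB hE) (E_Km _ Kkp) Ea /E M_h2 drh2 /kp; ring.
have e1 : X1 * W3 (h2' - kp * a) = s1 / chi.
  by rewrite W3E Eh; field; rewrite X1_neq0 chi0.
have s1E : s1 / chi = ph * s1 ^+ 2 by rewrite /s1; field; rewrite chi0 ph1.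
have Cs : C (s1 / chi).
  rewrite s1E; apply: K_C.
    by apply: (constant2M h3 hr) => //; apply: (constant2X h3 hr).
  have dss1 : ds s1 = 1.
    have := dsC Ckp; rewrite /kp (derB hs) dsth => /eqP.
    by rewrite subr_eq0 => /eqP.
  have : ds ph * s1 = - 2 * ph.
    rewrite -[ds ph]opprK -psi1_ph /s1 /chi; have psi10 : psi1 != 0.
      by apply: contraNneq chi0; rewrite /chi => ->; rewrite mul0r.
    by field; rewrite psi10 ph1 n2.
  rewrite (derM hs) (derX2 hs) dss1 => e2.
  by apply: (eq_lc1 (k := s1) e2); ring.
have Oh : O (W3 (h2' - kp * a)).
  have Ohk : O (h2' - kp * a).
    by apply: polyfunB => //; apply: PolyfunM => //; apply: polyfun_C.
  apply: PolyfunD; first exact: O_W1.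
  by apply: PolyfunM; [apply: polyfun_C|apply: O_W2].
rewrite -e1 in Cs; have := X1_no_unit Oh Cs; rewrite e1 => /eqP.
by rewrite /s1 mulf_eq0 !invr_eq0 mulf_eq0 (negPf ph1) (negPf chi0).
Qed.

End Exceptional.

End Ruling.

(** The sign of the square root [om] is chosen so that [N] is divisible by [t]. *)
Lemma asymptotic_direction : exists om nu n,
  [/\ om ^+ 2 = W, d3 om = 0, d3 nu = 0, nu != 0
    & N = nu * (A + (om - d2 P) / d2 Q * B) ^+ n.+1].
Proof.
have [om om2 M_om] := asymptotic_rational.
have [nu [n [a1 a2 [e1|e1]]]] :=
  N_monomial om2 M_om erefl erefl erefl erefl erefl; first by exists om, nu, n.
exists (- om), nu, n; split; rewrite ?sqrrN //.
by rewrite (derN h3) M_om oppr0.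
Qed.

End RankTwo.

(** * The normals of the image *)

Lemma rank_one : d2 Q != 0 -> d1 P * d2 Q = d2 P ^+ 2 -> gauss_dependent.
Proof.
move=> Q2 Delta0.
have [m em] : exists m, m = - d2 P / d2 Q by eexists.
pose dr u := d1 u + m * d2 u.
have [m2|m2] := eqVneq (d2 m) 0.
  exact: (rank_one_constant_ruling Q2 Delta0 em (dr := dr)).
exfalso; have [c0|c0] := eqVneq (dr c) 0.
  exact: (@planes_absurd Q2 Delta0 m dr em (fun _ => erefl) m2 _ _ _ erefl
    (fun _ => erefl) erefl c0).
exact: (@parabolas_absurd Q2 Delta0 m dr em (fun _ => erefl) m2 _ _ _ erefl
  (fun _ => erefl) erefl c0 _ _ erefl erefl).
Qed.

Lemma rank_two : d2 Q != 0 -> d1 P * d2 Q != d2 P ^+ 2 -> False.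
Proof.
move=> Q2; rewrite eq_sym -subr_eq0 => Delta0.
have [/(line_pair_absurd Delta0)//|kap0] := eqVneq conic_level 0.
have [om [nu [n [om2 M_om M_nu nu0 eNt]]]] := asymptotic_direction Q2 Delta0 kap0.
have [m em] : exists m, m = (om - d2 P) / d2 Q by eexists.
have [mu emu] : exists mu, mu = (- om - d2 P) / d2 Q by eexists.
have [t et] : exists t, t = A + m * B by eexists.
have [t' et'] : exists t, t = A + mu * B by eexists.
have [dr edr] : exists dr : L -> L, forall u, dr u = d1 u + m * d2 u by eexists.
have [dq edq] : exists dq : L -> L, forall u, dq u = d1 u + mu * d2 u by eexists.
rewrite -em -et in eNt.
have [kap ekap] : exists kap, kap = conic_level / d2 Q by eexists.
have [G [eta [G0 M_G drG eeta eta_case]]] :=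
  @ruling_scale Q2 Delta0 kap0 om m mu t t' kap om2 M_om em emu et et' ekap nu n _ _ _ dr dq
   M_nu eNt erefl edr edq erefl erefl _ erefl.
have [ds eds] : exists ds : L -> L, forall u, ds u = G * d2 u by eexists.
have C_eta : C eta.
  by case: eta_case => [->|[-> _]]; [apply: constant3_1 cs|apply: constant3_0 cs].
have [al0 z10] := @quadric_exceptional Q2 Delta0 kap0 om m mu t t' kap om2 M_om em emu et et'
  ekap nu n _ _ _ dr dq M_nu eNt erefl edr edq erefl erefl _ erefl G eta ds
  G0 M_G drG eeta C_eta eds _ _ _ _ _ _ _ _ _ _ _ _ _ _ _ erefl erefl erefl erefl
  erefl erefl erefl erefl erefl erefl erefl erefl erefl erefl erefl.
have absurd := fun th h2' => @exceptional_absurd Q2 Delta0 kap0 om m mu t t' kap om2 M_om em emu et et'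
  ekap nu n _ _ _ dr dq M_nu eNt erefl edr edq erefl erefl _ erefl G eta ds
  G0 M_G drG eeta C_eta eds _ _ _ _ _ _ _ _ _ _ _ _ _ _ _ erefl erefl erefl erefl
  erefl erefl erefl erefl erefl erefl erefl erefl erefl erefl erefl al0 z10 th h2'.
case: eta_case => eta1.
  by apply: (absurd m b _ _ erefl _ erefl); left.
by apply: (absurd (P + m * Q) f _ _ erefl _ erefl); right.
Qed.

Lemma gauss_image_linear :
  d2 Q != 0 \/ [/\ d1 P = 0, d2 P = 0 & d2 Q = 0] -> gauss_dependent.
Proof.
case=> [Q2|[P1 P2 Q2]].
  have [Delta|Delta] := eqVneq (d1 P * d2 Q) (d2 P ^+ 2); first exact: rank_one.
  by have := rank_two Q2 Delta.
exists 1, 0, P; rewrite oner_neq0; split=> //.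
- exact: constant3_1 cs.
- exact: constant3_0 cs.
- by apply: d_constant; rewrite ?P1 ?P2 ?M_P.
by rewrite mul1r mul0r addr0.
Qed.

End NilpotentFrame.

(** * From adapted frames to nilpotent polynomial maps *)

Section NilpotentMaps.

Variables (L : fieldType) (char0 : [pchar L] =i pred0).

Definition minor (d e : L -> L) (u w : L) : L := d u * e w - e u * d w.

Record nilpotent_map (dx dy dz : L -> L) (x y z a b f : L) : Prop := NilpotentMap {
  nm_cs : coordinates dx dy dz x y z;
  nm_a : polyfun (constant3 dx dy dz) x y z a;
  nm_b : polyfun (constant3 dx dy dz) x y z b;
  nm_f : polyfun (constant3 dx dy dz) x y z f;
  nm_frac : forall u, exists F G, [/\ polyfun (constant3 dx dy dz) x y z F,
    polyfun (constant3 dx dy dz) x y z G, G != 0 & u = F / G];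
  nm_trace : dx a + dy b + dz f = 0;
  nm_minors : minor dx dy a b + minor dx dz a f + minor dy dz b f = 0;
  nm_det : dx f * minor dy dz a b + dy f * minor dz dx a b + dz f * minor dx dy a b = 0 }.

(** The normals of the image of [(a, b, f)] lie in a fixed plane. *)
Definition normals_planar (dx dy dz : L -> L) (a b f : L) : Prop :=
  exists k1 k2 k3, [/\ constant3 dx dy dz k1, constant3 dx dy dz k2, constant3 dx dy dz k3,
    [|| k1 != 0, k2 != 0 | k3 != 0] &
    [/\ k1 * minor dy dz b f + k2 * minor dy dz f a + k3 * minor dy dz a b = 0,
        k1 * minor dz dx b f + k2 * minor dz dx f a + k3 * minor dz dx a b = 0 &
        k1 * minor dx dy b f + k2 * minor dx dy f a + k3 * minor dx dy a b = 0]].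

Lemma constant3_cycle dx dy dz (c : L) : constant3 dx dy dz c -> constant3 dy dz dx c.
Proof. by case. Qed.

Lemma constant3_swap dx dy dz (c : L) : constant3 dx dy dz c -> constant3 dy dx dz c.
Proof. by case. Qed.

Lemma coordinates_cycle (dx dy dz : L -> L) x y z :
  coordinates dx dy dz x y z -> coordinates dy dz dx y z x.
Proof. by case=> *; split. Qed.

Lemma polyfun_cycle dx dy dz x y z (F : L) :
  polyfun (constant3 dx dy dz) x y z F -> polyfun (constant3 dy dz dx) y z x F.
Proof.
apply: polyfun_sub; try by constructor.
  by move=> c /constant3_cycle; apply: PolyfunC.
all: by move=> *; constructor.
Qed.

Lemma polyfun_swap dx dy dz x y z (F : L) :
  polyfun (constant3 dx dy dz) x y z F -> polyfun (constant3 dy dx dz) y x z F.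
Proof.
apply: polyfun_sub; try by constructor.
  by move=> c /constant3_swap; apply: PolyfunC.
all: by move=> *; constructor.
Qed.

Lemma nilpotent_map_cycle dx dy dz x y z a b f :
  nilpotent_map dx dy dz x y z a b f -> nilpotent_map dy dz dx y z x b f a.
Proof.
case=> [cs Oa Ob Of fr tr mi de]; split; try exact: polyfun_cycle.
- exact: coordinates_cycle.
- move=> u; have [F [G [OF OG G0 ->]]] := fr u.
  by exists F, G; split=> //; apply: polyfun_cycle.
- by rewrite -tr; ring.
- by rewrite -mi /minor; ring.
by rewrite -de /minor; ring.
Qed.

Lemma nilpotent_map_swap dx dy dz x y z a b f :
  nilpotent_map dx dy dz x y z a b f -> nilpotent_map dy dx dz y x z b a f.
Proof.
case=> [cs Oa Ob Of fr tr mi de]; split; try exact: polyfun_swap.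
- by case: cs => *; split.
- move=> u; have [F [G [OF OG G0 ->]]] := fr u.
  by exists F, G; split=> //; apply: polyfun_swap.
- by rewrite -tr; ring.
- by rewrite -mi /minor; ring.
by rewrite -de /minor; ring.
Qed.

Lemma normals_planar_cycle dx dy dz a b f :
  normals_planar dy dz dx b f a -> normals_planar dx dy dz a b f.
Proof.
move=> [k1 [k2 [k3 [c1 c2 c3 k0 [e1 e2 e3]]]]]; exists k3, k1, k2; split.
- by do 2!apply: constant3_cycle.
- by do 2!apply: constant3_cycle.
- by do 2!apply: constant3_cycle.
- by case/or3P: k0 => ->; rewrite ?orbT.
by split; [rewrite -e3|rewrite -e1|rewrite -e2]; ring.
Qed.

Lemma normals_planar_swap dx dy dz a b f :
  normals_planar dy dx dz b a f -> normals_planar dx dy dz a b f.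
Proof.
move=> [k1 [k2 [k3 [c1 c2 c3 k0 [e1 e2 e3]]]]]; exists k2, k1, k3; split.
- exact: constant3_swap.
- exact: constant3_swap.
- exact: constant3_swap.
- by case/or3P: k0 => ->; rewrite ?orbT.
by split; [rewrite -e2|rewrite -e1|rewrite -e3]; rewrite /minor; ring.
Qed.

Section Shear.

Variables (dx dy dz : L -> L) (x y z a b f : L) (d1 d2 d3 : L -> L) (P Q c : L).
Hypothesis nm : nilpotent_map dx dy dz x y z a b f.
Hypothesis fr : adapted_frame dx dy dz x y z a b f d1 d2 d3 P Q c.
Variables (n : nat).
Local Notation l := (n%:R : L).

Let ey u := dy u - l * dx u.

Let cs := nm_cs nm.
Let hx := derx cs. Let hy := dery cs. Let hz := derz cs.

Let he : derivation ey.
Proof. by split=> u w; rewrite /ey ?(derD hx, derD hy) ?(derM hx, derM hy); ring. Qed.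

Lemma shear_coordinates : coordinates dx ey dz (x + l * y) y z.
Proof.
split=> //; rewrite /ey.
- move=> u; rewrite (derB hx) (derM hx) (der_nat hx) (dxdy cs); ring.
- exact: dxdz cs.
- move=> u; rewrite (derB hz) (derM hz) (der_nat hz) (dydz cs) (dxdz cs); ring.
- by rewrite (derD hx) (derM hx) (der_nat hx) (dxx cs) (dxy cs); ring.
- exact: dxy cs.
- exact: dxz cs.
- rewrite (derD hx) (derD hy) (derM hx) (derM hy) (der_nat hx) (der_nat hy).
  by rewrite (dxx cs) (dxy cs) (dyx cs) (dyy cs); ring.
- by rewrite (dyy cs) (dxy cs); ring.
- by rewrite (dyz cs) (dxz cs); ring.
- by rewrite (derD hz) (derM hz) (der_nat hz) (dzx cs) (dzy cs); ring.
- exact: dzy cs.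
exact: dzz cs.
Qed.

Lemma shear_constant k : constant3 dx ey dz k <-> constant3 dx dy dz k.
Proof.
split=> -[e1 e2 e3]; split=> //; last by rewrite /ey e1 e2; ring.
by move: e2; rewrite /ey e1 mulr0 subr0.
Qed.

Lemma shear_polyfun F : polyfun (constant3 dx dy dz) x y z F ->
  polyfun (constant3 dx ey dz) (x + l * y) y z F.
Proof.
apply: polyfun_sub; try by constructor.
- by move=> k /shear_constant; apply: PolyfunC.
- have e : (x + l * y) + - l * y = x by ring.
  rewrite -[X in polyfun _ _ _ _ X]e; apply: PolyfunD; first exact: PolyfunX.
  apply: PolyfunM; last exact: PolyfunY.
  by apply: PolyfunC; split; rewrite (derN, derN) ?(derN hz) ?(derN he) ?(derN hx) ?der_nat ?oppr0.
all: by move=> *; constructor.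
Qed.

Lemma shear_nilpotent_map : nilpotent_map dx ey dz (x + l * y) y z (a + l * b) b f.
Proof.
have [lx ly lz] : [/\ dx l = 0, dy l = 0 & dz l = 0] by split; rewrite der_nat.
have e d : derivation d -> d l = 0 -> d (a + l * b) = d a + l * d b.
  by move=> hd dl; rewrite (derD hd) (derM hd) dl; ring.
split; try exact: shear_polyfun (nm_b nm); try exact: shear_polyfun (nm_f nm).
- exact: shear_coordinates.
- apply: PolyfunD; first exact: shear_polyfun (nm_a nm).
  apply: PolyfunM; last exact: shear_polyfun (nm_b nm).
  by apply: PolyfunC; apply/shear_constant; split.
- move=> u; have [F [G [OF OG G0 ->]]] := nm_frac nm u.
  by exists F, G; split=> //; apply: shear_polyfun.
- by rewrite -(nm_trace nm) /ey e //; ring.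
- by rewrite -(nm_minors nm) /minor /ey !e //; ring.
by rewrite -(nm_det nm) /minor /ey !e //; ring.
Qed.

Lemma shear_transverse : minor ey dz (a + l * b) b =
  minor dy dz a b + l * minor dz dx a b.
Proof.
have [lx ly lz] : [/\ dx l = 0, dy l = 0 & dz l = 0] by split; rewrite der_nat.
have e d : derivation d -> d l = 0 -> d (a + l * b) = d a + l * d b.
  by move=> hd dl; rewrite (derD hd) (derM hd) dl; ring.
by rewrite /minor /ey !e //; ring.
Qed.

Variables (e1 e2 e3 : L -> L) (P' Q' c' : L).
Hypothesis fr' : adapted_frame dx ey dz (x + l * y) y z (a + l * b) b f e1 e2 e3 P' Q' c'.
Hypothesis v0 : minor ey dz (a + l * b) b != 0.

(** On functions of [a] and [b] the new frame is given by the chain rule. *)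
Lemma shear_frame k : d3 k = 0 -> e1 k = d1 k /\ e2 k = d2 k - l * d1 k.
Proof.
move=> M_k.
have [lx ly lz] : [/\ dx l = 0, dy l = 0 & dz l = 0] by split; rewrite der_nat.
have e d : derivation d -> d l = 0 -> d (a + l * b) = d a + l * d b.
  by move=> hd dl; rewrite (derD hd) (derM hd) dl; ring.
have ez : dz (a + l * b) * (e1 k - d1 k) + dz b * (e2 k - (d2 k - l * d1 k)) = 0.
  have := fr_dz fr' k; rewrite (fr_dz fr k) e // => ez.
  by apply: (eq_lc1 (k := -1) ez); ring.
have eey : ey (a + l * b) * (e1 k - d1 k) + ey b * (e2 k - (d2 k - l * d1 k)) = 0.
  have := fr_dy fr' k; rewrite {1}/ey (fr_dy fr k) (fr_dx fr k) M_k !(e _ he) ?(der_nat he) //.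
  by rewrite /ey => eey; apply: (eq_lc1 (k := -1) eey); ring.
have e0 : e1 k - d1 k = 0.
  apply: (mulfI v0); rewrite mulr0 /minor.
  by apply: (eq_lc2 (k := - ey b) (k' := dz b) ez eey); ring.
have e0' : e2 k - (d2 k - l * d1 k) = 0.
  apply: (mulfI v0); rewrite mulr0 /minor.
  by apply: (eq_lc2 (k := ey (a + l * b)) (k' := - dz (a + l * b)) ez eey); ring.
by split; apply/eqP; rewrite -subr_eq0 ?e0 ?e0'.
Qed.

Lemma shear_PQ : [/\ P' = P, Q' = Q - l * P &
  e2 Q' = d2 Q - 2 * l * d2 P + l ^+ 2 * d1 P].
Proof.
have M_P : d3 P = 0 := M_P fr; have M_Q : d3 Q = 0 := M_Q fr.
have [eP eQ] := shear_frame (fr_3f fr).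
rewrite (fr_1f fr) (fr_1f fr') in eP; rewrite (fr_2f fr) (fr_1f fr) (fr_2f fr') in eQ.
split=> //; rewrite eQ (derB (fr_der2 fr')) (derM (fr_der2 fr')) (der_nat (fr_der2 fr')).
have [_ ->] := shear_frame M_P; have [_ ->] := shear_frame M_Q.
by rewrite (d1Q fr); ring.
Qed.

End Shear.

Lemma nat_non_root (p : {poly L}) : p != 0 -> exists n : nat, p.[n%:R] != 0.
Proof.
move=> p0; pose s : seq L := [seq n%:R | n <- iota 0 (size p)].
have us : uniq s.
  rewrite map_inj_uniq ?iota_uniq // => i j.
  wlog ltij : i j / (i < j)%N.
    by move=> h e; case: (ltngtP i j) => // lt; [apply: h|apply/esym/h].
  move=> e; have : (j - i)%:R == 0 :> L by rewrite natrB ?(ltnW ltij) // e subrr.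
  by rewrite -subn_gt0 in ltij; case: (j - i)%N ltij => // k _; rewrite (negPf (natf_neq0 char0 k)).
have : ~~ all (root p) s.
  by apply/negP=> hs; have := max_poly_roots p0 hs us; rewrite size_map size_iota ltnn.
by case/allPn=> _ /mapP[n _ ->] hn; exists n.
Qed.

(** The shear by [n] changes [d2 Q] and the cofactor by polynomials in [n]; if the
    second fundamental form is nonzero, some natural number is a root of neither. *)
Lemma transverse_normals_planar dx dy dz x y z a b f :
  nilpotent_map dx dy dz x y z a b f -> minor dy dz a b != 0 -> normals_planar dx dy dz a b f.
Proof.
move=> nm v0; have cs := nm_cs nm.
have frame dx' dy' dz' x' y' z' a' : nilpotent_map dx' dy' dz' x' y' z' a' b f ->
    minor dy' dz' a' b != 0 -> exists d1 d2 d3 P Q c,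
    adapted_frame dx' dy' dz' x' y' z' a' b f d1 d2 d3 P Q c.
  move=> nm' w0; apply: (frame_exists (nm_cs nm') w0).
    by rewrite -(nm_det nm') /minor; ring.
  by rewrite -(nm_minors nm') /minor; ring.
have [d1 [d2 [d3 [P [Q [c fr]]]]]] := frame _ _ _ _ _ _ _ nm v0.
have key n d1' d2' d3' P' Q' c' :
    adapted_frame dx (fun u => dy u - n%:R * dx u) dz (x + n%:R * y) y z (a + n%:R * b) b f
      d1' d2' d3' P' Q' c' ->
    minor (fun u => dy u - n%:R * dx u) dz (a + n%:R * b) b != 0 ->
    d2' Q' != 0 \/ [/\ d1' P' = 0, d2' P' = 0 & d2' Q' = 0] -> normals_planar dx dy dz a b f.
  move=> fr' v0' h; have nm' := shear_nilpotent_map nm n.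
  have [k1 [k2 [k3 [c1 c2 c3 k0 ek]]]] := gauss_image_linear char0 (nm_cs nm') fr' (nm_a nm')
    (nm_b nm') (nm_f nm') v0' (nm_trace nm') erefl erefl erefl erefl (nm_frac nm') h.
  have [eP eQ _] := shear_PQ nm fr fr' v0'.
  have C_sh k := shear_constant dx dy dz n k.
  exists (k1 - n%:R * k2), k2, k3; split; try exact/C_sh.
  - apply: (constant3D cs); first exact/C_sh.
    apply: (constant3N cs); apply: (constant3M cs); last exact/C_sh.
    exact: (constant3_nat cs).
  - move: k0; have [->|_] := eqVneq k2 0; last by rewrite /= !orbT.
    by rewrite /= orbF mulr0 subr0 => ->.
  rewrite eP eQ in ek; have hdx := fr_dx fr f; have hdy := fr_dy fr f; have hdz := fr_dz fr f.
  rewrite (fr_1f fr) (fr_2f fr) ?(fr_3f fr) ?add0r in hdx hdy hdz.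
  rewrite /minor hdx hdy hdz.
  split.
  - by apply: (eq_lc1 (k := - minor dy dz a b) ek); rewrite /minor; ring.
  - by apply: (eq_lc1 (k := - minor dz dx a b) ek); rewrite /minor; ring.
  by apply: (eq_lc1 (k := - minor dx dy a b) ek); rewrite /minor; ring.
pose q : {poly L} := (minor dy dz a b)%:P + (minor dz dx a b)%:P * 'X.
pose r : {poly L} := (d2 Q)%:P + (- 2 * d2 P)%:P * 'X + (d1 P)%:P * 'X^2.
have q0 : q != 0.
  apply: contraNneq v0 => e; have := congr1 (fun t : {poly L} => t`_0) e.
  by rewrite /q coefD coefC coefCM coefX coef0 /= mulr0 addr0 => ->.
have [r0|r0] := eqVneq r 0.
  have ri i : r`_i = 0 by rewrite r0 coef0.
  have := ri 0%N; have := ri 1%N; have := ri 2%N.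
  rewrite /r !coefD !coefCM !coefC !coefXn !coefX /= !mulr0 !mulr1 !addr0 !add0r => P1 /eqP P2 Q2.
  rewrite mulf_eq0 oppr_eq0 (negPf (natf_neq0 char0 1)) /= in P2.
  have nm0 := shear_nilpotent_map nm 0.
  have v0' : minor (fun u => dy u - 0%:R * dx u) dz (a + 0%:R * b) b != 0.
    by rewrite (shear_transverse nm 0) mul0r addr0.
  have [d1' [d2' [d3' [P' [Q' [c' fr']]]]]] := frame _ _ _ _ _ _ _ nm0 v0'.
  apply: (key 0%N d1' d2' d3' P' Q' c' fr' v0'); right.
  have [eP eQ eQ2] := shear_PQ nm fr fr' v0'.
  have [h1 h2] := shear_frame nm fr fr' v0' (M_P fr).
  by rewrite eQ2 eP h1 h2 P1 (eqP P2) Q2; split; ring.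
have [n] := nat_non_root (mulf_neq0 q0 r0).
rewrite hornerM mulf_eq0 negb_or /q /r !(hornerD, hornerM, hornerC, hornerX, hornerXn).
move=> /andP[qn rn]; have nmn := shear_nilpotent_map nm n.
have v0' : minor (fun u => dy u - n%:R * dx u) dz (a + n%:R * b) b != 0.
  by rewrite (shear_transverse nm n) mulrC.
have [d1' [d2' [d3' [P' [Q' [c' fr']]]]]] := frame _ _ _ _ _ _ _ nmn v0'.
apply: (key n d1' d2' d3' P' Q' c' fr' v0'); left.
have [_ _ ->] := shear_PQ nm fr fr' v0'.
by apply: contraNneq rn => e; apply/eqP; rewrite -[RHS]e; ring.
Qed.

(** The determinant and the trace of the cofactor matrix vanish, so the cofactor
    matrix cannot be diagonal and nonzero; a permutation of the coordinates moves
    an off-diagonal cofactor to the position used above. *)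
Lemma nilpotent_normals_planar dx dy dz x y z a b f :
  nilpotent_map dx dy dz x y z a b f -> normals_planar dx dy dz a b f.
Proof.
move=> nm; have T := @transverse_normals_planar.
have nm_c := nilpotent_map_cycle nm; have nm_cc := nilpotent_map_cycle nm_c.
have [m31|] := eqVneq (minor dy dz a b) 0; last exact: T nm.
have [m12|h] := eqVneq (minor dz dx b f) 0; last first.
  by apply: normals_planar_cycle; apply: T nm_c h.
have [m13|h] := eqVneq (minor dy dx f b) 0; last first.
  by apply: normals_planar_cycle; apply: normals_planar_swap; apply: T (nilpotent_map_swap nm_c) h.
have [m21|h] := eqVneq (minor dz dy a f) 0; last first.
  apply: normals_planar_cycle; apply: normals_planar_cycle; apply: normals_planar_swap.
  by apply: T (nilpotent_map_swap nm_cc) h.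
have mi := nm_minors nm; have de := nm_det nm.
have d12 : minor dy dz b f * minor dz dx f a = 0.
  apply: (eq_lc2 (k := dz f) (k' := minor dz dx b f) de m21).
  by rewrite /minor; ring.
have d13 : minor dy dz b f * minor dx dy a b = 0.
  apply: (eq_lc2 (k := dy b) (k' := minor dx dy b f) de m31).
  by rewrite /minor; ring.
have m11 : minor dy dz b f = 0.
  apply/eqP; rewrite -[_ == 0]orbb -mulf_eq0; apply/eqP.
  apply: (eq_lc3 (k := minor dy dz b f) (k' := -1) (k'' := -1) mi d12 d13).
  by rewrite /minor; ring.
exists 1, 0, 0; rewrite oner_neq0 m11 m12; have c1 := constant3_1 (nm_cs nm).
have c0 := constant3_0 (nm_cs nm); split=> //.
have m13' : minor dx dy b f = 0 by rewrite -m13 /minor; ring.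
by rewrite m13'; split; ring.
Qed.

End NilpotentMaps.

(** * The field of rational functions *)

Section QuotientRule.

Variables (F : fieldType) (p q r s p' q' r' s' : F).

Lemma quotient_rule_add : q != 0 -> s != 0 ->
  ((p' * s + p * s' + (r' * q + r * q')) * (q * s) - (p * s + r * q) * (q' * s + q * s'))
    / (q * s * (q * s)) =
  (p' * q - p * q') / (q * q) + (r' * s - r * s') / (s * s).
Proof. by move=> q0 s0; field; rewrite q0 s0. Qed.

Lemma quotient_rule_mul : q != 0 -> s != 0 ->
  ((p' * r + p * r') * (q * s) - p * r * (q' * s + q * s')) / (q * s * (q * s)) =
  (p' * q - p * q') / (q * q) * (r / s) + p / q * ((r' * s - r * s') / (s * s)).
Proof. by move=> q0 s0; field; rewrite q0 s0. Qed.

Lemma quotient_rule_comm (p1 q1 p2 q2 p12 q12 : F) : q != 0 ->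
  ((p12 * q + p2 * q1 - (p1 * q2 + p * q12)) * (q * q)
     - (p2 * q - p * q2) * (q1 * q + q * q1)) / (q * q * (q * q)) =
  ((p12 * q + p1 * q2 - (p2 * q1 + p * q12)) * (q * q)
     - (p1 * q - p * q1) * (q2 * q + q * q2)) / (q * q * (q * q)).
Proof. by move=> q0; field. Qed.

End QuotientRule.

Section RationalFunctions.

Variables (K : fieldType) (n : nat).
Local Notation R := {mpoly K[n]}.
Local Notation L := {fraction {mpoly K[n]}}.
Local Notation "p %:F" := (@FracField.tofrac {mpoly K[n]} p).

Lemma tofrac_neq0 (q : R) : q != 0 -> q%:F != 0.
Proof. by rewrite tofrac_eq0. Qed.

Lemma fraction_numden (u : L) : u = (\n_(repr u))%:F / (\d_(repr u))%:F.
Proof.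
have d0 := tofrac_neq0 (denom_ratioP (repr u)).
apply: (mulIf d0); rewrite divfK //.
rewrite -{1}[u]reprK; move: (repr u) => {u d0} w.
unlock FracField.tofrac; rewrite -[LHS]FracField.pi_mul; apply/eqmodP.
rewrite /= FracField.equivfE /FracField.mulf !numden_Ratio ?mulf_neq0 ?oner_neq0 ?denom_ratioP //.
by rewrite !mulr1 mulrC.
Qed.

(** The quotient rule, applied to a chosen representative. *)
Definition partial (i : 'I_n) (u : L) : L :=
  let p := \n_(repr u) in let q := \d_(repr u) in
  (p^`M(i) * q - p * q^`M(i))%:F / (q * q)%:F.

Lemma partial_quotient i (p q : R) : q != 0 ->
  partial i (p%:F / q%:F) = (p^`M(i) * q - p * q^`M(i))%:F / (q * q)%:F.
Proof.
move=> q0; rewrite /partial; set u := p%:F / q%:F.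
have := fraction_numden u; have := denom_ratioP (repr u).
move: (\n_ _) (\d_ _) => p' q' q'0 e.
have e1 : p * q' = p' * q.
  apply/eqP; rewrite -tofrac_eq !tofracM -eqr_div ?tofrac_neq0 //.
  by apply/eqP.
have e2 := congr1 (mderiv i) e1; rewrite !mderivM in e2.
apply/eqP; rewrite eqr_div ?tofrac_neq0 ?mulf_neq0 // -!tofracM tofrac_eq; apply/eqP.
by apply: (eq_lc2 (k := q^`M(i) * q' + q * q'^`M(i)) (k' := - q * q') e1 e2); ring.
Qed.

Lemma fraction_ind (P : L -> Prop) :
  (forall p q : R, q != 0 -> P (p%:F / q%:F)) -> forall u, P u.
Proof. by move=> h u; rewrite (fraction_numden u); apply/h/denom_ratioP. Qed.

Lemma partial_derivation i : derivation (partial i).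
Proof.
split; elim/fraction_ind=> p q q0; elim/fraction_ind=> r s s0;
  have q1 := tofrac_neq0 q0; have s1 := tofrac_neq0 s0; have qs0 := mulf_neq0 q0 s0.
  rewrite (addf_div _ _ q1 s1) -!tofracM -tofracD.
  rewrite (partial_quotient _ _ qs0) (partial_quotient _ _ q0) (partial_quotient _ _ s0).
  rewrite !(mderivD, mderivM) !(tofracB, tofracD, tofracM).
  by rewrite (quotient_rule_add _ _ _ _ _ _ q1 s1).
rewrite mulf_div -!tofracM.
rewrite (partial_quotient _ _ qs0) (partial_quotient _ _ q0) (partial_quotient _ _ s0).
rewrite !mderivM !(tofracB, tofracD, tofracM).
by rewrite (quotient_rule_mul _ _ _ _ _ _ q1 s1).
Qed.

Lemma partial_tofrac i (p : R) : partial i p%:F = (p^`M(i))%:F.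
Proof.
have -> : p%:F = p%:F / (1 : R)%:F by rewrite tofrac1 divr1.
rewrite partial_quotient ?oner_neq0 // -mpolyC1 mderivC mulr0 subr0 !mpolyC1 !mulr1.
by rewrite tofrac1 divr1.
Qed.

Lemma partial_comm i j u : partial i (partial j u) = partial j (partial i u).
Proof.
elim/fraction_ind: u => p q q0; have q1 := tofrac_neq0 q0; have qq := mulf_neq0 q0 q0.
rewrite (partial_quotient j p q0) (partial_quotient i p q0) !(partial_quotient _ _ qq).
rewrite !(mderivB, mderivM) (mderiv_comm i j p) (mderiv_comm i j q).
rewrite !(tofracB, tofracD, tofracM); by rewrite (quotient_rule_comm _ _ _ _ _ _ _ q1).
Qed.

Lemma partialX i j : partial i ('X_j)%:F = (i == j)%:R.
Proof.
rewrite partial_tofrac mderivX mnm1E eq_sym; case: eqVneq => [->|_].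
  by rewrite scale1r -{1}[U_(j)%MM]add0m addmK mpolyX0 tofrac1.
by rewrite scale0r tofrac0.
Qed.

Hypothesis char0 : [pchar K] =i pred0.

Lemma fraction_char0 : [pchar L] =i pred0.
Proof.
move=> p; rewrite inE /=; apply: contraFF (char0 p) => /andP[pp].
rewrite -(rmorph_nat (@FracField.tofrac {mpoly K[n]})) tofrac_eq0 -mpolyC_nat mpolyC_eq0 => p0.
by rewrite inE pp p0.
Qed.

Lemma msize_mderiv_lt i (p : R) : p^`M(i) != 0 -> (msize p^`M(i) < msize p)%N.
Proof.
move=> p'0; have : (0 < msize p)%N.
  by rewrite lt0n msize_poly_eq0; apply: contraNneq p'0 => ->; rewrite mderiv0.
move=> p_gt0; rewrite -(prednK p_gt0) ltnS msizeE; apply/bigmax_leqP_seq=> m hm _.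
have : (m + U_(i))%MM \in msupp p.
  move: hm; rewrite !mcoeff_msupp mcoeff_deriv; apply: contraNneq => ->.
  by rewrite mul0rn.
move/msize_mdeg_lt; rewrite mdegD mdeg1 addn1.
by move: (msize p) (mdeg m); clear; lia.
Qed.

Lemma mderiv0_mpolyC (p : R) : (forall i, p^`M(i) = 0) -> exists c, p = c%:MP.
Proof.
move=> h; exists p@_0; apply/mpolyP=> m; rewrite mcoeffC.
have [->|m0] := eqVneq m 0%MM; first by rewrite mulr1.
rewrite mulr0.
have [i mi] : exists i, m i != 0%N.
  apply/existsP; apply: contraNT m0; rewrite negb_exists => /forallP hm.
  by apply/eqP/mnmP=> i; rewrite mnm0E; apply/eqP; rewrite -[_ == _]negbK.
have em : m = (m - U_(i) + U_(i))%MM.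
  by rewrite submK // lep1mP.
have := congr1 (fun q : R => q@_(m - U_(i))%MM) (h i); rewrite mcoeff_deriv mcoeff0 -em.
by move/eqP; rewrite -mulr_natr mulf_eq0 (negPf (natf_neq0 char0 _)) orbF => /eqP.
Qed.

(** A denominator of least degree of a constant fraction is constant, since
    numerator and denominator may be replaced by their derivatives. *)
Lemma partial0_constant (u : L) : (forall i, partial i u = 0) -> exists c : K, u = (c%:MP)%:F.
Proof.
elim/fraction_ind: u => p q q0; have [k] := ubnP (msize q).
elim: k p q q0 => // k ih p q q0 sq hu.
have e i : p^`M(i) * q = p * q^`M(i).
  have := hu i; rewrite partial_quotient // => /eqP.
  rewrite mulf_eq0 invr_eq0 !tofrac_eq0 mulf_eq0 (negPf q0) !orbF subr_eq0.
  by move/eqP.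
have [/existsP[i qi]|] := boolP [exists i, q^`M(i) != 0].
  have eu : p%:F / q%:F = (p^`M(i))%:F / (q^`M(i))%:F.
    by apply/eqP; rewrite eqr_div ?tofrac_neq0 // -!tofracM -e.
  have := ih p^`M(i) q^`M(i) qi; rewrite -eu; apply=> //.
  by rewrite -ltnS; apply: leq_trans sq; rewrite ltnS; apply: msize_mderiv_lt.
rewrite negb_exists => /forallP hq.
have [c ec] : exists c, q = c%:MP.
  by apply: mderiv0_mpolyC => i; apply/eqP; rewrite -[_ == _]negbK.
have c0 : c != 0 by move: q0; rewrite ec mpolyC_eq0.
have [c' ec'] : exists c', p = c'%:MP.
  apply: mderiv0_mpolyC => i; apply: (mulIf q0); rewrite mul0r e ec mderivC mulr0 //.
exists (c' / c); have c1 := tofrac_neq0 q0.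
by apply: (mulIf c1); rewrite divfK // ec ec' -tofracM -mpolyCM divfK.
Qed.

End RationalFunctions.

Section NilpotentMatrices.

Variable F : fieldType.

(** The characteristic polynomial divides a power of the indeterminate. *)
Lemma nilpotent_mx_trace n (A : 'M[F]_n.+1) k : A ^+ k = 0 -> \tr A = 0.
Proof.
move=> Ak; pose X : 'M[{poly F}]_n.+1 := 'X%:M; pose B := map_mx polyC A.
have XB : GRing.comm X B by apply/esym/eqP; rewrite /GRing.comm /X; apply/eqP; exact: scalar_mxC.
have Bk : B ^+ k = 0 by rewrite /B -rmorphXn Ak rmorph0.
have := congr1 determinant (subrXX_comm k XB).
rewrite Bk subr0 /X -rmorphXn /= det_scalar det_mulmx -/(char_poly_mx A) -/(char_poly A) -exprM.
set q := \det _ => e.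
have : char_poly A %| ('X - 0%:P) ^+ (k * n.+1) by rewrite subr0 e dvdp_mulr.
case/dvdp_exp_XsubCP=> m _; rewrite subr0 => eqm.
have {}eqm : char_poly A = 'X^m.
  by apply/eqP; rewrite -eqp_monic ?char_poly_monic ?monicXn.
have := size_char_poly A; rewrite eqm size_polyXn => -[em].
have := @char_poly_trace _ _ A (ltn0Sn n); rewrite eqm em coefXn /=.
by rewrite eqn_leq ltnn andbF => /esym/eqP; rewrite oppr_eq0 => /eqP.
Qed.

Lemma nilpotent_mx_det n (A : 'M[F]_n.+1) k : A ^+ k = 0 -> \det A = 0.
Proof.
move=> Ak; have dk : \det (A ^+ k) = \det A ^+ k.
  elim: k {Ak} => [|k ih]; first by rewrite !expr0 det1.
  by rewrite !exprS det_mulmx ih.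
by apply/eqP; rewrite Ak det0 in dk; move/esym/eqP: dk; rewrite expf_eq0 => /andP[].
Qed.

Lemma nilpotent_mx3 (A : 'M[F]_3) (i0 := ord0 : 'I_3) (i1 := lift ord0 ord0 : 'I_3)
    (i2 := lift ord0 (lift ord0 ord0) : 'I_3) k :
  (2 : F) != 0 -> A ^+ k = 0 ->
  [/\ A i0 i0 + A i1 i1 + A i2 i2 = 0,
      A i0 i0 * A i1 i1 - A i0 i1 * A i1 i0 + (A i0 i0 * A i2 i2 - A i0 i2 * A i2 i0)
        + (A i1 i1 * A i2 i2 - A i1 i2 * A i2 i1) = 0 &
      A i2 i0 * (A i0 i1 * A i1 i2 - A i0 i2 * A i1 i1)
        + A i2 i1 * (A i0 i2 * A i1 i0 - A i0 i0 * A i1 i2)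
        + A i2 i2 * (A i0 i0 * A i1 i1 - A i0 i1 * A i1 i0) = 0].
Proof.
move=> n2 Ak; have AA : (A ^+ 2) ^+ k = 0 by rewrite exprAC Ak expr0n.
have := nilpotent_mx_trace Ak; have := nilpotent_mx_trace AA; have := nilpotent_mx_det Ak.
rewrite /mxtrace !big_ord_recl !big_ord0 expr2 !mxE !big_ord_recl !big_ord0 -/i0 -/i1 -/i2.
rewrite (expand_det_row _ i0) !big_ord_recl big_ord0 /cofactor.
rewrite !(expand_det_row _ ord0) !big_ord_recl !big_ord0 /cofactor !det_mx11 !mxE /= => dt tr2 tr.
pose g s t := A (inord s) (inord t); have AE i j : A i j = g i j by rewrite /g !inord_val.
move: dt tr2 tr; rewrite !AE /= /bump /= => dt tr2 tr; split.
    by apply: (eq_lc1 (k := 1) tr); ring.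
  apply: (mulfI n2).
  apply: (eq_lc2 (k := g 0%N 0%N + g 1%N 1%N + g 2%N 2%N) (k' := -1) tr tr2).
  by ring.
by apply: (eq_lc1 (k := 1) dt); ring.
Qed.

End NilpotentMatrices.

(** * Polynomial maps of three-space *)

Lemma cross_product_combination (F : fieldType) (c1 c2 c3 c1' c2' c3' s k1 k2 k3
    a1 b1 f1 a2 b2 f2 : F) :
  c2 * c3' - c3 * c2' = s * k1 -> c3 * c1' - c1 * c3' = s * k2 -> c1 * c2' - c2 * c1' = s * k3 ->
  k1 * (b1 * f2 - b2 * f1) + k2 * (f1 * a2 - f2 * a1) + k3 * (a1 * b2 - a2 * b1) = 0 ->
  (c1 * a1 + c2 * b1 + c3 * f1) * (c1' * a2 + c2' * b2 + c3' * f2)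
    - (c1 * a2 + c2 * b2 + c3 * f2) * (c1' * a1 + c2' * b1 + c3' * f1) = 0.
Proof.
move=> e1 e2 e3 n0; apply: (eq_lc4 (k1 := b1 * f2 - b2 * f1) (k2 := f1 * a2 - f2 * a1)
  (k3 := a1 * b2 - a2 * b1) (k4 := s) e1 e2 e3 n0).
by ring.
Qed.

Section ThreeSpace.

Variables (K : fieldType) (char0 : [pchar K] =i pred0).
Local Notation R := {mpoly K[3]}.
Local Notation L := {fraction {mpoly K[3]}}.
Local Notation "p %:F" := (@FracField.tofrac {mpoly K[3]} p).
Local Notation i0 := (ord0 : 'I_3).
Local Notation i1 := (lift ord0 ord0 : 'I_3).
Local Notation i2 := (lift ord0 (lift ord0 ord0) : 'I_3).
Local Notation dx := (@partial K 3 i0).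
Local Notation dy := (@partial K 3 i1).
Local Notation dz := (@partial K 3 i2).
Local Notation x := (('X_i0 : R)%:F).
Local Notation y := (('X_i1 : R)%:F).
Local Notation z := (('X_i2 : R)%:F).
Local Notation C := (constant3 dx dy dz).

Lemma ord3_cases (P : 'I_3 -> Prop) : P i0 -> P i1 -> P i2 -> forall i, P i.
Proof.
move=> h0 h1 h2 i.
case: i => -[|[|[|//]]] hi.
- by have -> : Ordinal hi = i0 by apply: val_inj.
- by have -> : Ordinal hi = i1 by apply: val_inj.
by have -> : Ordinal hi = i2 by apply: val_inj.
Qed.

Lemma partial_coordinates : coordinates dx dy dz x y z.
Proof.
have d1 i : partial i ('X_i : R)%:F = 1 by rewrite partialX eqxx.
have d0 i j : i != j -> partial i ('X_j : R)%:F = 0 by move=> ij; rewrite partialX (negPf ij).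
have cc i j (u : L) : partial i (partial j u) = partial j (partial i u) := partial_comm i j u.
have hd i : derivation (partial i) := @partial_derivation K 3 i.
exact (Coordinates (hd i0) (hd i1) (hd i2) (cc i0 i1) (cc i0 i2) (cc i1 i2)
  (d1 i0) (d0 i0 i1 isT) (d0 i0 i2 isT) (d0 i1 i0 isT) (d1 i1) (d0 i1 i2 isT)
  (d0 i2 i0 isT) (d0 i2 i1 isT) (d1 i2)).
Qed.

Lemma partial_constantP u : C u <-> exists c : K, u = (c%:MP)%:F.
Proof.
split=> [[h0 h1 h2]|[c ->]].
  by apply: (partial0_constant char0); apply: ord3_cases.
by split; rewrite partial_tofrac mderivC tofrac0.
Qed.

Lemma tofrac_polyfun (p : R) : polyfun C x y z p%:F.
Proof.
have cC c : polyfun C x y z (c%:MP)%:F by apply/PolyfunC/partial_constantP; exists c.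
have Xn (u : R) k : polyfun C x y z u%:F -> polyfun C x y z (u ^+ k)%:F.
  move=> hu; elim: k => [|k ih]; first by rewrite expr0 -mpolyC1.
  by rewrite exprS tofracM; apply: PolyfunM.
elim/mpolyind: p => [|c m p _ _ ih]; first by rewrite -mpolyC0.
rewrite tofracD; apply: PolyfunD => //; rewrite -mul_mpolyC tofracM; apply: PolyfunM => //.
have -> : ('X_[m])%:F =
    (('X_i0 : R) ^+ m i0)%:F * ((('X_i1 : R) ^+ m i1)%:F * ((('X_i2 : R) ^+ m i2)%:F * 1)).
  by rewrite ['X_[m]]mpolyXE_id !big_ord_recl big_ord0 !tofracM tofrac1.
apply: PolyfunM; first by apply: Xn; exact: PolyfunX.
apply: PolyfunM; first by apply: Xn; exact: PolyfunY.
apply: PolyfunM; first by apply: Xn; exact: PolyfunZ.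
by rewrite -tofrac1 -mpolyC1.
Qed.

Lemma nilpotent_jacobian_map (H : 'I_3 -> R) : nilpotent_mx (jacobian H) ->
  nilpotent_map dx dy dz x y z (H i0)%:F (H i1)%:F (H i2)%:F.
Proof.
case=> k Jk; pose A := map_mx (@FracField.tofrac R) (jacobian H).
have Ak : A ^+ k = 0 by rewrite /A -rmorphXn Jk rmorph0.
have AE i j : A i j = partial j (H i)%:F by rewrite !mxE partial_tofrac.
have n2 := natf_neq0 (fraction_char0 3 char0) 1.
have [tr mi dt] := nilpotent_mx3 n2 Ak; rewrite !AE in tr mi dt.
apply: NilpotentMap tr mi dt; try exact: tofrac_polyfun.
  exact: partial_coordinates.
move=> u; exists (\n_(repr u))%:F, (\d_(repr u))%:F; split; try exact: tofrac_polyfun.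
  exact/tofrac_neq0/denom_ratioP.
exact: fraction_numden.
Qed.

(** The monomials are indexed by a single number below [b * b], read in base [b]. *)
Lemma alg_dependent_relation (p q : R) b k (r : nat -> L) : (k < b * b)%N ->
  (forall i, (i <= k)%N -> C (r i)) -> r k = 1 ->
  \sum_(i < k.+1) r i * (p%:F ^+ (i %/ b)%N * q%:F ^+ (i %% b)%N) = 0 -> alg_dependent p q.
Proof.
move=> ltkb Cr rk rel.
have ex (i : 'I_k.+1) : exists c : K, r i = (c%:MP)%:F.
  by apply/partial_constantP/Cr; rewrite -ltnS.
have [c ec] := fin_all_exists ex.
pose m (i : 'I_k.+1) : 'X_{1..2} := Multinom [tuple (i %/ b)%N; (i %% b)%N].
have mI i : m i = m ord_max -> i = ord_max.
  move=> e; have e0 := congr1 (fun t : 'X_{1..2} => t ord0) e.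
  have e1 := congr1 (fun t : 'X_{1..2} => t (lift ord0 ord0)) e.
  rewrite /m !multinomE !(tnth_nth 0%N) /= in e0 e1.
  by apply: val_inj; rewrite /= (divn_eq i b) e0 e1 -divn_eq.
exists (\sum_(i < k.+1) c i *: 'X_[m i]).
  apply: contraNneq (oner_neq0 K) => e.
  have := congr1 (fun t : {mpoly K[2]} => t@_(m ord_max)) e.
  rewrite raddf_sum (bigD1 ord_max) //= big1 => [|i ik]; last first.
    rewrite mcoeffZ mcoeffX (negPf (contraNneq _ ik)) ?mulr0 // => /mI -> //.
  rewrite mcoeffZ mcoeffX eqxx mulr1 addr0 mcoeff0 => ck.
  by have := ec ord_max; rewrite /= rk ck mpolyC0 tofrac0 => /eqP; rewrite oner_eq0.
apply/eqP; rewrite -(tofrac_eq0 (_ \mPo _)); apply/eqP; rewrite -[RHS]rel linear_sum rmorph_sum /=.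
apply: eq_bigr => i _.
rewrite comp_mpolyZ comp_mpolyX !big_ord_recl big_ord0 /m !multinomE !(tnth_nth 0) /= mulr1.
by rewrite -mul_mpolyC !tofracM !tofracXn ec.
Qed.

Lemma parallel_alg_dependent (p q : R) :
  minor dx dy p%:F q%:F = 0 -> minor dy dz p%:F q%:F = 0 -> minor dz dx p%:F q%:F = 0 ->
  alg_dependent p q.
Proof.
move=> m12 m23 m31; have cs := partial_coordinates.
have cs1 := coordinates_cycle cs; have cs2 := coordinates_cycle cs1.
have Op := tofrac_polyfun p; have Oq := tofrac_polyfun q.
have eqm (s t : L) : s - t = 0 -> s = t by move/eqP; rewrite subr_eq0 => /eqP.
have c0 := fraction_char0 3 char0.
have [px|px] := eqVneq (dx p%:F) 0; last first.
  have [b [k [r [h1 h2 h3 h4]]]] := parallel_gradients_dependent c0 cs Op Oq px (eqm _ _ m12)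
    (esym (eqm _ _ m31)).
  exact: alg_dependent_relation h1 h2 h3 h4.
have Op1 := polyfun_cycle Op; have Oq1 := polyfun_cycle Oq.
have [py|py] := eqVneq (dy p%:F) 0; last first.
  have [b [k [r [h1 h2 h3 h4]]]] := parallel_gradients_dependent c0 cs1 Op1 Oq1 py (eqm _ _ m23)
    (esym (eqm _ _ m12)).
  apply: alg_dependent_relation h1 _ h3 h4 => i /h2.
  by do 2!move/constant3_cycle.
have Op2 := polyfun_cycle Op1; have Oq2 := polyfun_cycle Oq1.
have [pz|pz] := eqVneq (dz p%:F) 0; last first.
  have [b [k [r [h1 h2 h3 h4]]]] := parallel_gradients_dependent c0 cs2 Op2 Oq2 pz (eqm _ _ m31)
    (esym (eqm _ _ m23)).
  by apply: alg_dependent_relation h1 _ h3 h4 => i /h2 /constant3_cycle.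
have [c /eqP] : exists c : K, p%:F = (c%:MP)%:F by apply/partial_constantP; split.
rewrite tofrac_eq => /eqP ep.
exists ('X_ord0 - c%:MP).
  apply/eqP=> /(congr1 (fun t : {mpoly K[2]} => t@_(U_(ord0)))) /eqP.
  rewrite mcoeffB mcoeffC mcoeff0 mcoeffXU eqxx mnm1_eq0 mulr0 subr0.
  by rewrite oner_eq0.
by rewrite comp_mpolyB comp_mpolyXU comp_mpolyC /= ep subrr.
Qed.

Lemma free_pair (l1 l2 : 'rV[K]_3) i j : l1 0 i * l2 0 j != l1 0 j * l2 0 i -> free [:: l1; l2].
Proof.
move=> h; rewrite free_cons free_cons span_seq1 span_nil nil_free memv0 andbT.
have [e|l20] /= := eqVneq l2 0; first by move: h; rewrite e !mxE !mulr0 eqxx.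
rewrite andbT; apply: contraNN h => /vlineP[c ->]; rewrite !mxE.
by apply/eqP; ring.
Qed.

Definition row3 (c1 c2 c3 : K) : 'rV[K]_3 := \row_(i < 3) [:: c1; c2; c3]`_i.

Lemma linear_form_row3 (c1 c2 c3 : K) (H : 'I_3 -> R) :
  (linear_form_app (row3 c1 c2 c3) H)%:F =
  (c1%:MP)%:F * (H i0)%:F + (c2%:MP)%:F * (H i1)%:F + (c3%:MP)%:F * (H i2)%:F.
Proof.
by rewrite /linear_form_app !big_ord_recl big_ord0 !mxE /= addr0 addrA -!mul_mpolyC
  !tofracD !tofracM.
Qed.

(** The cross product of two linear forms orthogonal to [k] is a multiple of [k]. *)
Lemma orthogonal_forms_dependent (H : 'I_3 -> R) (k1 k2 k3 s c1 c2 c3 c1' c2' c3' : K) :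
  let nrm d e := (k1%:MP)%:F * minor d e (H i1)%:F (H i2)%:F
    + (k2%:MP)%:F * minor d e (H i2)%:F (H i0)%:F + (k3%:MP)%:F * minor d e (H i0)%:F (H i1)%:F in
  nrm dx dy = 0 -> nrm dy dz = 0 -> nrm dz dx = 0 ->
  c2 * c3' - c3 * c2' = s * k1 -> c3 * c1' - c1 * c3' = s * k2 -> c1 * c2' - c2 * c1' = s * k3 ->
  alg_dependent (linear_form_app (row3 c1 c2 c3) H) (linear_form_app (row3 c1' c2' c3') H).
Proof.
move=> nrm n1 n2 n3 e1 e2 e3.
have cst (c : K) i : partial i (c%:MP)%:F = 0 by rewrite partial_tofrac mderivC tofrac0.
have lin i (s1 s2 s3 : K) (a b f : L) : partial i ((s1%:MP)%:F * a + (s2%:MP)%:F * b + (s3%:MP)%:F * f) =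
    (s1%:MP)%:F * partial i a + (s2%:MP)%:F * partial i b + (s3%:MP)%:F * partial i f.
  have hd := @partial_derivation K 3 i.
  by rewrite !(derD hd) !(derM hd) !cst !mul0r !add0r.
have toF (c c' d d' r : K) : c * c' - d * d' = r ->
    (c%:MP)%:F * (c'%:MP)%:F - (d%:MP)%:F * (d'%:MP)%:F = (r%:MP)%:F.
  by move=> <-; rewrite -!tofracM -tofracB -!mpolyCM -mpolyCB.
have {}e1 := toF _ _ _ _ _ e1; have {}e2 := toF _ _ _ _ _ e2; have {}e3 := toF _ _ _ _ _ e3.
rewrite !mpolyCM !tofracM in e1 e2 e3.
have key i j : nrm (partial i) (partial j) = 0 -> minor (partial i) (partial j)
    (linear_form_app (row3 c1 c2 c3) H)%:F (linear_form_app (row3 c1' c2' c3') H)%:F = 0.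
  rewrite /nrm /minor !linear_form_row3 !lin => n0.
  exact: cross_product_combination e1 e2 e3 n0.
by apply: parallel_alg_dependent; apply: key.
Qed.

End ThreeSpace.

Theorem theorem3p1 (K : fieldType) (charK0 : [pchar K] =i pred0)
    (H : 'I_3 -> {mpoly K[3]})
    (H0 : forall i : 'I_3, (H i).@[fun _ => 0] = 0)
    (JH_nilp : nilpotent_mx (jacobian H))
    (H_indep : components_lin_indep H) :
  exists l1 l2 : 'rV[K]_3,
    free [:: l1; l2] /\
    alg_dependent (linear_form_app l1 H) (linear_form_app l2 H).
Proof.
have nm := nilpotent_jacobian_map charK0 JH_nilp.
have [_ [_ [_ [/(partial_constantP charK0)[k1 ->] /(partial_constantP charK0)[k2 ->]
  /(partial_constantP charK0)[k3 ->]]]]] := nilpotent_normals_planar (fraction_char0 3 charK0) nm.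
rewrite !tofrac_eq0 !mpolyC_eq0 => k0 [n1 n2 n3].
have dep := @orthogonal_forms_dependent K charK0 H k1 k2 k3 _ _ _ _ _ _ _ n3 n1 n2.
case/or3P: k0 => k0.
- exists (row3 (- k2) k1 0), (row3 (- k3) 0 k1); split.
    apply: (@free_pair _ _ _ (lift ord0 ord0) (lift ord0 (lift ord0 ord0))).
    by rewrite !mxE /= mul0r mulf_neq0.
  by apply: (dep k1); ring.
- exists (row3 0 (- k3) k2), (row3 k2 (- k1) 0); split.
    apply: (@free_pair _ _ _ (lift ord0 (lift ord0 ord0)) ord0).
    by rewrite !mxE /= mul0r mulf_neq0.
  by apply: (dep k2); ring.
exists (row3 k3 0 (- k1)), (row3 0 k3 (- k2)); split.
  apply: (@free_pair _ _ _ ord0 (lift ord0 ord0)).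
  by rewrite !mxE /= mul0r mulf_neq0.
by apply: (dep k3); ring.
Qed.
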